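(* Let $(X_t,Y_t)$ be the Brownian swapping process with swap rate $s>0$ started at a deterministic point $(x_0,y_0)\in\mathbb{R}^2$ (described in the context). For every $\tau\ge0$ the centred auto- and cross-correlations satisfy, as $t\to\infty$, $$\rho_{XX}(\tau):=\lim_{t\to\infty}\mathrm{Corr}(X_t,X_{t+\tau})=\frac{e^{-2s\tau}(\mu_1-\mu_2)^2+(\sigma_1^2+\sigma_2^2)s(1+e^{-2s\tau})}{(\mu_1-\mu_2)^2+2s(\sigma_1^2+\sigma_2^2)},$$ $$\rho_{XY}(\tau):=\lim_{t\to\infty}\mathrm{Corr}(X_t,Y_{t+\tau})=\frac{(\sigma_1^2+\sigma_2^2)s(1-e^{-2s\tau})-(\mu_1-\mu_2)^2e^{-2s\tau}}{(\mu_1-\mu_2)^2+2s(\sigma_1^2+\sigma_2^2)}.$$ In particular the dependence on $\tau$ is through $e^{-2s\tau}$ (correlation time $(2s)^{-1}$), $\rho_{XX}(0)=1$, and $\rho_{XY}(0)=\lim_{t\to\infty}\mathrm{Corr}(X_t,Y_t)=-\frac{\eta}{1+\eta}$ with $\eta=\frac{(\mu_1-\mu_2)^2}{2s(\sigma_1^2+\sigma_2^2)}$.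
   Context: The Brownian swapping process with parameters $\mu_1,\mu_2\in\mathbb{R}$, $\sigma_1,\sigma_2>0$, $s>0$ is the càdlàg Markov process $(X,Y)$ on $\mathbb{R}^2$ with $\mathrm{d}X_t=\mu_1\mathrm{d}t+\sigma_1\mathrm{d}W^1_t+(Y_{t-}-X_{t-})\mathrm{d}\mathcal{N}_t$, $\mathrm{d}Y_t=\mu_2\mathrm{d}t+\sigma_2\mathrm{d}W^2_t+(X_{t-}-Y_{t-})\mathrm{d}\mathcal{N}_t$, $(X_0,Y_0)=(x_0,y_0)$, where $W^1,W^2$ are independent standard one-dimensional Brownian motions and $\mathcal{N}$ is an independent Poisson process of rate $s$ (at each jump of $\mathcal{N}$ the two coordinates are exchanged). $\mathrm{Corr}(A,B)=\mathrm{Cov}(A,B)/\sqrt{\mathrm{Var}(A)\mathrm{Var}(B)}$. Here $\tau$ is a time lag. *)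

(* Defs.v *)
From HB Require Import structures.
From mathcomp Require Import all_boot all_order all_algebra.
From mathcomp Require Import all_classical all_reals all_analysis.

Set Implicit Arguments.
Unset Strict Implicit.
Unset Printing Implicit Defensive.
Import Order.TTheory GRing.Theory Num.Theory.
Import numFieldNormedType.Exports.
Local Open Scope classical_set_scope.
Local Open Scope ring_scope.

(* Processes are families of random variables indexed by all of R; only the
   times t >= 0 are ever constrained. *)

Definition independent_systems (d : measure_display) (T : measurableType d)
    (R : realType) (P : probability T R) (I : finType)
    (F : I -> set (set T)) : Prop :=
  forall (J : {set I}) (A : I -> set T), (forall i, i \in J -> F i (A i)) ->
    P (\bigcap_(i in [set` J]) A i) = (\prod_(i in J) P (A i))%E.

Definition sigma_of_rv (d d' : measure_display) (T : measurableType d)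
    (T' : measurableType d') (X : T -> T') : set (set T) :=
  preimage_set_system setT X measurable.

Definition sigma_of_process (d d' : measure_display) (T : measurableType d)
    (T' : measurableType d') (R : realType) (Z : R -> T -> T') :
    set (set T) :=
  <<s \bigcup_(t in [set t : R | 0 <= t]) sigma_of_rv (Z t) >>.

Definition independent_increments (d : measure_display) (T : measurableType d)
    (R : realType) (P : probability T R) (Z : R -> T -> R) : Prop :=
  forall (n : nat) (t : nat -> R), 0 <= t 0 ->
    (forall i, (i < n)%N -> t i <= t i.+1) ->
    independent_systems P
      (fun i : 'I_n => sigma_of_rv (fun w => Z (t i.+1) w - Z (t i) w)).

Definition cadlag (R : realType) (f : R -> R) : Prop :=
  (forall t : R, 0 <= t -> f u @[u --> t^'+] --> f t) /\
  (forall t : R, 0 < t -> cvg (f u @[u --> t^'-])).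

Definition left_limit (R : realType) (f : R -> R) (t : R) : R :=
  lim (f u @[u --> t^'-]).

Definition brownian_motion (d : measure_display) (T : measurableType d)
    (R : realType) (P : probability T R) (W : R -> {RV P >-> R}) : Prop :=
  [/\ {ae P, forall w, W 0 w = 0},
      {ae P, forall w,
        {within `[0 : R, +oo[, continuous (fun t : R => W t w)}},
      independent_increments P (fun t => W t) &
      forall a b : R, 0 <= a -> a < b -> forall B : set R, measurable B ->
        P ((W b \- W a) @^-1` B) = normal_prob 0 (Num.sqrt (b - a)) B].

Definition poisson_process (d : measure_display) (T : measurableType d)
    (R : realType) (P : probability T R) (rate : R)
    (N : R -> {RV P >-> nat}) : Prop :=
  [/\ {ae P, forall w, N 0 w = 0%N},
      {ae P, forall w,
        (forall a b : R, 0 <= a -> a <= b -> (N a w <= N b w)%N) /\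
        cadlag (fun t => (N t w)%:R : R)},
      independent_increments P (fun t w => (N t w)%:R) &
      forall a b : R, 0 <= a -> a < b -> forall k : nat,
        P [set w | N b w = (N a w + k)%N]
        = (poisson_pmf (rate * (b - a)) k)%:E].

(* The pathwise integral of h over ]0, t] against dn, for a counting path n.
   The sum is finitely supported because a cadlag integer-valued path has
   finitely many jumps in ]0, t]. *)
Definition counting_integral (R : realType) (h n : R -> R) (t : R) : R :=
  \sum_(u \in `]0, t]) h u * (n u - left_limit n u).

Definition brownian_swapping_process (d : measure_display)
    (T : measurableType d) (R : realType) (P : probability T R)
    (mu1 mu2 sigma1 sigma2 s x0 y0 : R)
    (W1 W2 : R -> {RV P >-> R}) (N : R -> {RV P >-> nat})
    (X Y : R -> {RV P >-> R}) : Prop :=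
  [/\ [/\ brownian_motion W1, brownian_motion W2 & poisson_process s N],
      independent_systems P (fun i : 'I_3 =>
        tnth [tuple sigma_of_process W1; sigma_of_process W2;
                    sigma_of_process N] i),
      {ae P, forall w, cadlag (fun t => X t w) /\ cadlag (fun t => Y t w)},
      {ae P, forall w, X 0 w = x0 /\ Y 0 w = y0} &
      {ae P, forall w, let x := fun t : R => X t w in
        let y := fun t : R => Y t w in
        let n := fun t : R => (N t w)%:R : R in
        forall t : R, 0 <= t ->
          x t = x 0 + mu1 * t + sigma1 * W1 t w
            + counting_integral (fun u => left_limit y u - left_limit x u) n t
          /\
          y t = y 0 + mu2 * t + sigma2 * W2 t w
            + counting_integral (fun u => left_limit x u - left_limit y u) n t}].

Definition corr (d : measure_display) (T : measurableType d) (R : realType)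
    (P : probability T R) (A B : T -> R) : R :=
  fine (covariance P A B) / Num.sqrt (fine 'V_P[A] * fine 'V_P[B]).

Definition limit_corr (d : measure_display) (T : measurableType d)
    (R : realType) (P : probability T R) (A B : R -> T -> R) (tau : R) : R :=
  lim (corr P (A t) (B (t + tau)) @[t --> +oo]).

(* rho relaxes exponentially to a constant, with time constant theta. *)
Definition has_correlation_time (R : realType) (rho : R -> R) (theta : R) :
    Prop :=
  exists a b : R, b != 0 /\
    forall tau : R, 0 <= tau -> rho tau = a + b * expR (- (tau / theta)).

(* Main.v *)
Require Import Defs.
From HB Require Import structures.
From mathcomp Require Import all_boot all_order all_algebra.
From mathcomp Require Import all_classical all_reals all_analysis.
From mathcomp Require Import measurable_realfun zify ring lra.
Import Order.TTheory GRing.Theory Num.Theory.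
Import numFieldNormedType.Exports.
Local Open Scope classical_set_scope.
Local Open Scope ring_scope.

(** The sum [X + Y] does not see the swaps: it is a drift plus the noise
    [S = sigma1 W1 + sigma2 W2]. The difference [D = X - Y] changes sign at each
    swap, so its product with the parity [eps t = (-1) ^ N t] does not jump, and
    [eps t * D t = D 0 + M t] where [M t] is the integral over [0, t] of [eps]
    against [Z t = (mu1 - mu2) t + sigma1 W1 t - sigma2 W2 t]. Hence, up to
    deterministic terms, [2 X] and [2 Y] are [S + eps (M + D 0)] and
    [S - eps (M + D 0)] ([ae_components]).

    The parity is independent of the Brownian motions, and
    [E (eps a * eps b) = exp (- 2 s |b - a|)] because the number of swaps between
    two times is a Poisson variable ([E_parity2]). Write [m = mu1 - mu2] and
    [v = sigma1 ^ 2 + sigma2 ^ 2]. Then, for [u >= t],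
    - [E (S t ^ 2) = v t] ([E_noise_sum_sqr]);
    - [E (eps t * eps u * M t ^ 2)] is [exp (- 2 s (u - t))] times [v t] plus
      [m ^ 2] times the double integral of [exp (- 2 s |r - r'|)] over
      [[0, t] ^ 2], that is [(m ^ 2 / s + v) t + O(1)]
      ([E_parity_signed_diff_sqr]);
    - [E (eps u * M t)] and [E (S t * eps u * M t)] are bounded, because the
      parity at time [u] only remembers a bounded stretch of the integral
      ([E_parity_signed_diff_le]);
    - what [S] and [M] add between [t] and [t + tau] is bounded in quadratic mean
      ([E_remainder_le]).
    So four times the covariance of two coordinates at times [t] and [t + tau] is
    [t (v + exp (- 2 s tau) (m ^ 2 / s + v))] for equal coordinates and
    [t (v - exp (- 2 s tau) (m ^ 2 / s + v))] for different ones, up to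
    [O (sqrt t)] ([cov_component_asymptotics]). The limits of the correlations
    are the ratios of these rates to the rate of the variances.

    No stochastic integral is constructed. [M] is by definition
    [eps D - eps 0 * D 0], and it is the almost sure limit of its Riemann sums
    along grids with [K * 2 ^ p] cells ([riemann_sums_cvg]): almost surely no cell
    contains two swaps once [p] is large, and a cell with a swap contributes an
    error of at most twice the oscillation of the continuous path [Z] over it.
    The second moments of Riemann sums are explicit by independence; Fatou's
    lemma turns them into bounds on the increments of [M] ([signed_diff_incr]) and
    into the convergence of the Riemann sums in quadratic mean ([ito_sum_cvg]),
    so that all moments and bounds of [M] above come from Riemann sums. *)

(** * Expectations and covariances of square integrable variables *)
Section expectations.
Context {d : measure_display} {T : measurableType d} {R : realType}.
Variable P : probability T R.
Implicit Types f g : T -> R.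

Local Notation E f := (Rintegral P setT f).
Local Notation L1 f := (f \in Lfun P 1).
Local Notation L2 f := (f \in Lfun P 2%:E).

Lemma L1_measurable f : L1 f -> measurable_fun setT f.
Proof. by rewrite inE => /andP[+ _]; rewrite inE. Qed.

Lemma L2_measurable f : L2 f -> measurable_fun setT f.
Proof. by rewrite inE => /andP[+ _]; rewrite inE. Qed.

Lemma L1D f g : L1 f -> L1 g -> L1 (fun w => f w + g w).
Proof. exact: rpredD. Qed.

Lemma L1B f g : L1 f -> L1 g -> L1 (fun w => f w - g w).
Proof. exact: rpredB. Qed.

Lemma L1Z c f : L1 f -> L1 (fun w => c * f w).
Proof.
move=> f1; rewrite (_ : (fun w => _) = c \o* f); first exact: Lfun_scale.
by apply/funext => w /=; rewrite mulrC.
Qed.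

Lemma L1_cst c : L1 (fun _ => c).
Proof. exact: Lfun_cst. Qed.

Lemma L1_sum (I : Type) (r : seq I) (Q : pred I) (F : I -> T -> R) :
  (forall i, Q i -> L1 (F i)) -> L1 (fun w => \sum_(i <- r | Q i) F i w).
Proof.
move=> F1; have -> : (fun w => \sum_(i <- r | Q i) F i w)
    = \sum_(i <- r | Q i) F i by apply/funext => w; rewrite fct_sumE.
exact: rpred_sum.
Qed.

Lemma L2D f g : L2 f -> L2 g -> L2 (fun w => f w + g w).
Proof. by move=> f2 g2; rewrite (_ : (fun w => _) = f + g)// rpredD ?lee1n. Qed.

Lemma L2B f g : L2 f -> L2 g -> L2 (fun w => f w - g w).
Proof. by move=> f2 g2; rewrite (_ : (fun w => _) = f - g)// rpredB ?lee1n. Qed.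

Lemma L2Z c f : L2 f -> L2 (fun w => c * f w).
Proof.
move=> f2; rewrite (_ : (fun w => _) = c \o* f).
  by apply: Lfun_scale => //; rewrite ler1n.
by apply/funext => w /=; rewrite mulrC.
Qed.

Lemma L2_cst c : L2 (fun _ => c).
Proof. exact: Lfun_cst. Qed.

Lemma L2_sum (I : Type) (r : seq I) (Q : pred I) (F : I -> T -> R) :
  (forall i, Q i -> L2 (F i)) -> L2 (fun w => \sum_(i <- r | Q i) F i w).
Proof.
move=> F2; have -> : (fun w => \sum_(i <- r | Q i) F i w)
    = \sum_(i <- r | Q i) F i by apply/funext => w; rewrite fct_sumE.
by rewrite rpred_sum ?lee1n.
Qed.

Lemma L2_L1 f : L2 f -> L1 f.
Proof. by apply: Lfun_subset12; exact: fin_num_measure. Qed.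

Lemma L2M_L1 f g : L2 f -> L2 g -> L1 (fun w => f w * g w).
Proof. exact: Lfun2_mul_Lfun1. Qed.

Lemma ED f g : L1 f -> L1 g -> E (fun w => f w + g w) = E f + E g.
Proof. by move=> /Lfun1_integrable ? /Lfun1_integrable ?; rewrite RintegralD. Qed.

Lemma EB f g : L1 f -> L1 g -> E (fun w => f w - g w) = E f - E g.
Proof. by move=> /Lfun1_integrable ? /Lfun1_integrable ?; rewrite RintegralB. Qed.

Lemma EZ c f : L1 f -> E (fun w => c * f w) = c * E f.
Proof. by move=> /Lfun1_integrable ?; rewrite RintegralZl. Qed.

Lemma E_cst c : E (fun _ => c) = c.
Proof. by rewrite Rintegral_cst// [X in fine X](_ : _ = 1%E) ?mulr1//; exact: probability_setT. Qed.

Lemma E_sum (I : Type) (r : seq I) (Q : pred I) (F : I -> T -> R) :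
  (forall i, Q i -> L1 (F i)) ->
  E (fun w => \sum_(i <- r | Q i) F i w) = \sum_(i <- r | Q i) E (F i).
Proof.
move=> F1; elim: r => [|i r IH].
  by under eq_Rintegral do rewrite big_nil; rewrite E_cst big_nil.
rewrite big_cons; under eq_Rintegral do rewrite big_cons.
case: ifPn => Qi //; rewrite ED ?IH//; [exact: F1|exact: L1_sum].
Qed.

Lemma E_le f g : L1 f -> L1 g -> (forall w, f w <= g w) -> E f <= E g.
Proof.
by move=> /Lfun1_integrable ? /Lfun1_integrable ? fg; apply: le_Rintegral.
Qed.

Lemma E_ge0 f : (forall w, 0 <= f w) -> 0 <= E f.
Proof. by move=> f0; apply: Rintegral_ge0. Qed.

Lemma E_norm_le f M : L1 f -> (forall w, `|f w| <= M) -> `|E f| <= M.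
Proof.
move=> f1 fM; apply: le_trans (le_normr_Rintegral _ _) _ => //.
  exact/Lfun1_integrable.
by rewrite -[leRHS](E_cst M); apply: E_le => //; [exact: Lfun_norm|exact: L1_cst].
Qed.

Lemma L1_integralP f : measurable_fun setT f ->
  (\int[P]_w `|f w|%:E < +oo)%E -> L1 f.
Proof.
move=> mf fi; apply/Lfun1_integrable/integrableP; split => //.
exact/measurable_EFinP.
Qed.

Lemma L2P f : measurable_fun setT f -> L1 (fun w => f w ^+ 2) -> L2 f.
Proof.
move=> mf f1; rewrite inE; apply/andP; split; rewrite inE//=.
rewrite /finite_norm unlock poweR_lty//.
have /Lfun1_integrable/integrable_lty := f1.
move=> /(_ measurableT); apply: le_lt_trans; rewrite le_eqVlt; apply/orP; left.
by apply/eqP; apply: eq_integral => w _ /=; rewrite powR_mulrn// real_normK ?num_real.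
Qed.

Lemma L2_sqr f : L2 f -> L1 (fun w => f w ^+ 2).
Proof. by move=> /Lfun2_integrable_sqr/Lfun1_integrable. Qed.

Lemma bounded_L2 f M : measurable_fun setT f -> (forall w, `|f w| <= M) -> L2 f.
Proof.
move=> mf fM; apply: L2P => //; apply: L1_integralP.
  exact: measurable_funX.
apply: (@le_lt_trans _ _ (\int[P]_w (M ^+ 2)%:E))%E; last first.
  by have /Lfun1_integrable/integrable_lty := L1_cst (M ^+ 2); apply.
apply: ge0_le_integral => //.
  - apply/measurable_EFinP; apply: measurableT_comp => //; exact: measurable_funX.
  - by move=> w _; rewrite lee_fin normrX lerXn2r ?nnegrE// (le_trans _ (fM w)).
Qed.

Lemma bounded_mul_L1 f g M : measurable_fun setT f -> (forall w, `|f w| <= M) ->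
  L1 g -> L1 (fun w => f w * g w).
Proof.
move=> mf fM g1; have mg := L1_measurable _ g1.
apply/Lfun1_integrable.
apply: (@le_integrable _ _ _ P setT _ _ (EFin \o (fun w => M * g w))) => //=.
- by apply/measurable_EFinP; exact: measurable_funM.
- move=> w _; rewrite lee_fin !normrM ler_wpM2r// (le_trans (fM w))//.
  exact: ler_norm.
- exact/Lfun1_integrable/L1Z.
Qed.

Lemma bounded_mul_L2 f g M : measurable_fun setT f -> (forall w, `|f w| <= M) ->
  L2 g -> L2 (fun w => f w * g w).
Proof.
move=> mf fM g2; have mg := L2_measurable _ g2.
apply: L2P; first exact: measurable_funM.
under eq_fun do rewrite exprMn.
apply: (@bounded_mul_L1 _ _ (M ^+ 2)).
- exact: measurable_funX.
- by move=> w; rewrite normrX lerXn2r ?nnegrE// (le_trans _ (fM w)).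
- exact: L2_sqr.
Qed.

(** The quadratic [E (f + x g)^2] in [x] is nonnegative. *)
Lemma cauchy_schwarz f g : L2 f -> L2 g ->
  E (fun w => f w * g w) ^+ 2 <= E (fun w => f w ^+ 2) * E (fun w => g w ^+ 2).
Proof.
move=> f2 g2; set a := E (fun w => f w ^+ 2); set c := E (fun w => g w ^+ 2).
set b := E _.
have quad x : 0 <= c * x ^+ 2 + 2 * b * x + a.
  have -> : c * x ^+ 2 + 2 * b * x + a = E (fun w => (f w + x * g w) ^+ 2).
    transitivity (E (fun w => x ^+ 2 * g w ^+ 2
        + (2 * x * (f w * g w) + f w ^+ 2))).
      have fg1 := L2M_L1 _ _ f2 g2.
      have h1 := L1Z (x ^+ 2) _ (L2_sqr _ g2).
      have h2 := L1Z (2 * x) _ fg1.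
      rewrite ED//; last by apply: L1D => //; exact: L2_sqr.
      by rewrite ED ?EZ//; [rewrite -/a -/b -/c; ring|exact: L2_sqr|exact: L2_sqr].
    by apply: eq_Rintegral => w _; ring.
  by apply: E_ge0 => w; exact: sqr_ge0.
have a0 : 0 <= a by apply: E_ge0 => w; exact: sqr_ge0.
have c0 : 0 <= c by apply: E_ge0 => w; exact: sqr_ge0.
have [c00|cn0] := eqVneq c 0.
  rewrite c00 mulr0; have [->|b0] := eqVneq b 0; first by rewrite expr0n.
  have := quad (- (a + 1) / (2 * b)); rewrite c00 mul0r add0r.
  rewrite (_ : 2 * b * (- (a + 1) / (2 * b)) + a = - 1); first by lra.
  by field.
have := quad (- b / c).
rewrite (_ : _ + _ + a = (a * c - b ^+ 2) / c); last by field.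
by rewrite pmulr_lge0 ?invr_gt0 ?lt_def ?cn0// subr_ge0.
Qed.

Lemma E_sqrD_le f g : L2 f -> L2 g ->
  E (fun w => (f w + g w) ^+ 2)
    <= 2 * E (fun w => f w ^+ 2) + 2 * E (fun w => g w ^+ 2).
Proof.
move=> f2 g2; have f1 := L2_sqr _ f2; have g1 := L2_sqr _ g2.
rewrite -!EZ// -ED; [|exact: L1Z|exact: L1Z].
apply: E_le; first exact/L2_sqr/L2D.
  by apply: L1D; exact: L1Z.
by move=> w; rewrite -subr_ge0 (_ : _ - _ = (f w - g w) ^+ 2) ?sqr_ge0//; ring.
Qed.

(** Quadratic bounds pass to almost sure limits by Fatou's lemma; this is how the
    bounds on Riemann sums reach the integral against the parity. *)
Lemma fatou_L2 (F : nat -> T -> R) f C : (forall n, L2 (F n)) ->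
  measurable_fun setT f ->
  {ae P, forall w, F n w @[n --> \oo] --> f w} ->
  (forall n, E (fun w => F n w ^+ 2) <= C) ->
  L2 f /\ E (fun w => f w ^+ 2) <= C.
Proof.
move=> F2 mf Ff FC.
have mF n : measurable_fun setT (F n) := L2_measurable _ (F2 n).
have le_C : (\int[P]_w (f w ^+ 2)%:E <= C%:E)%E.
  apply: (@le_trans _ _ (\int[P]_w limn_einf (fun n => (F n w ^+ 2)%:E)))%E.
    rewrite le_eqVlt; apply/orP; left; apply/eqP.
    apply: ae_eq_integral => //.
    - by apply/measurable_EFinP; exact: measurable_funX.
    - apply: (emeasurable_fun_cvg
        (fun n w => einfs (fun k => (F k w ^+ 2)%:E) n)) => [n|w _].
        apply: measurable_fun_einfs => k.
        by apply/measurable_EFinP; exact: measurable_funX.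
      by rewrite limn_einf_lim; exact: is_cvg_einfs.
    - apply: filterS Ff => w Fw _; apply/esym.
      have Fw2 : (F n w ^+ 2)%:E @[n --> \oo] --> (f w ^+ 2)%:E.
        by apply: cvg_EFin; [exact: nearW|exact: cvgM].
      by rewrite limn_einf_lim; apply: cvg_lim => //; exact: cvg_einfs.
  apply: le_trans (fatou _ _ _ _) _ => //.
  - by move=> n; apply/measurable_EFinP; exact: measurable_funX.
  - by move=> n w _; rewrite lee_fin sqr_ge0.
  rewrite limn_einf_lim; apply: lime_le; first exact: is_cvg_einfs.
  apply: nearW => n.
  apply: (@le_trans _ _ (\int[P]_w (F n w ^+ 2)%:E)%E).
    by apply: ereal_inf_lbound; exists n => /=.
  have /Lfun1_integrable/integrable_fin_num := L2_sqr _ (F2 n).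
  by move=> /(_ measurableT) Ffin; rewrite -(fineK Ffin) lee_fin; exact: FC.
have f1 : L1 (fun w => f w ^+ 2).
  apply: L1_integralP; first exact: measurable_funX.
  under eq_integral do rewrite ger0_norm ?sqr_ge0//.
  exact: le_lt_trans le_C (ltry _).
split; first exact: L2P.
have /Lfun1_integrable/integrable_fin_num := f1.
by move=> /(_ measurableT) Ffin; rewrite -lee_fin fineK.
Qed.

(** The error is the scalar product of [g] with [f - A n], which the
    Cauchy-Schwarz inequality bounds. *)
Lemma L2_cvg_dot (A : nat -> T -> R) f g : L2 g -> L2 f -> (forall n, L2 (A n)) ->
  E (fun w => (f w - A n w) ^+ 2) @[n --> \oo] --> 0 ->
  E (fun w => g w * A n w) @[n --> \oo] --> E (fun w => g w * f w).
Proof.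
move=> g2 f2 A2 Af; have B2 n := L2B _ _ f2 (A2 n).
pose b n := Num.sqrt (E (fun w => g w ^+ 2) * E (fun w => (f w - A n w) ^+ 2)).
have b0 : b n @[n --> \oo] --> (0 : R).
  rewrite -sqrtr0 -(mulr0 (E (fun w => g w ^+ 2))).
  apply: (@continuous_cvg _ _ _ _ _ _ Num.sqrt); first exact: sqrt_continuous.
  by apply: cvgM => //; exact: cvg_cst.
have err : E (fun w => g w * (f w - A n w)) @[n --> \oo] --> (0 : R).
  apply/norm_cvg0P; apply: (squeeze_cvgr _ (cvg_cst 0) b0).
  apply: nearW => n; rewrite normr_ge0/= /b -sqrtr_sqr ler_sqrt.
    exact: cauchy_schwarz.
  by rewrite mulr_ge0// E_ge0// => w; exact: sqr_ge0.
rewrite (_ : (fun n => E (fun w => g w * A n w)) = (fun n =>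
    E (fun w => g w * f w) - E (fun w => g w * (f w - A n w)))).
  rewrite -[X in _ --> X]subr0; apply: cvgB => //; exact: cvg_cst.
apply/funext => n; have g1 := L2M_L1 _ _ g2 f2.
rewrite -EB//; last exact: L2M_L1.
by apply: eq_Rintegral => w _; ring.
Qed.

(** As [A n ^ 2 = 2 f (A n) - f ^ 2 + (f - A n) ^ 2], the convergence of scalar
    products suffices. *)
Lemma L2_cvg_sqr (A : nat -> T -> R) f g : measurable_fun setT g ->
  (forall w, `|g w| <= 1) -> L2 f -> (forall n, L2 (A n)) ->
  E (fun w => (f w - A n w) ^+ 2) @[n --> \oo] --> 0 ->
  E (fun w => g w * A n w ^+ 2) @[n --> \oo] --> E (fun w => g w * f w ^+ 2).
Proof.
move=> mg g1 f2 A2 Af; have B2 n := L2B _ _ f2 (A2 n).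
have gf2 : L2 (fun w => g w * f w) by exact: (bounded_mul_L2 _ _ 1).
have dot := L2_cvg_dot A f _ gf2 f2 A2 Af.
have gB1 n : L1 (fun w => g w * (f w - A n w) ^+ 2).
  by apply: (bounded_mul_L1 _ _ 1) => //; exact: L2_sqr.
have err : E (fun w => g w * (f w - A n w) ^+ 2) @[n --> \oo] --> (0 : R).
  apply/norm_cvg0P; apply: (squeeze_cvgr _ (cvg_cst 0) Af).
  apply: nearW => n; rewrite normr_ge0/=.
  apply: le_trans (le_normr_Rintegral _ _) _ => //; first exact/Lfun1_integrable.
  apply: E_le; [exact/Lfun_norm/gB1|exact: L2_sqr|move=> w].
  by rewrite normrM [`|_ ^+ 2|]ger0_norm ?sqr_ge0// ler_piMl ?sqr_ge0.
rewrite (_ : (fun n => E (fun w => g w * A n w ^+ 2)) = (fun n =>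
    2 * E (fun w => g w * f w * A n w) - E (fun w => g w * f w * f w)
    + E (fun w => g w * (f w - A n w) ^+ 2))).
  have -> : E (fun w => g w * f w ^+ 2) = 2 * E (fun w => g w * f w * f w)
      - E (fun w => g w * f w * f w) + 0.
    have -> : E (fun w => g w * f w ^+ 2) = E (fun w => g w * f w * f w).
      by apply: eq_Rintegral => w _; ring.
    ring.
  apply: cvgD => //; apply: cvgB; last exact: cvg_cst.
  by apply: cvgM => //; exact: cvg_cst.
apply/funext => n.
have gfA := L2M_L1 _ _ gf2 (A2 n); have gff := L2M_L1 _ _ gf2 f2.
rewrite -EZ// -EB//; last exact: L1Z.
rewrite -ED//; last by apply: L1B => //; exact: L1Z.
by apply: eq_Rintegral => w _; ring.
Qed.

Local Notation cov f g := (fine (covariance P f g)).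

Lemma cov_E f g : L2 f -> L2 g -> cov f g = E (fun w => f w * g w) - E f * E g.
Proof.
move=> f2 g2; have f1 := L2_L1 _ f2; have g1 := L2_L1 _ g2.
have fg1 := L2M_L1 _ _ f2 g2.
have e1 := expectation_fin_num f1; have e2 := expectation_fin_num g1.
have e3 := expectation_fin_num fg1.
rewrite covarianceE// fineB//; last by rewrite fin_numM.
by rewrite fineM// unlock.
Qed.

Lemma cov_ae f f' g g' : measurable_fun setT f -> measurable_fun setT f' ->
  measurable_fun setT g -> measurable_fun setT g' ->
  {ae P, forall w, f w = f' w} -> {ae P, forall w, g w = g' w} ->
  cov f g = cov f' g'.
Proof.
move=> mf mf' mg mg' ff' gg'.
have expE h h' : measurable_fun setT h -> measurable_fun setT h' ->
    {ae P, forall w, h w = h' w} -> ('E_P[h] = 'E_P[h'])%E.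
  move=> mh mh' hh'; rewrite unlock; apply: ae_eq_integral => //.
  - exact/measurable_EFinP.
  - exact/measurable_EFinP.
  - by apply: filterS hh' => w -> .
congr fine; rewrite unlock (expE f f')// (expE g g')//; apply: expE.
- by apply: measurable_funM; apply: measurable_funB.
- by apply: measurable_funM; apply: measurable_funB.
- by apply: filterS2 ff' gg' => w /= fw gw; rewrite !fctE /= fw gw.
Qed.

Lemma E_mul_le f g a b : L2 f -> L2 g -> 0 <= a -> 0 <= b ->
  E (fun w => f w ^+ 2) <= a ^+ 2 -> E (fun w => g w ^+ 2) <= b ^+ 2 ->
  `|E (fun w => f w * g w)| <= a * b.
Proof.
move=> f2 g2 a0 b0 fa gb.
rewrite -(ler_pXn2r (n := 2))// ?nnegrE ?mulr_ge0// real_normK ?num_real//.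
apply: le_trans (cauchy_schwarz _ _ f2 g2) _; rewrite exprMn; apply: ler_pM => //;
  by apply: E_ge0 => w; exact: sqr_ge0.
Qed.

Lemma E_le_sqrt f a : L2 f -> 0 <= a -> E (fun w => f w ^+ 2) <= a ^+ 2 ->
  `|E f| <= a.
Proof.
move=> f2 a0 fa; have := E_mul_le f (fun=> 1) a 1 f2 (L2_cst 1) a0 ler01 fa.
under eq_Rintegral do rewrite expr1n.
rewrite E_cst expr1n mulr1 => /(_ (lexx _)); congr (`|_| <= _).
by apply: eq_Rintegral => w _; rewrite mulr1.
Qed.

Lemma cov_le f g a b : L2 f -> L2 g -> 0 <= a -> 0 <= b ->
  E (fun w => f w ^+ 2) <= a ^+ 2 -> E (fun w => g w ^+ 2) <= b ^+ 2 ->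
  `|cov f g| <= 2 * (a * b).
Proof.
move=> f2 g2 a0 b0 fa gb; rewrite cov_E//.
have h1 := E_mul_le f g a b f2 g2 a0 b0 fa gb.
have h2 := E_le_sqrt f a f2 a0 fa; have h3 := E_le_sqrt g b g2 b0 gb.
rewrite (le_trans (ler_normB _ _))// mulr2n mulrDl mul1r lerD// normrM.
by apply: ler_pM.
Qed.

(** The remainders have size [c] and [U], [U'] have size [c sqrt t], so by the
    Cauchy-Schwarz inequality the cross covariances are at most [2 c ^ 2 sqrt t].
    As [1 <= sqrt t], the constant is [1 + 2 + 2 + 2]. *)
Lemma cov_perturbation (U U' r r' : T -> R) (al al' c t kappa : R) :
  L2 U -> L2 U' -> L2 r -> L2 r' -> 1 <= t -> 0 <= c ->
  E (fun w => U w ^+ 2) <= c ^+ 2 * t -> E (fun w => U' w ^+ 2) <= c ^+ 2 * t ->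
  E (fun w => r w ^+ 2) <= c ^+ 2 -> E (fun w => r' w ^+ 2) <= c ^+ 2 ->
  `|cov U U' - kappa * t| <= c ^+ 2 ->
  `|cov (fun w => al + (U w + r w)) (fun w => al' + (U' w + r' w)) - kappa * t|
    <= 7 * c ^+ 2 * Num.sqrt t.
Proof.
move=> U2 U'2 r2 r'2 t1 c0 EU EU' Er Er' UU'.
have t0 : 0 <= t by rewrite (le_trans ler01).
set q := Num.sqrt t; have q1 : 1 <= q by rewrite -sqrtr1 ler_sqrt.
have q0 : 0 <= q by rewrite sqrtr_ge0.
have qq : t = q ^+ 2 by rewrite sqr_sqrtr.
have cq0 : 0 <= c * q by rewrite mulr_ge0.
rewrite {1}qq -exprMn in EU; rewrite {1}qq -exprMn in EU'.
have h1 := cov_le U r' (c * q) c U2 r'2 cq0 c0 EU Er'.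
have h2 := cov_le r U' c (c * q) r2 U'2 c0 cq0 Er EU'.
have h3 := cov_le r r' c c r2 r'2 c0 c0 Er Er'.
have Ur2 := L2D _ _ U2 r2; have Ur'2 := L2D _ _ U'2 r'2.
have -> : cov (fun w => al + (U w + r w)) (fun w => al' + (U' w + r' w))
    = cov U U' + (cov U r' + (cov r U' + cov r r')).
  have e1 := L2_L1 _ U2; have e2 := L2_L1 _ U'2; have e3 := L2_L1 _ r2.
  have e4 := L2_L1 _ r'2.
  have p1 := L2M_L1 _ _ U2 U'2; have p2 := L2M_L1 _ _ U2 r'2.
  have p3 := L2M_L1 _ _ r2 U'2; have p4 := L2M_L1 _ _ r2 r'2.
  rewrite cov_E; [|exact: L2D (L2_cst _) Ur2|exact: L2D (L2_cst _) Ur'2].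
  rewrite !cov_E//.
  rewrite !(ED (fun=> _))//; [|exact: L1_cst|exact: L1D|exact: L1_cst|exact: L1D].
  rewrite !E_cst.
  have -> : E (fun w => (al + (U w + r w)) * (al' + (U' w + r' w)))
      = E (fun w => (al * al' + (al * U' w + al * r' w) + (al' * U w + al' * r w))
          + ((U w * U' w + U w * r' w) + (r w * U' w + r w * r' w))).
    by apply: eq_Rintegral => w _; ring.
  have z1 := L1Z al _ e2; have z2 := L1Z al _ e4.
  have z3 := L1Z al' _ e1; have z4 := L1Z al' _ e3.
  have z12 := L1D _ _ z1 z2; have z34 := L1D _ _ z3 z4.
  have w1 := L1D _ _ p1 p2; have w2 := L1D _ _ p3 p4.
  have k12 := L1D _ _ (L1_cst (al * al')) z12.
  rewrite (ED _ _ (L1D _ _ k12 z34) (L1D _ _ w1 w2)) (ED _ _ k12 z34).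
  rewrite (ED _ _ (L1_cst (al * al')) z12) (ED _ _ z1 z2) (ED _ _ z3 z4).
  rewrite (ED _ _ w1 w2) (ED _ _ p1 p2) (ED _ _ p3 p4) E_cst !EZ//.
  ring.
move: UU' h1 h2 h3; move: (cov U U') (cov U r') (cov r U') (cov r r') => a1 a2 a3 a4.
move=> UU' h1 h2 h3.
rewrite (_ : _ - _ = (a1 - kappa * t) + (a2 + (a3 + a4))); last by ring.
apply: le_trans (ler_normD _ _) _; apply: (@le_trans _ _ (c ^+ 2 +
  (2 * (c * q * c) + (2 * (c * (c * q)) + 2 * (c * c))))).
  apply: lerD => //; apply: le_trans (ler_normD _ _) _; apply: lerD => //.
  by apply: le_trans (ler_normD _ _) _; apply: lerD.
rewrite -subr_ge0 (_ : _ - _ = 3 * (c ^+ 2 * (q - 1))); last by ring.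
by rewrite mulr_ge0// mulr_ge0 ?sqr_ge0// subr_ge0.
Qed.

End expectations.

(** * Independence *)
Definition independent_rv {d : measure_display} {T : measurableType d}
    {R : realType} (P : probability T R) (f g : T -> R) : Prop :=
  forall B C : set R, measurable B -> measurable C ->
    P (f @^-1` B `&` g @^-1` C) = (P (f @^-1` B) * P (g @^-1` C))%E.

(** The rectangles that generate the join of the sigma-algebras [G] and [H]. *)
Definition intersections {T : Type} (G H : set (set T)) : set (set T) :=
  [set A `&` B | A in G & B in H].

Definition adapted {T : pointedType} {R : realType} (G : set (set T))
    (f : T -> R) : Prop :=
  measurable_fun (setT : set (g_sigma_algebraType G)) f.

Section independence.
Context {d : measure_display} {T : measurableType d} {R : realType}.
Variable P : probability T R.
Implicit Types f g : T -> R.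

Local Notation E f := (Rintegral P setT f).
Local Notation L1 f := (f \in Lfun P 1).

Lemma mfun_of f : measurable_fun setT f ->
  exists X : {mfun T >-> R}, (X : T -> R) = f.
Proof. by move=> mf; exists (mfun_Sub (mem_set mf)). Qed.

(** The joint law is the product of the laws, so Fubini applies. *)
Lemma E_indep f g : L1 f -> L1 g -> L1 (fun w => f w * g w) ->
  independent_rv P f g -> E (fun w => f w * g w) = E f * E g.
Proof.
move=> f1 g1 fg1 fg.
have [X Xf] := mfun_of f (L1_measurable P f f1).
have [Y Yg] := mfun_of g (L1_measurable P g g1).
move: f1 g1 fg1 fg; rewrite -{}Xf -{}Yg {f g} => X1 Y1 XY1 indXY.
have mXY : measurable_fun setT (fun w => (X w, Y w)) by exact: measurable_fun_pair.
pose Z : {mfun T >-> (R * R)%type} := mfun_Sub (mem_set mXY).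
pose m1 := distribution P X; pose m2 := distribution P Y.
have prodE A : measurable A -> (m1 \x m2)%E A = distribution P Z A.
  apply: product_measure_unique => B C mB mC.
  by rewrite -[LHS]/(P (X @^-1` B `&` Y @^-1` C)) indXY.
pose h (z : R * R) := (z.1 * z.2)%:E.
have mh : measurable_fun setT h.
  by apply/measurable_EFinP; apply: measurable_funM.
have iXY : (\int[P]_w (X w * Y w)%:E = \int[m1 \x m2]_z h z)%E.
  rewrite (eq_measure_integral (distribution P Z)); last first.
    by move=> A mA _; exact: prodE.
  by rewrite integral_distribution//; exact/Lfun1_integrable.
have ih : (m1 \x m2)%E.-integrable setT h.
  apply/integrableP; split => //.
  rewrite (eq_measure_integral (distribution P Z)); last first.
    by move=> A mA _; exact: prodE.
  rewrite ge0_integral_distribution//; last exact: measurableT_comp.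
  by have /Lfun1_integrable/integrableP[] := XY1.
have EY : (\int[m2]_y y%:E = (E Y)%:E)%E.
  have /Lfun1_integrable iY := Y1.
  rewrite integral_distribution//.
  by rewrite fineK//; exact: (integrable_fin_num measurableT iY).
have EX : (\int[m1]_x x%:E = (E X)%:E)%E.
  have /Lfun1_integrable iX := X1.
  rewrite integral_distribution//.
  by rewrite fineK//; exact: (integrable_fin_num measurableT iX).
have im1 : m1.-integrable setT EFin.
  have /Lfun1_integrable/integrableP[_ iX] := X1.
  apply/integrableP; split => //.
  by rewrite ge0_integral_distribution//; exact: measurableT_comp.
have im2 : m2.-integrable setT EFin.
  have /Lfun1_integrable/integrableP[_ iY] := Y1.
  apply/integrableP; split => //.
  by rewrite ge0_integral_distribution//; exact: measurableT_comp.
apply: EFin_inj; rewrite fineK; last first.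
  by have /Lfun1_integrable/(integrable_fin_num measurableT) := XY1.
rewrite iXY -(integral12_prod_meas1 ih) /fubini_F.
under eq_integral => x _.
  under eq_integral do rewrite /h /= EFinM.
  rewrite integralZl//= EY; over.
by rewrite integralZr//= EX.
Qed.

Lemma independent_rv_sym f g : independent_rv P f g -> independent_rv P g f.
Proof. by move=> fg B C mB mC; rewrite setIC fg// muleC. Qed.

Lemma setI_closed_intersections (G H : set (set T)) :
  setI_closed G -> setI_closed H -> setI_closed (intersections G H).
Proof.
move=> GI HI _ _ [A GA [B HB <-]] [A' GA' [B' HB' <-]].
exists (A `&` A'); first exact: GI.
by exists (B `&` B'); [exact: HI|rewrite setIACA].
Qed.

(** Both sides are finite measures in [A], and they agree on the rectangles, which
    form a generating pi-system. *)
Lemma independent_intersections (G H K : set (set T)) :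
  G `<=` measurable -> H `<=` measurable -> K `<=` measurable ->
  setI_closed G -> setI_closed H -> G setT -> H setT -> K setT ->
  (forall A B C, G A -> H B -> K C ->
     P (A `&` B `&` C) = (P A * P B * P C)%E) ->
  forall A C, <<s intersections G H >> A -> K C ->
    P (A `&` C) = (P A * P C)%E.
Proof.
move=> Gm Hm Km GI HI GT HT KT indep A C GHA KC.
have mC := Km _ KC.
have PC : P C \is a fin_num by exact: fin_num_measure.
have r0 : 0 <= fine (P C) by exact: fine_ge0.
pose m2 := mscale (NngNum r0) P.
have -> : (P A * P C = m2 A)%E by rewrite /m2/= /mscale/= fineK// muleC.
rewrite -[LHS]/(mrestr P mC A).
have GHm : intersections G H `<=` measurable.
  by move=> _ [B GB [B' HB <-]]; apply: measurableI; [exact: Gm|exact: Hm].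
have GHT : intersections G H setT by exists setT => //; exists setT; rewrite ?setIT.
apply: (g_sigma_algebra_measure_unique (intersections G H) GHm (fun=> setT)) => //.
- by rewrite bigcup_const.
- exact: setI_closed_intersections.
- move=> _ [B GB [B' HB <-]]; rewrite -[LHS]/(P (B `&` B' `&` C)).
  rewrite -[RHS]/((fine (P C))%:E * P (B `&` B'))%E fineK// muleC indep//.
  by have := indep _ _ _ GB HB KT; rewrite setIT => ->; rewrite probability_setT mule1.
- by move=> _; rewrite /= /mrestr setTI (le_lt_trans (probability_le1 _ _))// ltry.
Qed.

Lemma adapted_measurable (G : set (set T)) f : G `<=` measurable ->
  adapted G f -> measurable_fun setT f.
Proof.
move=> Gm Gf _ B mB; have := Gf measurableT B mB.
have := smallest_sub (@sigma_algebra_measurable _ T) Gm.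
by apply.
Qed.

End independence.

(** * The second moment of the normal law *)
Section normal_moments.
Context {R : realType}.
Local Notation mu := (@lebesgue_measure R).

(** With [c] twice the variance, the centred normal density up to its constant. *)
Definition gauss (c x : R) : R := expR (- x ^+ 2 / c).

Lemma continuous_gauss c : continuous (gauss c).
Proof.
move=> x; apply: (@continuous_comp _ _ _ (fun x : R => - x ^+ 2 / c) expR).
  apply: cvgM; last exact: cvg_cst.
  by apply: cvgN; exact: exprn_continuous.
exact: continuous_expR.
Qed.

Lemma gauss_ge0 c x : 0 <= gauss c x.
Proof. exact: expR_ge0. Qed.

(** The antiderivative behind the integration by parts that gives the variance. *)
Lemma is_derive_id_gauss (c x : R) :
  is_derive x (1 : R) (fun y => y * gauss c y) (gauss c x - 2 / c * (x ^+ 2 * gauss c x)).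
Proof.
have dq : is_derive x (1 : R) (fun y : R => - y ^+ 2 / c) (- (2 * x) / c).
  have -> : (fun y : R => - y ^+ 2 / c) = (- (@id R ^+ 2)) * cst (c^-1) by [].
  apply: is_derive_eq; rewrite /= /GRing.scale/= ?fctE; ring.
have dg : is_derive x (1 : R) (gauss c) (- (2 * x) / c * gauss c x).
  rewrite -[gauss c]/(expR \o (fun y : R => - y ^+ 2 / c)); apply: is_derive_eq.
  by rewrite mulrC.
have -> : (fun y : R => y * gauss c y) = @id R * gauss c by [].
by apply: is_derive_eq; rewrite /GRing.scale/=; ring.
Qed.

Lemma cvg_id_gauss c : 0 < c -> (n%:R * gauss c n%:R) @[n --> \oo] --> 0.
Proof.
move=> c0; apply: (@squeeze_cvgr _ _ _ _ (fun=> 0) (fun n => c * n.+1%:R^-1 * 2)).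
- near=> n; rewrite mulr_ge0 ?ler0n ?gauss_ge0//=.
  have n0 : (0 < n)%N by near: n; exact: nbhs_infty_gt.
  have nR : 0 < n%:R :> R by rewrite ltr0n.
  rewrite /gauss mulNr expRN.
  have := expR_ge1Dx (n%:R ^+ 2 / c) => le1.
  apply: (@le_trans _ _ (n%:R * (n%:R ^+ 2 / c)^-1)).
    rewrite ler_pM2l// lef_pV2 ?posrE ?expR_gt0 ?divr_gt0 ?exprn_gt0//.
    by apply: le_trans le1; rewrite lerDr.
  have -> : n%:R * (n%:R ^+ 2 / c)^-1 = c * n%:R^-1 :> R.
    by field; rewrite !gt_eqF.
  rewrite -mulrA ler_pM2l// -ler_pdivrMr// -invfM lef_pV2 ?posrE ?mulr_gt0//.
  by rewrite -natrM ler_nat; lia.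
- exact: cvg_cst.
- rewrite -(mul0r 2) -(mulr0 c); apply: cvgM; last exact: cvg_cst.
  by apply: cvgM; [exact: cvg_cst|exact: cvg_harmonic].
Unshelve. all: by end_near. Qed.

(** Integration by parts on [[0, n]]; the boundary term [n * gauss c n] vanishes in
    the limit. *)
Lemma integral0y_sqr_gauss c : 0 < c ->
  (\int[mu]_(x in `[0%R, +oo[) (gauss c x)%:E < +oo)%E ->
  (\int[mu]_(x in `[0%R, +oo[) (2 / c * (x ^+ 2 * gauss c x))%:E
   = \int[mu]_(x in `[0%R, +oo[) (gauss c x)%:E)%E.
Proof.
move=> c0 gfin.
have cg := continuous_gauss c.
pose h x := 2 / c * (x ^+ 2 * gauss c x).
have ch : continuous h.
  move=> x; apply: cvgM; first exact: cvg_cst.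
  by apply: cvgM; [exact: exprn_continuous|exact: cg].
have h0 x : 0 <= h x.
  apply: mulr_ge0; first by rewrite divr_ge0// ltW.
  by rewrite mulr_ge0 ?sqr_ge0 ?gauss_ge0.
have gE : (\int[mu]_(x in `[0%R, +oo[) (gauss c x)%:E)%E \is a fin_num.
  by rewrite ge0_fin_numE// integral_ge0// => x _; rewrite lee_fin gauss_ge0.
have int_n (f : R -> R) (n : nat) : continuous f ->
    mu.-integrable `[0%R, n%:R] (EFin \o f).
  move=> cf; apply: continuous_compact_integrable; first exact: segment_compact.
  exact: continuous_subspaceT.
have key (n : nat) : (\int[mu]_(x in `[0%R, n%:R]) (h x)%:E
    = \int[mu]_(x in `[0%R, n%:R]) (gauss c x)%:E - (n%:R * gauss c n%:R)%:E)%E.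
  have [->|n0] := posnP n.
    by rewrite set_itv1 !integral_set1 mul0r sube0.
  have := @continuous_FTC2 R (fun x => gauss c x - h x)
    (fun y => y * gauss c y) 0 n%:R.
  rewrite mul0r sube0 => <-.
  - under [X in (_ - X)%E]eq_integral do rewrite EFinB.
    rewrite integralB//; [|exact: int_n|exact: int_n].
    rewrite oppeB ?addeA ?subee ?add0e//.
      exact: (integrable_fin_num _ (int_n _ n cg)).
    by rewrite fin_num_adde_defr//; apply: (integrable_fin_num _ (int_n _ n cg)).
  - by rewrite ltr0n.
  - by apply: continuous_subspaceT => x; apply: cvgB; [exact: cg|exact: ch].
  - have cF : continuous (fun y : R => y * gauss c y).
      by move=> x; apply: cvgM; [exact: cvg_id|exact: cg].
    split.
    + by move=> x _; apply: ex_derive; exact: is_derive_id_gauss.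
    + by apply/cvg_at_right_filter; exact: cF.
    + by apply/cvg_at_left_filter; exact: cF.
  - move=> x _; rewrite derive1E; have d := is_derive_id_gauss c x.
    exact: derive_val.
have lim1 : (\int[mu]_(x in `[0%R, n%:R]) (h x)%:E)%E @[n --> \oo] -->
    (\int[mu]_(x in `[0%R, +oo[) (h x)%:E)%E.
  by apply: ge0_cvgn_integral => //; exact: continuous_measurable_fun.
have lim2 : (\int[mu]_(x in `[0%R, n%:R]) (h x)%:E)%E @[n --> \oo] -->
    (\int[mu]_(x in `[0%R, +oo[) (gauss c x)%:E)%E.
  rewrite (eq_cvg _ _ key).
  rewrite -(sube0 (\int[mu]_(x in `[0%R, +oo[) (gauss c x)%:E)%E); apply: cvgeB.
  - by rewrite fin_num_adde_defl.
  - apply: ge0_cvgn_integral; [exact: gauss_ge0|].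
    exact: continuous_measurable_fun.
  - by apply: cvg_EFin; [exact: nearW|exact: cvg_id_gauss].
exact: cvg_unique lim1 lim2.
Qed.

Lemma integral_normal_prob (s : R) (f : R -> \bar R) :
  measurable_fun setT f -> (forall x, 0 <= f x)%E ->
  (\int[normal_prob 0 s]_x f x = \int[mu]_x (f x * (normal_pdf 0 s x)%:E))%E.
Proof.
move=> mf f0; have dom := normal_prob_dominates 0 s.
rewrite -(Radon_Nikodym_SigmaFinite.change_of_variables dom)//.
have iRN := Radon_Nikodym_SigmaFinite.f_integrable dom.
have mpdf : measurable_fun setT (fun x => (normal_pdf 0 s x)%:E).
  by apply/measurable_EFinP; exact: measurable_normal_pdf.
apply: ae_eq_integral => //.
- by apply: emeasurable_funM => //; exact: measurable_int iRN.
- exact: emeasurable_funM.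
- apply: ae_eqe_mul2l; apply: integral_ae_eq => //.
  by move=> E _ mE; rewrite -(Radon_Nikodym_SigmaFinite.f_integral dom).
Qed.

Lemma normal_pdf_gauss (s x : R) : s != 0 ->
  normal_pdf 0 s x = normal_peak s * gauss (s ^+ 2 *+ 2) x.
Proof. by move=> s0; rewrite normal_pdfE// /gauss /normal_fun subr0. Qed.

Let set_ge0E : [set x : R | 0 <= x] = `[0, +oo[%classic.
Proof. by apply/seteqP; split=> x /=; rewrite in_itv/= andbT. Qed.

(** By evenness it is enough to work on the half line, where [integral0y_sqr_gauss]
    exchanges the second moment for the total mass. *)
Lemma normal_prob_sqr (s : R) : 0 < s ->
  (\int[normal_prob 0 s]_x (x ^+ 2)%:E = (s ^+ 2)%:E)%E.
Proof.
move=> s0; have sn0 : s != 0 by rewrite gt_eqF.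
have pk0 := normal_peak_gt0 sn0.
set c := s ^+ 2 *+ 2.
have c0 : 0 < c by rewrite pmulrn_lgt0// exprn_gt0.
have cg := continuous_gauss c.
have mg := continuous_measurable_fun cg.
have half : (2%:E * ((normal_peak s)%:E * \int[mu]_(x in `[0%R, +oo[) (gauss c x)%:E)
    = 1)%E.
  rewrite -(integral_normal_pdf 0 s) -ge0_integralZl//; last 3 first.
  - by apply/measurable_EFinP/measurable_funTS.
  - by move=> x _; rewrite lee_fin gauss_ge0.
  - by rewrite lee_fin ltW.
  rewrite ge0_symfun_integralT.
  - rewrite set_ge0E. congr (_ * _)%E; apply: eq_integral => x _.
    by rewrite normal_pdf_gauss// EFinM.
  - by move=> x; exact: normal_pdf_ge0.
  - exact: continuous_normal_pdf.
  - by move=> x; rewrite /= !normal_pdf_gauss// /gauss sqrrN.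
have gfin : (\int[mu]_(x in `[0%R, +oo[) (gauss c x)%:E < +oo)%E.
  rewrite ltNge leye_eq; apply/negP => /eqP gy.
  by move: half; rewrite gy gt0_muley ?lte_fin// gt0_muley ?lte_fin.
rewrite integral_normal_prob//; last 2 first.
- by apply/measurable_EFinP; exact: measurable_funX.
- by move=> x; rewrite lee_fin sqr_ge0.
under eq_integral do rewrite -EFinM.
rewrite ge0_symfun_integralT; last 3 first.
- by move=> x; rewrite mulr_ge0 ?sqr_ge0 ?normal_pdf_ge0.
- by move=> x; apply: cvgM; [exact: exprn_continuous|exact: continuous_normal_pdf].
- by move=> x; rewrite /= !normal_pdf_gauss// /gauss sqrrN.
rewrite set_ge0E.
have mh : measurable_fun setT (fun x : R => 2 / c * (x ^+ 2 * gauss c x)).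
  by apply: measurable_funM => //; apply: measurable_funM => //; exact: measurable_funX.
have h0 x : 0 <= 2 / c * (x ^+ 2 * gauss c x).
  apply: mulr_ge0; first by rewrite divr_ge0// ltW.
  by rewrite mulr_ge0 ?sqr_ge0 ?gauss_ge0.
transitivity (2%:E * ((s ^+ 2)%:E * ((normal_peak s)%:E *
    \int[mu]_(x in `[0%R, +oo[) (gauss c x)%:E)))%E.
  rewrite -integral0y_sqr_gauss//; congr (_ * _)%E.
  rewrite -!ge0_integralZl//.
  - apply: eq_integral => x _.
    rewrite -!EFinM normal_pdf_gauss// -/c; congr EFin.
    have -> : 2 / c = (s ^+ 2)^-1 by rewrite /c -mulr_natr; field.
    by field.
  - by apply: emeasurable_funM => //; apply/measurable_EFinP/measurable_funTS.
  - by move=> x _; rewrite -!EFinM lee_fin mulr_ge0// ltW.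
  - by rewrite lee_fin sqr_ge0.
  - by apply/measurable_EFinP/measurable_funTS.
  - by move=> x _; rewrite lee_fin.
  - by rewrite lee_fin ltW.
by rewrite muleCA half mule1.
Qed.

(** The density is even; comparing the two parts gives a vanishing mean. *)
Lemma normal_prob_pos_neg (s : R) : s != 0 ->
  (\int[normal_prob 0 s]_x (Num.max x 0)%:E
   = \int[normal_prob 0 s]_x (Num.max (- x) 0)%:E)%E.
Proof.
move=> s0.
rewrite !integral_normal_prob//; last 4 first.
- by apply/measurable_EFinP; apply: measurable_funrpos => //; exact: measurable_funN.
- by move=> x; rewrite lee_fin le_max lexx orbT.
- by apply/measurable_EFinP; apply: measurable_funrpos.
- by move=> x; rewrite lee_fin le_max lexx orbT.
pose G x := Num.max (- x) 0 * normal_pdf 0 s x.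
have cG : continuous G.
  move=> x; apply: cvgM; last exact: continuous_normal_pdf.
  apply: (@continuous_comp _ _ _ (@GRing.opp R) (fun y => Num.max y 0)).
    exact: opp_continuous.
  by apply: continuous_max; [exact: cvg_id|exact: cvg_cst].
have G0 x : 0 <= G x.
  by rewrite mulr_ge0 ?normal_pdf_ge0// le_max lexx orbT.
transitivity (\int[mu]_(x in `]-oo, (- 0)%R]) (G x)%:E)%E; last first.
  rewrite integral_mkcond; apply: eq_integral => x _; rewrite patchE oppr0.
  case: ifPn => [|]; first by rewrite EFinM.
  rewrite notin_setE /= in_itv/= => /negP; rewrite -ltNge => x0.
  by rewrite max_r ?mul0e// oppr_le0 ltW.
rewrite ge0_integration_by_substitutionNy//; last first.
  exact: continuous_subspaceT.
rewrite [RHS]integral_mkcond; apply: eq_integral => x _; rewrite patchE.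
case: ifPn => [|].
  by rewrite /= /G opprK EFinM !normal_pdf_gauss// /gauss sqrrN.
rewrite notin_setE /= in_itv/= andbT => /negP; rewrite -ltNge => x0.
by rewrite max_r ?mul0e// ltW.
Qed.

End normal_moments.

(** * Moments of Brownian increments and of the Poisson parity *)
Section increments.
Context {d : measure_display} {T : measurableType d} {R : realType}.
Variable P : probability T R.
Implicit Types f g : T -> R.

Local Notation E f := (Rintegral P setT f).
Local Notation L1 f := (f \in Lfun P 1).
Local Notation L2 f := (f \in Lfun P 2%:E).

Lemma independent_disjoint_increments (Z : R -> T -> R) (a b c e : R) :
  independent_increments P Z -> 0 <= a -> a <= b -> b <= c -> c <= e ->
  independent_rv P (fun w => Z b w - Z a w) (fun w => Z e w - Z c w).
Proof.
move=> indZ a0 ab bc ce B C mB mC.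
(* The two increments are the outer ones of the subdivision [a, b, c, e]; the
   default value of [nth] supplies the last point. *)
pose t i := nth e [:: a; b; c] i.
have ordt i : (i < 3)%N -> t i <= t i.+1 by case: i => [|[|[|//]]].
pose i0 : 'I_3 := ord0; pose i2 : 'I_3 := ord_max.
pose D1 := (fun w => Z b w - Z a w) @^-1` B.
pose D2 := (fun w => Z e w - Z c w) @^-1` C.
have := indZ 3%N t a0 ordt [set i0; i2]%SET (fun i => if i == i0 then D1 else D2).
rewrite big_setU1 ?inE//= big_set1/=.
have -> : \bigcap_(i in [set` [set i0; i2]%SET]) (if i == i0 then D1 else D2)
    = D1 `&` D2.
  apply/seteqP; split=> w.
    move=> Dw; split; first by have := Dw i0; rewrite /= !inE eqxx; apply.
    by have := Dw i2; rewrite /= !inE eqxx orbT; apply.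
  by move=> [D1w D2w] i _ /=; case: ifP.
apply => i; rewrite !inE => /orP[] /eqP -> /=.
  by exists B => //; rewrite setTI.
by exists C => //; rewrite setTI.
Qed.

Lemma independent_rv_comp f g (u v : R -> R) :
  measurable_fun setT u -> measurable_fun setT v ->
  independent_rv P f g -> independent_rv P (u \o f) (v \o g).
Proof.
move=> mu mv fg B C mB mC.
have := fg (u @^-1` B) (v @^-1` C).
by apply; [rewrite -[_ @^-1` _]setTI; exact: mu|rewrite -[_ @^-1` _]setTI; exact: mv].
Qed.

End increments.

Section brownian_moments.
Context {d : measure_display} {T : measurableType d} {R : realType}.
Variable P : probability T R.
Variable W : R -> {RV P >-> R}.
Hypothesis bmW : brownian_motion W.

Local Notation E f := (Rintegral P setT f).
Local Notation L1 f := (f \in Lfun P 1).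
Local Notation L2 f := (f \in Lfun P 2%:E).

Lemma bm_law (a b : R) (f : R -> \bar R) : 0 <= a -> a < b ->
  measurable_fun setT f -> (forall x, 0 <= f x)%E ->
  (\int[P]_w f (W b w - W a w)%R = \int[normal_prob 0 (Num.sqrt (b - a))]_x f x)%E.
Proof.
move=> a0 ab mf f0; case: bmW => _ _ _ law.
have mX : measurable_fun setT (fun w => W b w - W a w : measurableTypeR R).
  exact: (measurable_funB (f := W b) (g := W a)).
pose X := @mfun_Sub _ _ T (measurableTypeR R) _ (mem_set mX).
rewrite -[LHS]/(\int[P]_w (f \o X) w)%E.
rewrite -(ge0_integral_distribution (T' := measurableTypeR R))//.
apply: eq_measure_integral => B mB _.
exact: (law a b a0 ab B mB).
Qed.

Lemma bm_incr_measurable (a b : R) : measurable_fun setT (fun w => W b w - W a w).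
Proof. exact: measurable_funB. Qed.

Let bm_sqr (a b : R) : 0 <= a -> a < b ->
  (\int[P]_w ((W b w - W a w) ^+ 2)%:E = (b - a)%:E)%E.
Proof.
move=> a0 ab; rewrite (bm_law _ _ (fun x => (x ^+ 2)%:E))//; last 2 first.
- by apply/measurable_EFinP; exact: measurable_funX.
- by move=> x; rewrite lee_fin sqr_ge0.
by rewrite normal_prob_sqr ?sqrtr_gt0 ?subr_gt0// sqr_sqrtr// subr_ge0 ltW.
Qed.

Lemma bm_L2 (a b : R) : 0 <= a -> a <= b -> L2 (fun w => W b w - W a w).
Proof.
move=> a0; rewrite le_eqVlt => /orP[/eqP <-|ab].
  by under eq_fun do rewrite subrr; exact: L2_cst.
apply: L2P; first exact: bm_incr_measurable.
apply: L1_integralP; first by apply: measurable_funX; exact: bm_incr_measurable.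
by under eq_integral do rewrite ger0_norm ?sqr_ge0//; rewrite bm_sqr// ltry.
Qed.

Lemma bm_var (a b : R) : 0 <= a -> a <= b ->
  E (fun w => (W b w - W a w) ^+ 2) = b - a.
Proof.
move=> a0; rewrite le_eqVlt => /orP[/eqP <-|ab]; last by rewrite /Rintegral bm_sqr.
by under eq_Rintegral do rewrite subrr expr0n/=; rewrite E_cst subrr.
Qed.

Lemma bm_mean (a b : R) : 0 <= a -> a <= b -> E (fun w => W b w - W a w) = 0.
Proof.
move=> a0; rewrite le_eqVlt => /orP[/eqP <-|ab].
  by under eq_Rintegral do rewrite subrr; rewrite E_cst.
have mm : measurable_fun setT (fun x : R => Num.max x 0) by apply: measurable_funrpos.
have mmN : measurable_fun setT (fun x : R => Num.max (- x) 0).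
  by apply: measurable_funrpos => //; exact: measurable_funN.
have bL1 (u : R -> R) : measurable_fun setT u -> (forall x, `|u x| <= `|x|) ->
    L1 (fun w => u (W b w - W a w)).
  move=> mu ux; apply/Lfun1_integrable.
  apply: (@le_integrable _ _ _ P setT _ _ (EFin \o (fun w => W b w - W a w))) => //=.
  - by apply/measurable_EFinP; exact: (measurableT_comp mu (bm_incr_measurable a b)).
  - by move=> w _; rewrite lee_fin.
  - exact/Lfun1_integrable/L2_L1/bm_L2/ltW.
have p1 : L1 (fun w => Num.max (W b w - W a w) 0).
  apply: (bL1 (fun x => Num.max x 0)) => // x.
  by rewrite ger0_norm ?le_max ?lexx ?orbT// ge_max ler_norm normr_ge0.
have n1 : L1 (fun w => Num.max (- (W b w - W a w)) 0).
  apply: (bL1 (fun x => Num.max (- x) 0)) => // x.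
  by rewrite ger0_norm ?le_max ?lexx ?orbT// ge_max -normrN ler_norm normr_ge0.
transitivity (E (fun w => Num.max (W b w - W a w) 0
    - Num.max (- (W b w - W a w)) 0)).
  apply: eq_Rintegral => w _; set x := _ - _; case: (leP x 0) => x0.
    by rewrite max_l ?oppr_ge0// sub0r opprK.
  by rewrite max_r ?subr0// oppr_le0 ltW.
rewrite EB//; apply/eqP; rewrite subr_eq0; apply/eqP; congr fine.
rewrite (bm_law _ _ (fun x => (Num.max x 0)%:E))//; last 2 first.
- exact/measurable_EFinP.
- by move=> x; rewrite lee_fin le_max lexx orbT.
rewrite (bm_law _ _ (fun x => (Num.max (- x) 0)%:E))//; last 2 first.
- exact/measurable_EFinP.
- by move=> x; rewrite lee_fin le_max lexx orbT.
by rewrite normal_prob_pos_neg// gt_eqF// sqrtr_gt0 subr_gt0.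
Qed.

Lemma bm_orthogonal (a b c e : R) : 0 <= a -> a <= b -> b <= c -> c <= e ->
  E (fun w => (W b w - W a w) * (W e w - W c w)) = 0.
Proof.
move=> a0 ab bc ce; have c0 : 0 <= c by rewrite (le_trans a0)// (le_trans ab).
have f2 := bm_L2 _ _ a0 ab; have g2 := bm_L2 _ _ c0 ce.
have [_ _ ind _] := bmW.
rewrite (E_indep P _ _ (L2_L1 P _ f2) (L2_L1 P _ g2)).
- by rewrite bm_mean// mul0r.
- exact: L2M_L1.
- exact: (independent_disjoint_increments P (fun t w => W t w)).
Qed.

Lemma bm_total_incr (a b t : R) : 0 <= a -> a <= b -> b <= t ->
  E (fun w => (W t w - W 0 w) * (W b w - W a w)) = b - a.
Proof.
move=> a0 ab bt; have b0 := le_trans a0 ab.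
have f2 := bm_L2 _ _ a0 ab; have g2 := bm_L2 _ _ b0 bt; have h2 := bm_L2 _ _ (lexx 0) a0.
transitivity (E (fun w => (W a w - W 0 w) * (W b w - W a w)
    + ((W b w - W a w) ^+ 2 + (W b w - W a w) * (W t w - W b w)))).
  by apply: eq_Rintegral => w _; ring.
rewrite ED; last 2 first.
- exact: L2M_L1.
- by apply: L1D; [exact: L2_sqr|exact: L2M_L1].
rewrite ED; [|exact: L2_sqr|exact: L2M_L1].
rewrite (bm_orthogonal 0 a a b)// (bm_orthogonal a b b t)// bm_var//.
by rewrite add0r addr0.
Qed.

End brownian_moments.

Section poisson_moments.
Context {d : measure_display} {T : measurableType d} {R : realType}.
Variable P : probability T R.
Variables (rate : R) (N : R -> {RV P >-> nat}).
Hypotheses (rate_gt0 : 0 < rate) (ppN : poisson_process rate N).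

Local Notation E f := (Rintegral P setT f).

(** The sign by which the swaps up to time [t] act on the difference of the
    coordinates. *)
Definition parity (N : R -> T -> nat) (t : R) (w : T) : R := (-1) ^+ N t w.

Local Notation eps := (parity N).

Lemma parity_sqr t w : eps t w ^+ 2 = 1.
Proof. by rewrite /parity sqrr_sign. Qed.

Lemma norm_parity t w : `|eps t w| <= 1.
Proof. by rewrite /parity normrX normrN1 expr1n. Qed.

Lemma measurable_comp_nat (h : nat -> R) t : measurable_fun setT (fun w => h (N t w)).
Proof. exact: (measurableT_comp (f := h)). Qed.

Lemma measurable_parity t : measurable_fun setT (eps t).
Proof. exact: (measurable_comp_nat (fun n => (-1) ^+ n)). Qed.

(** The generating function of the Poisson law: the factor [c ^+ k] turns the
    weights into those of the exponential series at [c * lam]. *)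
Lemma sum_expr_poisson_pmf (c lam : R) : 0 < lam ->
  (\sum_(k <oo) (c ^+ k * poisson_pmf lam k)%:E = (expR ((c - 1) * lam))%:E)%E.
Proof.
move=> lam0; apply/cvg_lim => //.
under eq_fun do rewrite sumEFin.
apply: cvg_EFin; first exact: nearW.
have -> : (c - 1) * lam = - lam + c * lam by ring.
rewrite expRD.
have -> : fine \o (fun n => (\sum_(0 <= k < n) c ^+ k * poisson_pmf lam k)%:E)
    = (fun n => expR (- lam) * series (exp_coeff (c * lam)) n).
  apply/funext => n; rewrite /= /series/= mulr_sumr; apply: eq_bigr => k _.
  by rewrite /poisson_pmf lam0 /exp_coeff/= exprMn; ring.
apply: cvgM; first exact: cvg_cst.
exact: is_cvg_series_exp_coeff.
Qed.

Lemma measurable_jump a b k : measurable [set w | N b w = (N a w + k)%N].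
Proof.
rewrite (_ : [set w | _] = (fun w => (N b w)%:R - (N a w)%:R : R) @^-1` [set k%:R : R]).
  rewrite -[_ @^-1` _]setTI.
  have : measurable_fun setT (fun w => (N b w)%:R - (N a w)%:R : R).
    by apply: measurable_funB; exact: (measurable_comp_nat (fun n => n%:R)).
  by apply => //; exact: measurable_set1.
apply/seteqP; split=> w /=; first by move=> ->; rewrite natrD addrC addKr.
by move=> /eqP; rewrite subr_eq addrC -natrD eqr_nat => /eqP.
Qed.

(** On the event of [k] jumps in [(a, b]] the product is [(-1) ^ k], so its mean is
    the generating function of the Poisson law at [-1]. *)
Lemma E_parity2 (a b : R) : 0 <= a -> a <= b ->
  E (fun w => eps a w * eps b w) = expR (- (2 * rate * (b - a))).
Proof.
move=> a0; rewrite le_eqVlt => /orP[/eqP <-|ab].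
  under eq_Rintegral do rewrite -expr2 parity_sqr.
  by rewrite E_cst subrr mulr0 oppr0 expR0.
case: ppN => _ _ _ law; set lam := rate * (b - a).
have lam0 : 0 < lam by rewrite mulr_gt0// subr_gt0.
pose A k := [set w | N b w = (N a w + k)%N].
have mA k : measurable (A k) := measurable_jump a b k.
have PA k : P (A k) = (poisson_pmf lam k)%:E := law a b a0 ab k.
have tA : trivIset setT A.
  by apply/trivIsetP => i j _ _ ij; apply/seteqP; split=> // w [];
    rewrite /A /= => -> /eqP; rewrite eqn_add2l (negbTE ij).
have PU : P (\bigcup_k A k) = 1%E.
  rewrite measure_bigcup//=.
  have := sum_expr_poisson_pmf 1 lam lam0; rewrite subrr mul0r expR0 => <-.
  rewrite [RHS](@eq_eseriesl _ _ (fun x => x \in [set: nat])); last first.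
    by move=> x; rewrite in_setT.
  by apply: eq_eseriesr => k _; rewrite expr1n mul1r.
have mU : measurable (\bigcup_k A k) by exact: bigcupT_measurable.
have PUC : P (~` (\bigcup_k A k)) = 0%E by rewrite probability_setC// PU subee.
have f1 : (fun w => eps a w * eps b w) \in Lfun P 1.
  apply: (bounded_mul_L1 P _ _ 1); [exact: measurable_parity|exact: norm_parity|].
  by apply/L2_L1/(bounded_L2 P _ 1); [exact: measurable_parity|exact: norm_parity].
have /Lfun1_integrable if1 := f1.
rewrite /Rintegral -(setUv (\bigcup_k A k)) integral_setU_EFin//; last 3 first.
- exact: measurableC.
- by rewrite setUv; apply: (L1_measurable P).
- exact/disj_setPCl.
rewrite [X in (_ + X)%E]null_set_integral//; last 2 first.
- exact: measurableC.
- by apply: measurable_funTS; apply/measurable_EFinP; exact: (L1_measurable P).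
rewrite adde0 integral_bigcup//; last by apply: integrableS if1.
transitivity (fine (\sum_(k <oo) ((-1) ^+ k * poisson_pmf lam k)%:E)%E); last first.
  rewrite sum_expr_poisson_pmf//=; congr expR; rewrite /lam; ring.
congr fine; apply: eq_eseriesr => k _.
rewrite (eq_integral (fun=> ((-1) ^+ k)%:E)); last first.
  move=> w /set_mem /= Nw; congr EFin; rewrite /parity Nw exprD mulrA.
  by rewrite -expr2 sqrr_sign mul1r.
by rewrite integral_cst// EFinM; congr (_ * _)%E; exact: PA.
Qed.

Lemma cos_pi_nat n : cos (pi *+ n) = (-1) ^+ n :> R.
Proof.
elim: n => [|n IH]; first by rewrite mulr0n cos0 expr0.
by rewrite mulrS addrC cosDpi IH exprS mulN1r.
Qed.

Lemma sin_pi_nat n : sin (pi *+ n) = 0 :> R.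
Proof.
elim: n => [|n IH]; first by rewrite mulr0n sin0.
by rewrite mulrS addrC sinDpi IH oppr0.
Qed.

(** Independence of increments concerns the real variable [N b - N a]; the cosine
    extends the parity to such an argument without recovering an integer. *)
Lemma parity_increment a b w :
  eps a w * eps b w = cos (pi * ((N b w)%:R - (N a w)%:R)).
Proof.
rewrite mulrBr !mulr_natr cosB !cos_pi_nat !sin_pi_nat mulr0 addr0.
by rewrite mulrC.
Qed.

Lemma E_parity4 (a b c e : R) : 0 <= a -> a <= b -> b <= c -> c <= e ->
  E (fun w => (eps a w * eps b w) * (eps c w * eps e w)) =
  expR (- (2 * rate * (b - a))) * expR (- (2 * rate * (e - c))).
Proof.
move=> a0 ab bc ce; have c0 : 0 <= c by rewrite (le_trans a0)// (le_trans ab).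
have [_ _ ind _] := ppN.
have m2 x y : (fun w => eps x w * eps y w) \in Lfun P 2%:E.
  apply: (bounded_mul_L2 P _ _ 1); [exact: measurable_parity|exact: norm_parity|].
  by apply: (bounded_L2 P _ 1); [exact: measurable_parity|exact: norm_parity].
rewrite -(E_parity2 _ _ a0 ab) -(E_parity2 _ _ c0 ce).
apply: E_indep; [exact/L2_L1/m2|exact/L2_L1/m2|exact: L2M_L1|].
have mcos : measurable_fun setT (fun x : R => cos (pi * x)).
  apply: continuous_measurable_fun => x.
  apply: (@continuous_comp _ _ _ (fun x => pi * x) cos).
    by apply: cvgM; [exact: cvg_cst|exact: cvg_id].
  exact: continuous_cos.
have := independent_rv_comp P _ _ _ _ mcos mcos
  (independent_disjoint_increments P _ _ _ _ _ ind a0 ab bc ce).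
congr (independent_rv P _ _); apply/funext => w; rewrite /= parity_increment//.
Qed.

(** A Poisson variable of parameter [lam] exceeds [1] with probability
   [1 - (1 + lam) exp (- lam) <= lam ^ 2], because [1 - lam <= exp (- lam)]. *)
Lemma double_jump_le (a b : R) : 0 <= a -> a < b ->
  measurable [set w | (N a w + 1 < N b w)%N] /\
  (P [set w | (N a w + 1 < N b w)%N] <= ((rate * (b - a)) ^+ 2)%:E)%E.
Proof.
move=> a0 ab; case: ppN => _ _ _ law; set lam := rate * (b - a).
have lam0 : 0 < lam by rewrite mulr_gt0// subr_gt0.
set B := [set w | _].
have mB : measurable B.
  rewrite (_ : B = (fun w => (N b w)%:R - (N a w)%:R : R) @^-1` `]1, +oo[%classic).
    rewrite -[_ @^-1` _]setTI.
    have : measurable_fun setT (fun w => (N b w)%:R - (N a w)%:R : R).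
      by apply: measurable_funB; exact: (measurable_comp_nat (fun n => n%:R)).
    by apply.
  by apply/seteqP; split=> w; rewrite /B/= in_itv/= andbT ltrBrDl -[1]/(1%:R) -natrD ltr_nat.
split => //.
pose A k := [set w | N b w = (N a w + k)%N].
have mA k : measurable (A k) := measurable_jump a b k.
have dA : A 0%N `&` A 1%N = set0.
  by apply/seteqP; split=> // w []; rewrite /A /= => ->; lia.
have PA : P (A 0%N `|` A 1%N) = ((poisson_pmf lam 0)%:E + (poisson_pmf lam 1)%:E)%E.
  rewrite measureU//; congr (_ + _)%E; exact: law.
have : (P (A 0%N `|` A 1%N) <= P (~` B))%E.
  apply: le_measure; rewrite ?inE; [exact: measurableU|exact: measurableC|].
  by rewrite /A /B => w [] /= ->; lia.
rewrite PA probability_setC//.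
have PB : P B \is a fin_num by exact: fin_num_measure.
rewrite -(fineK PB) -EFinD -[1%E]/(1%:E) -EFinB !lee_fin /poisson_pmf lam0 expr0 expr1 fact0 factS fact0.
rewrite muln1 invr1 !mulr1 mul1r.
have := expR_ge1Dx (- lam); have := expR_ge0 (- lam).
move: (fine (P B)) (expR (- lam)) => p x; nra.
Qed.

End poisson_moments.

(** * Paths that swap at the jumps of a counting path *)
Section heine.
Context {R : realType}.

(** The Heine-Cantor theorem, by compactness of [[0, b]]. *)
Lemma within_continuous_uniform (f : R -> R) (b e : R) :
  {within `[0 : R, +oo[, continuous f} -> 0 < e ->
  exists2 delta, 0 < delta & forall x y, 0 <= x <= b -> 0 <= y <= b ->
    `|x - y| < delta -> `|f x - f y| < e.
Proof.
move=> /subspace_continuousP cf e0.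
have /compact_near_coveringP cov := @segment_compact R 0 b.
pose Q (delta x : R) := 0 <= x <= b -> forall y, 0 <= y <= b ->
  `|x - y| < delta -> `|f x - f y| < e.
have : \forall delta \near (0 : R)^'+, `[0, b]%classic `<=` Q delta.
  apply: (cov _ (0 : R)^'+ Q) => x /=; rewrite in_itv/= => x0b.
  have xin : [set` `[0 : R, +oo[] x by rewrite /= in_itv/= andbT; case/andP: x0b.
  have e20 : 0 < e / 2 by rewrite divr_gt0.
  have /nbhs_ballP[r /= r0 fr] :
      \forall y \near x, [set` `[0 : R, +oo[] y -> `|f x - f y| < e / 2.
    by have /cvgrPdist_lt/(_ _ e20) := cf x xin.
  exists (ball x (r / 2), [set delta | delta < r / 2]).
    split; first by apply: nbhsx_ballx; rewrite divr_gt0.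
    by apply: nbhs_right_lt; rewrite divr_gt0.
  move=> [x' delta] /= [xx' dr] x'0b y y0b x'y.
  have f1 : `|f x - f x'| < e / 2.
    apply: fr; last by rewrite in_itv/= andbT; case/andP: x'0b.
    by rewrite /ball/= in xx' *; rewrite (lt_le_trans xx')// ler_pdivrMr// ler_pMr// ler1n.
  have f2 : `|f x - f y| < e / 2.
    apply: fr; last by rewrite in_itv/= andbT; case/andP: y0b.
    rewrite /ball/= in xx' *.
    have -> : x - y = (x - x') + (x' - y) by ring.
    rewrite (le_lt_trans (ler_normD _ _))// [r]splitr ltrD//.
    exact: lt_trans dr.
  have -> : f x' - f y = - (f x - f x') + (f x - f y) by ring.
  by rewrite (le_lt_trans (ler_normD _ _))// normrN [e]splitr ltrD.
move=> nearQ; near (0 : R)^'+ => delta.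
exists delta; first by near: delta; exact: nbhs_right_gt.
move=> x y x0b y0b xy; have Qd : `[0, b]%classic `<=` Q delta by near: delta.
by apply: (Qd x) => //; rewrite /= in_itv.
Unshelve. all: by end_near. Qed.

End heine.

Section counting_path.
Context {R : realType}.
Variable n : R -> nat.
Hypothesis n_nd : forall a b, 0 <= a -> a <= b -> (n a <= n b)%N.
Hypothesis n_rc : forall t, 0 <= t -> (n u)%:R @[u --> t^'+] --> ((n t)%:R : R).

Local Notation nR := (fun t => (n t)%:R : R).

Definition jump_size (u : R) : R := nR u - left_limit nR u.

(** The condition under which the finitely supported sum [counting_integral] really
    ranges over all jumps. *)
Definition finite_jumps (t : R) : Prop :=
  finite_set [set u | 0 < u <= t /\ jump_size u != 0].

Lemma left_limit_eq (f g : R -> R) (a u l : R) : a < u ->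
  (forall v, a <= v < u -> f v = g v) -> g v @[v --> u^'-] --> l ->
  left_limit f u = l.
Proof.
move=> au fg gl; apply/cvg_lim => //; apply: cvg_trans gl; apply: near_eq_cvg.
near=> v; apply/esym/fg; apply/andP; split.
  by apply: ltW; near: v; exact: nbhs_left_gt.
by near: v; exact: nbhs_left_lt.
Unshelve. all: by end_near. Qed.

Lemma jump_size_const (a u : R) : a < u -> (forall v, a <= v <= u -> n v = n u) ->
  jump_size u = 0.
Proof.
move=> au nu; rewrite /jump_size (@left_limit_eq _ (fun=> nR u) a _ (nR u)) ?subrr//.
- by move=> v /andP[av vu]; rewrite nu// av ltW.
- exact: cvg_cst.
Qed.

Lemma n_const a b u : 0 <= a -> n b = n a -> a <= u <= b -> n u = n b.
Proof.
move=> a0 nba /andP[au ub]; apply/eqP; rewrite eqn_leq n_nd ?(le_trans a0)//=.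
by rewrite nba n_nd.
Qed.

(** The jump occurs at the infimum of the times at which the path has its final
    value; right continuity gives it that value already there. *)
Lemma single_jump (a b : R) : 0 <= a -> a < b -> n b = (n a).+1 ->
  exists u, [/\ a < u <= b, forall v, a <= v < u -> n v = n a &
    forall v, u <= v <= b -> n v = n b].
Proof.
move=> a0 ab nba; pose A := [set v | a <= v <= b /\ n v = n b].
have Ab : A b by split=> //; rewrite lexx ltW.
have lA : has_lbound A by exists a => v [/andP[]].
have hA : has_inf A by split => //; exists b.
set u := inf A.
have au : a <= u by apply: lb_le_inf; [exists b|move=> v [/andP[]]].
have ub : u <= b by apply: ge_inf.
have u0 := le_trans a0 au.
have below v : a <= v < u -> n v = n a.
  move=> /andP[av vu]; have := n_nd _ _ a0 av.
  have := n_nd _ _ (le_trans a0 av) (le_trans (ltW vu) ub).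
  rewrite nba leq_eqVlt => /orP[/eqP nv|]; last by rewrite ltnS => ? ?; lia.
  have : u <= v by apply: ge_inf => //; split; [rewrite av (le_trans (ltW vu))|lia].
  by rewrite leNgt vu.
have above v : u < v <= b -> n v = n b.
  move=> /andP[uv vb]; have uv0 : 0 < v - u by rewrite subr_gt0.
  have [w [/andP[aw wb] nw]] := inf_adherent uv0 hA.
  rewrite addrC subrK => wv; apply/eqP; rewrite eqn_leq n_nd ?(le_trans u0 (ltW uv))//=.
  by rewrite -nw n_nd// ?(le_trans a0)// ltW.
have nu : n u = n b.
  have [->//|uneb] := eqVneq u b.
  have ultb : u < b by rewrite lt_neqAle uneb.
  have h1 := n_rc u u0.
  have h2 : nR v @[v --> u^'+] --> nR b.
    apply: cvg_near_cst; near=> v; rewrite above//; apply/andP; split.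
      by near: v; exact: nbhs_right_gt.
    by near: v; exact: nbhs_right_ltW.
  by apply/eqP; rewrite -(eqr_nat R); apply/eqP; exact: cvg_unique h1 h2.
exists u; split => //.
- rewrite ub andbT lt_neqAle au andbT; apply/eqP => aeu.
  by move: nu; rewrite -aeu nba => /eqP; rewrite ltn_eqF.
- move=> v /andP[]; rewrite le_eqVlt => /orP[/eqP <-//|uv vb].
  by apply: above; rewrite uv.
Unshelve. all: by end_near. Qed.

Lemma jump_size_outside (a b u v : R) : 0 <= a -> a < u <= b ->
  (forall w, a <= w < u -> n w = n a) -> (forall w, u <= w <= b -> n w = n b) ->
  a < v <= b -> v != u -> jump_size v = 0.
Proof.
move=> a0 /andP[au ub] below above /andP[av vb] vu.
have [vltu|ultv|/eqP] := ltgtP v u; last by rewrite (negbTE vu).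
  apply: (@jump_size_const a) => // w /andP[aw wv].
  by rewrite below ?aw ?(le_lt_trans wv)// below// (ltW av).
apply: (@jump_size_const u) => // w /andP[uw wv].
by rewrite above ?uw ?(le_trans wv)// above// (ltW ultv).
Qed.

Lemma jump_size_single (a b u : R) : 0 <= a -> n b = (n a).+1 -> a < u <= b ->
  (forall w, a <= w < u -> n w = n a) -> (forall w, u <= w <= b -> n w = n b) ->
  jump_size u = 1.
Proof.
move=> a0 nba /andP[au ub] below above; rewrite /jump_size.
rewrite (@left_limit_eq _ (fun=> nR a) a _ (nR a)) //.
- by rewrite above ?lexx// nba -natr1 addrC addKr.
- by move=> v vau; rewrite below.
- exact: cvg_cst.
Qed.

Lemma finite_jumps_const a b : 0 <= a -> a <= b -> n b = n a ->
  finite_jumps a -> finite_jumps b.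
Proof.
move=> a0 ab nba; apply: sub_finite_set => u /= [/andP[u0 ub] ju].
split=> //; rewrite u0 leNgt; apply/negP => au; move/eqP: ju; apply.
apply: (@jump_size_const a) => // v /andP[av vu].
by rewrite !(n_const a b _ a0 nba) ?av ?(le_trans vu)// (ltW au).
Qed.

Lemma finite_jumps_single a b u : 0 <= a -> a < u <= b ->
  (forall w, a <= w < u -> n w = n a) -> (forall w, u <= w <= b -> n w = n b) ->
  finite_jumps a -> finite_jumps b.
Proof.
move=> a0 aub below above fa.
apply: (@sub_finite_set _ _ ([set v | 0 < v <= a /\ jump_size v != 0] `|` [set u])).
  move=> v /= [/andP[v0 vb] jv]; have [->|vu] := eqVneq v u; [by right|left].
  split=> //; rewrite v0 leNgt; apply/negP => av; move/eqP: jv; apply.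
  by apply: (@jump_size_outside a b u) => //; rewrite av.
by rewrite finite_setU; split => //; exact: finite_set1.
Qed.

Lemma counting_integralE (h : R -> R) t :
  counting_integral h nR t = \sum_(u \in `]0, t]) h u * jump_size u.
Proof. by []. Qed.

Lemma counting_integral_const (h : R -> R) a b : 0 <= a -> a <= b -> n b = n a ->
  counting_integral h nR b = counting_integral h nR a.
Proof.
move=> a0 ab nba; rewrite !counting_integralE; apply/esym/fsbig_widen.
  by apply: subset_itvl; rewrite bnd_simp.
move=> u [/=]; rewrite !in_itv/= => /andP[u0 ub]; rewrite u0/= => /negP.
rewrite -ltNge => au; rewrite (@jump_size_const a) ?mulr0// => v /andP[av vu].
by rewrite !(n_const a b _ a0 nba) ?av ?(le_trans vu)// (ltW au).
Qed.

Lemma counting_integral_single (h : R -> R) a b u : 0 <= a -> n b = (n a).+1 ->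
  a < u <= b ->
  (forall w, a <= w < u -> n w = n a) -> (forall w, u <= w <= b -> n w = n b) ->
  finite_jumps a ->
  counting_integral h nR b = counting_integral h nR a + h u.
Proof.
move=> a0 nba aub below above fa; have /andP[au ub] := aub.
have ju : jump_size u = 1 by exact: (@jump_size_single a b).
pose A := [set v | 0 < v <= a /\ jump_size v != 0].
have suppE : \sum_(v \in A) h v * jump_size v = \sum_(v \in `]0, a]) h v * jump_size v.
  apply: fsbig_widen; first by move=> v [? _]; rewrite /= in_itv.
  move=> v [/=]; rewrite in_itv/= => v0a /not_andP[//|/negP]; rewrite negbK.
  by move=> /eqP ->; rewrite mulr0.
rewrite !counting_integralE -suppE.
transitivity (\sum_(v \in A `|` [set u]) h v * jump_size v).
  apply/esym/fsbig_widen.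
    move=> v [[/andP[v0 va] _]|->]; rewrite /= in_itv/=.
      by rewrite v0 (le_trans va)// (le_trans (ltW au)).
    by rewrite ub (le_lt_trans a0 au).
  move=> v [/=]; rewrite in_itv/= => /andP[v0 vb] /not_orP[nA /eqP vu].
  have [va|av] := leP v a.
    have := nA; rewrite /A /= v0 va => /not_andP[//|/negP]; rewrite negbK => /eqP ->.
    by rewrite mulr0.
  by rewrite (@jump_size_outside a b u) ?mulr0// av.
rewrite fsbigU//=; first by rewrite fsbig_set1 ju mulr1.
by move=> v [[/andP[_ va] _] /= vu]; move: va; rewrite vu leNgt au.
Qed.

Section swapped_path.
Variables (x y xi yi : R -> R).
Hypothesis x_eq : forall t, 0 <= t -> x t = x 0 + xi t
  + counting_integral (fun u => left_limit y u - left_limit x u) nR t.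
Hypothesis y_eq : forall t, 0 <= t -> y t = y 0 + yi t
  + counting_integral (fun u => left_limit x u - left_limit y u) nR t.
Hypothesis cxi : {within `[0 : R, +oo[, continuous xi}.
Hypothesis cyi : {within `[0 : R, +oo[, continuous yi}.

Local Notation D := (fun t => x t - y t).
Local Notation z := (fun t => xi t - yi t).
Local Notation eps := (fun t => (-1) ^+ n t : R).

Lemma continuous_left (f : R -> R) u : {within `[0 : R, +oo[, continuous f} ->
  0 < u -> f v @[v --> u^'-] --> f u.
Proof.
move=> cf u0; apply/cvgrPdist_lt => e e0.
have [delta d0 fd] := within_continuous_uniform f u e cf e0.
near=> v; apply: fd.
- by rewrite lexx ltW.
- apply/andP; split; apply: ltW; last by near: v; exact: nbhs_left_lt.
  by near: v; exact: nbhs_left_gt.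
- rewrite ger0_norm; last by rewrite subr_ge0 ltW//; near: v; exact: nbhs_left_lt.
  by near: v; exact: nbhs_left_ltBl.
Unshelve. all: by end_near. Qed.

Lemma no_jump_path a b : 0 <= a -> a <= b -> n b = n a ->
  x b - x a = xi b - xi a /\ y b - y a = yi b - yi a.
Proof.
move=> a0 ab nba; have b0 := le_trans a0 ab.
rewrite (x_eq b)// (x_eq a)// (y_eq b)// (y_eq a)//.
by rewrite !(counting_integral_const _ a b)//; split; ring.
Qed.

Lemma left_limit_no_jump a u : 0 <= a -> a < u -> (forall v, a <= v < u -> n v = n a) ->
  left_limit x u = x a + xi u - xi a /\ left_limit y u = y a + yi u - yi a.
Proof.
move=> a0 au nv; have u0 := le_lt_trans a0 au; split.
- apply: (@left_limit_eq _ (fun v => x a + xi v - xi a) a) => //.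
    move=> v /andP[av vu].
    have nva : n v = n a by apply: nv; rewrite av.
    by have [+ _] := no_jump_path a v a0 av nva; lra.
  by apply: cvgB; [apply: cvgD; [exact: cvg_cst|exact: continuous_left]|exact: cvg_cst].
- apply: (@left_limit_eq _ (fun v => y a + yi v - yi a) a) => //.
    move=> v /andP[av vu].
    have nva : n v = n a by apply: nv; rewrite av.
    by have [_ +] := no_jump_path a v a0 av nva; lra.
  by apply: cvgB; [apply: cvgD; [exact: cvg_cst|exact: continuous_left]|exact: cvg_cst].
Qed.

(** If the cell contains a swap, at time [u], then [eps D] follows [eps a * z] up
    to [u] and its opposite afterwards, so freezing the sign costs twice the
    increment of [z] over [[u, b]]. Without a swap there is no error. *)
Lemma one_cell (eta a b : R) : 0 <= a -> a < b -> (n b <= (n a).+1)%N ->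
  finite_jumps a -> (forall u, a <= u <= b -> `|z b - z u| <= eta) ->
  finite_jumps b /\
  `|eps b * D b - eps a * D a - eps a * (z b - z a)|
    <= 2 * eta * (nR b - nR a).
Proof.
move=> a0 ab nb fa osc; have b0 := le_trans a0 (ltW ab).
have := n_nd a b a0 (ltW ab); rewrite leq_eqVlt => /orP[/eqP nab|nab].
  split; first exact: (finite_jumps_const a b a0 (ltW ab)).
  have [ex ey] := no_jump_path a b a0 (ltW ab) (esym nab).
  rewrite nab subrr mulr0 (_ : _ - _ = 0) ?normr0//.
  have -> : x b = x a + (xi b - xi a) by rewrite -ex; ring.
  have -> : y b = y a + (yi b - yi a) by rewrite -ey; ring.
  ring.
have nba : n b = (n a).+1 by lia.
have [u [aub below above]] := single_jump a b a0 ab nba.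
have /andP[au ub] := aub.
split; first exact: (finite_jumps_single a b u).
have [lx ly] := left_limit_no_jump a u a0 au below.
have cs h := counting_integral_single h a b u a0 nba aub below above fa.
have xba : x b - x a = xi b - xi a + (left_limit y u - left_limit x u).
  by rewrite (x_eq b)// (x_eq a)// cs; ring.
have yba : y b - y a = yi b - yi a + (left_limit x u - left_limit y u).
  by rewrite (y_eq b)// (y_eq a)// cs; ring.
rewrite nba exprS.
have -> : (n a).+1%:R - (n a)%:R = 1 :> R by rewrite -natr1; ring.
have -> : -1 * (-1) ^+ n a * (x b - y b) - (-1) ^+ n a * (x a - y a)
    - (-1) ^+ n a * (xi b - yi b - (xi a - yi a))
  = (-1) ^+ n a * (- 2 * ((xi b - yi b) - (xi u - yi u))).
  have -> : x b = x a + (xi b - xi a + (left_limit y u - left_limit x u)).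
    by rewrite -xba; ring.
  have -> : y b = y a + (yi b - yi a + (left_limit x u - left_limit y u)).
    by rewrite -yba; ring.
  rewrite lx ly; ring.
rewrite normrM normrX normrN1 expr1n mul1r normrM normrN normr_nat mulr1.
by rewrite ler_pM2l//; apply: osc; rewrite ub ltW.
Qed.

(** Only the cells with a swap contribute an error, and the path counts them. *)
Lemma many_cells (eta : R) (t : nat -> R) K : 0 <= t 0 ->
  (forall k, (k < K)%N -> t k < t k.+1) ->
  (forall k, (k < K)%N -> (n (t k.+1) <= (n (t k)).+1)%N) ->
  (forall k u, (k < K)%N -> t k <= u <= t k.+1 -> `|z (t k.+1) - z u| <= eta) ->
  finite_jumps (t 0%N) -> 0 <= t K /\ finite_jumps (t K) /\
  `|eps (t K) * D (t K) - eps (t 0%N) * D (t 0%N)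
     - \sum_(0 <= k < K) eps (t k) * (z (t k.+1) - z (t k))|
    <= 2 * eta * (nR (t K) - nR (t 0%N)).
Proof.
move=> t00; elim: K => [|K IH] lt_t nt osc f0.
  by rewrite big_geq// !subrr normr0 mulr0.
have [tK0 [fK errK]] := IH (fun k h => lt_t k (ltnW h)) (fun k h => nt k (ltnW h))
  (fun k u h => osc k u (ltnW h)) f0.
have [fS errS] := one_cell eta (t K) (t K.+1) tK0 (lt_t K (leqnn _)) (nt K (leqnn _))
  fK (fun u => osc K u (leqnn _)).
split; first exact: le_trans tK0 (ltW (lt_t K (leqnn _))).
split=> //; rewrite big_nat_recr//=.
move: errK errS; set S := \sum_(0 <= k < K) _.
set eD0 := _ * (x (t 0%N) - _); set eDK := _ * (x (t K) - _).
set eDS := _ * (x (t K.+1) - _); set c := _ * (z _ - z _) => errK errS.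
have -> : eDS - eD0 - (S + c) = (eDK - eD0 - S) + (eDS - eDK - c) by ring.
apply: le_trans (ler_normD _ _) _.
have -> : 2 * eta * (nR (t K.+1) - nR (t 0%N))
  = 2 * eta * (nR (t K) - nR (t 0%N)) + 2 * eta * (nR (t K.+1) - nR (t K)) by ring.
exact: lerD.
Qed.

End swapped_path.

End counting_path.

(** * Grids without double jumps *)
Section grids.
Context {R : realType}.
Implicit Types a b : R.

Definition grid a b (K k : nat) : R := a + (b - a) * (k%:R / K%:R).

Lemma grid0 a b K : grid a b K 0 = a.
Proof. by rewrite /grid mul0r mulr0 addr0. Qed.

Lemma grid_last a b K : (0 < K)%N -> grid a b K K = b.
Proof. by move=> K0; rewrite /grid divff ?pnatr_eq0 -?lt0n// mulr1 addrC subrK. Qed.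

Lemma grid_step a b K k : grid a b K k.+1 - grid a b K k = (b - a) / K%:R.
Proof. by rewrite /grid -natr1; ring. Qed.

Lemma grid_lt a b K k : (0 < K)%N -> a < b -> grid a b K k < grid a b K k.+1.
Proof. by move=> K0 ab; rewrite -subr_gt0 grid_step divr_gt0 ?subr_gt0 ?ltr0n. Qed.

Lemma grid_le a b K j k : a <= b -> (j <= k)%N -> grid a b K j <= grid a b K k.
Proof.
move=> ab jk; rewrite /grid lerD2l ler_wpM2l ?subr_ge0// ler_wpM2r ?invr_ge0//.
by rewrite ler_nat.
Qed.

Lemma grid_ge a b K k : a <= b -> a <= grid a b K k.
Proof. by move=> ab; rewrite -[leLHS](grid0 a b K); exact: grid_le. Qed.

Lemma grid_le_last a b K k : (0 < K)%N -> a <= b -> (k <= K)%N -> grid a b K k <= b.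
Proof. by move=> K0 ab kK; rewrite -[leRHS](grid_last a b K K0); exact: grid_le. Qed.

Lemma grid_mul a b K m k : (0 < m)%N -> grid a b (K * m) (k * m) = grid a b K k.
Proof.
move=> m0; rewrite /grid !natrM; have [->|K0] := posnP K.
  by rewrite mul0r invr0 !mulr0.
by congr (_ + _ * _); field; rewrite !pnatr_eq0 -!lt0n K0 m0.
Qed.

Lemma finite_jumps0 (n : R -> nat) : finite_jumps n 0.
Proof.
apply: sub_finite_set (finite_set0 _) => u [/andP[u0]]; rewrite leNgt u0//.
Qed.

Lemma finite_jumps_cells (n : R -> nat) (t : nat -> R) K :
  (forall a b, 0 <= a -> a <= b -> (n a <= n b)%N) ->
  (forall t, 0 <= t -> (n u)%:R @[u --> t^'+] --> ((n t)%:R : R)) ->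
  0 <= t 0%N -> (forall k, (k < K)%N -> t k < t k.+1) ->
  (forall k, (k < K)%N -> (n (t k.+1) <= (n (t k)).+1)%N) ->
  finite_jumps n (t 0%N) -> 0 <= t K /\ finite_jumps n (t K).
Proof.
move=> n_nd n_rc t0; elim: K => [//|K IH] lt_t nt f0.
have [tK fK] := IH (fun k h => lt_t k (ltnW h)) (fun k h => nt k (ltnW h)) f0.
have lt_K := lt_t K (leqnn _); split; first exact: le_trans tK (ltW lt_K).
have := n_nd _ _ tK (ltW lt_K); rewrite leq_eqVlt => /orP[/eqP nab|nab].
  by apply: (finite_jumps_const n n_nd (t K)) => //; exact: ltW.
have nba : n (t K.+1) = (n (t K)).+1 by have := nt K (leqnn _); lia.
have [u [aub below above]] := single_jump n n_nd n_rc _ _ tK lt_K nba.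
exact: (finite_jumps_single n (t K) (t K.+1) u).
Qed.

(** Each half of a cell lies in that cell, and the path is nondecreasing. *)
Lemma cells_refine (n : R -> nat) a b K : 0 <= a -> a <= b -> (0 < K)%N ->
  (forall a b, 0 <= a -> a <= b -> (n a <= n b)%N) ->
  (forall k, (k < K)%N -> (n (grid a b K k.+1) <= (n (grid a b K k)).+1)%N) ->
  forall k, (k < K * 2)%N ->
    (n (grid a b (K * 2) k.+1) <= (n (grid a b (K * 2) k)).+1)%N.
Proof.
move=> a0 ab K0 n_nd nK k kK.
have g0 j : 0 <= grid a b (K * 2) j by rewrite (le_trans a0)// grid_ge.
have kh : (k./2 < K)%N by rewrite -ltn_double -!muln2; lia.
have := nK _ kh; rewrite -!(grid_mul a b K 2)//.
have lo : (n (grid a b (K * 2) (k./2 * 2)) <= n (grid a b (K * 2) k))%N.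
  by apply: n_nd => //; apply: grid_le => //; lia.
have hi : (n (grid a b (K * 2) k.+1) <= n (grid a b (K * 2) (k./2.+1 * 2)))%N.
  by apply: n_nd => //; apply: grid_le => //; lia.
lia.
Qed.

End grids.

Section almost_surely.
Context {d : measure_display} {T : measurableType d} {R : realType}.
Variable P : probability T R.

Lemma finite_union_bound (F : nat -> set T) (c : R) K :
  (forall k, (k < K)%N -> measurable (F k) /\ (P (F k) <= c%:E)%E) ->
  measurable [set w | exists2 k, (k < K)%N & F k w] /\
  (P [set w | exists2 k, (k < K)%N & F k w] <= (K%:R * c)%:E)%E.
Proof.
elim: K => [|K IH] FK.
  rewrite (_ : [set w | _] = set0) ?measure0 ?mul0r//.
  by apply/seteqP; split=> // w [].
have [mK PK] := IH (fun k h => FK k (ltnW h)); have [mF PF] := FK K (leqnn _).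
rewrite (_ : [set w | _] = [set w | exists2 k, (k < K)%N & F k w] `|` F K).
  split; first exact: measurableU.
  apply: (le_trans (measureU2 _ mK mF)).
  by rewrite -natr1 mulrDl mul1r EFinD; exact: leeD.
apply/seteqP; split=> w.
  by move=> [k]; rewrite ltnS leq_eqVlt => /orP[/eqP ->|kK] Fw; [right|left; exists k].
by move=> [[k kK Fw]|Fw]; [exists k => //; exact: ltnW|exists K].
Qed.

Lemma negligible_of_small (B : nat -> set T) (c : R) :
  (forall p, measurable (B p) /\ (P (B p) <= (c / (2 ^ p)%:R)%:E)%E) ->
  P.-negligible (\bigcap_p B p).
Proof.
move=> Bp; have mB : measurable (\bigcap_p B p).
  by apply: bigcapT_measurable => p; have [] := Bp p.
suff P0 : P (\bigcap_p B p) = 0%E by apply/negligibleP.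
apply/eqP; rewrite eq_le measure_ge0 andbT.
have PB : P (\bigcap_p B p) \is a fin_num by exact: fin_num_measure.
rewrite -(fineK PB) lee_fin.
have le_p p : fine (P (\bigcap_p B p)) <= c / (2 ^ p)%:R.
  have [mp Pp] := Bp p; rewrite -lee_fin fineK//; apply: le_trans Pp.
  by apply: le_measure; rewrite ?inE//; exact: bigcap_inf.
have cv : c / (2 ^ p)%:R @[p --> \oo] --> (0 : R).
  rewrite -(mulr0 c); apply: cvgM; first exact: cvg_cst.
  under eq_fun do rewrite natrX -exprVn.
  by apply: cvg_expr; rewrite ger0_norm ?invr_ge0// invf_lt1// ltr1n.
rewrite -(cvg_lim _ cv)//; apply: limr_ge; first exact: cvgP cv.
exact: nearW.
Qed.

(** A cell of length [h] contains two jumps with probability at most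
    [(rate * h) ^ 2], so some cell of the [p]-th grid does with probability
    [O (2 ^ - p)]. Almost surely this fails for some [p], and then for all larger
    ones, since the grids are nested. *)
Lemma ae_single_jumps (rate : R) (N : R -> {RV P >-> nat}) (a b : R) K :
  0 < rate -> poisson_process rate N -> 0 <= a -> a < b -> (0 < K)%N ->
  {ae P, forall w, exists p0, forall p, (p0 <= p)%N -> forall k, (k < K * 2 ^ p)%N ->
    (N (grid a b (K * 2 ^ p) k.+1) w <= (N (grid a b (K * 2 ^ p) k) w).+1)%N}.
Proof.
move=> rate0 ppN a0 ab K0; have [_ Nnd _ _] := ppN.
pose F p k := [set w | (N (grid a b (K * 2 ^ p) k) w + 1
  < N (grid a b (K * 2 ^ p) k.+1) w)%N].
pose B p := [set w | exists2 k, (k < K * 2 ^ p)%N & F p k w].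
have Kp p : (0 < K * 2 ^ p)%N by rewrite muln_gt0 K0 expn_gt0.
have Bp p : measurable (B p) /\ (P (B p) <= ((rate * (b - a)) ^+ 2 / (2 ^ p)%:R)%:E)%E.
  have := finite_union_bound (F p) ((rate * ((b - a) / (K * 2 ^ p)%:R)) ^+ 2) (K * 2 ^ p).
  case.
    move=> k _; rewrite -(grid_step a b _ k).
    apply: (double_jump_le P rate N rate0 ppN); last exact: grid_lt.
    by rewrite (le_trans a0)// grid_ge// ltW.
  move=> mB PB; split => //; apply: le_trans PB _; rewrite lee_fin.
  have K0' : 0 < K%:R :> R by rewrite ltr0n.
  have p0' : 0 < (2 ^ p)%:R :> R by rewrite ltr0n expn_gt0.
  rewrite natrM (_ : _ * _ ^+ 2 = (rate * (b - a)) ^+ 2 / (2 ^ p)%:R / K%:R); last first.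
    by field; rewrite !gt_eqF.
  rewrite ler_pdivrMr// ler_peMr ?divr_ge0 ?sqr_ge0//.
  by rewrite -[1]/(1%:R) ler_nat.
have neg : P.-negligible (\bigcap_p B p) := negligible_of_small B _ Bp.
have {neg} : {ae P, forall w, ~ (\bigcap_p B p) w}.
  by apply: negligibleS neg => w /= /contrapT.
apply: filterS2 Nnd => w [nd _] nB.
have [p0 nBp0] : exists p0, ~ B p0 w.
  by apply: contrapT => h; apply: nB => p _; apply: contrapT => nBp; apply: h; exists p.
exists p0; elim=> [|p IH] p0p.
  move: p0p; rewrite leqn0 => /eqP p00 k kK.
  by rewrite leqNgt; apply/negP => lt; apply: nBp0; rewrite p00; exists k => //; rewrite /F/=; lia.
move: p0p; rewrite leq_eqVlt => /orP[/eqP p0p|p0p].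
  move=> k kK; rewrite leqNgt; apply/negP => lt; apply: nBp0; rewrite p0p.
  by exists k => //; rewrite /F/=; lia.
rewrite expnSr mulnA; apply: (cells_refine (fun t => N t w)) => //.
- exact: ltW.
- exact: IH.
Qed.

End almost_surely.

(** * The signed difference as a limit of Riemann sums *)
Section swapping_paths.
Context {d : measure_display} {T : measurableType d} {R : realType}.
Variable P : probability T R.
Variables (mu1 mu2 sigma1 sigma2 s x0 y0 : R).
Variables (W1 W2 : R -> {RV P >-> R}) (N : R -> {RV P >-> nat}).
Variables (X Y : R -> {RV P >-> R}).
Hypothesis s_gt0 : 0 < s.
Hypothesis XY_bsp : brownian_swapping_process mu1 mu2 sigma1 sigma2 s x0 y0
  W1 W2 N X Y.

Local Notation eps := (parity N).
Local Notation D := (fun t w => X t w - Y t w).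

(** The process that drives the difference [X - Y] between swaps. *)
Definition drive (t : R) (w : T) : R :=
  (mu1 - mu2) * t + (sigma1 * W1 t w - sigma2 * W2 t w).

Lemma within_continuous_affine (f : R -> R) (c k : R) :
  {within `[0 : R, +oo[, continuous f} ->
  {within `[0 : R, +oo[, continuous (fun t => c * t + k * f t)}.
Proof.
move=> /subspace_continuousP cf; apply/subspace_continuousP => t t0.
apply: cvgD; apply: cvgM; [exact: cvg_cst|exact: cvg_within|exact: cvg_cst|].
exact: cf.
Qed.

Lemma mesh_cvg0 (c : R) K : (0 < K)%N -> c / (K * 2 ^ p)%:R @[p --> \oo] --> (0 : R).
Proof.
move=> K0; under eq_fun do rewrite natrM invfM mulrA.
rewrite -(mulr0 (c / K%:R)); apply: cvgM; first exact: cvg_cst.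
under eq_fun do rewrite natrX -exprVn.
by apply: cvg_expr; rewrite ger0_norm ?invr_ge0// invf_lt1// ltr1n.
Qed.

(** On almost every path the cells eventually contain at most one swap, and
    [many_cells] bounds the error by the number of swaps times the modulus of
    continuity of the drive. *)
Lemma riemann_sums_cvg (a b : R) K : 0 <= a -> a < b -> (0 < K)%N ->
  {ae P, forall w, \sum_(0 <= k < K * 2 ^ p) eps (grid a b (K * 2 ^ p) k) w
      * (drive (grid a b (K * 2 ^ p) k.+1) w - drive (grid a b (K * 2 ^ p) k) w)
    @[p --> \oo] --> eps b w * D b w - eps a w * D a w}.
Proof.
move=> a0 ab K0; case: XY_bsp => -[bm1 bm2 ppN] _ _ XY0 XYeq.
have [_ cW1 _ _] := bm1; have [_ cW2 _ _] := bm2; have [_ Npath _ _] := ppN.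
(* [many_cells] starts from finitely many jumps in [(0, a]]; a grid on [[0, a]]
   shows that there are. *)
have aux : {ae P, forall w, finite_jumps (fun t => N t w) a}.
  move: a0; rewrite le_eqVlt => /orP[/eqP <-|a0].
    by apply: nearW => w; exact: finite_jumps0.
  have sj := ae_single_jumps P s N 0 a 1 s_gt0 ppN (lexx 0) a0 isT.
  apply: filterS2 Npath sj => w [nd [rc _]] [p0 /(_ p0 (leqnn _)) sj].
  have K0' : (0 < 1 * 2 ^ p0)%N by rewrite mul1n expn_gt0.
  have := finite_jumps_cells (fun t => N t w) (grid 0 a (1 * 2 ^ p0)) (1 * 2 ^ p0) nd rc.
  rewrite grid0 grid_last//; case=> //.
  - by move=> k _; exact: grid_lt.
  - exact: finite_jumps0.
have sj := ae_single_jumps P s N a b K s_gt0 ppN a0 ab K0.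
apply: filterS (filterI aux (filterI sj (filterI Npath (filterI cW1 (filterI cW2 XYeq))))).
move=> w [fa [[p0 single] [[nd [rc _]] [c1 [c2 eqs]]]]].
pose xi t := mu1 * t + sigma1 * W1 t w.
pose yi t := mu2 * t + sigma2 * W2 t w.
have cxi : {within `[0 : R, +oo[, continuous xi} by exact: within_continuous_affine.
have cyi : {within `[0 : R, +oo[, continuous yi} by exact: within_continuous_affine.
have driveE t : drive t w = xi t - yi t by rewrite /drive /xi /yi; ring.
have cz : {within `[0 : R, +oo[, continuous (fun t => xi t - yi t)}.
  move: cxi cyi => /subspace_continuousP cxi /subspace_continuousP cyi.
  apply/subspace_continuousP => t t0.
  by apply: cvgB; [exact: cxi|exact: cyi].
have Xeq t : 0 <= t -> X t w = X 0 w + xi t + counting_integral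
    (fun u => left_limit (fun t => Y t w) u - left_limit (fun t => X t w) u)
    (fun t => (N t w)%:R) t.
  by move=> t0; have [-> _] := eqs t t0; rewrite /xi addrA.
have Yeq t : 0 <= t -> Y t w = Y 0 w + yi t + counting_integral
    (fun u => left_limit (fun t => X t w) u - left_limit (fun t => Y t w) u)
    (fun t => (N t w)%:R) t.
  by move=> t0; have [_ ->] := eqs t t0; rewrite /yi addrA.
apply/cvgrPdist_le => e e0.
pose eta := e / (2 * ((N b w)%:R + 1)).
have Nb1 : 0 < (N b w)%:R + 1 :> R by rewrite ltr_wpDl.
have eta0 : 0 < eta by rewrite divr_gt0// mulr_gt0.
have [delta delta0 osc] := within_continuous_uniform _ b eta cz eta0.
near=> p.
have Kp : (0 < K * 2 ^ p)%N by rewrite muln_gt0 K0 expn_gt0.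
have p0p : (p0 <= p)%N by near: p; exact: nbhs_infty_ge.
have mesh : (b - a) / (K * 2 ^ p)%:R < delta.
  near: p; have /cvgrPdist_lt/(_ _ delta0) := mesh_cvg0 (b - a) K K0.
  apply: filterS => p; rewrite sub0r normrN ger0_norm//.
  by rewrite divr_ge0// subr_ge0 ltW.
have := many_cells (fun t => N t w) nd rc (fun t => X t w) (fun t => Y t w) xi yi
  Xeq Yeq cxi cyi eta (grid a b (K * 2 ^ p)) (K * 2 ^ p).
rewrite grid0 grid_last//; case=> //.
- by move=> k _; exact: grid_lt.
- exact: single.
- move=> k u kK /andP[ku uk]; apply/ltW/osc.
  + rewrite grid_le_last ?(ltW ab)//.
    by rewrite (le_trans a0)// grid_ge// ltW.
  + rewrite (le_trans uk) ?grid_le_last ?(ltW ab)// andbT.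
    by rewrite (le_trans a0)// (le_trans _ ku)// grid_ge// ltW.
  + rewrite ger0_norm ?subr_ge0//; apply: le_lt_trans mesh.
    by rewrite -(grid_step a b _ k) lerB.
move=> _ [_]; under eq_bigr do rewrite -!driveE.
move=> /le_trans; apply.
apply: (@le_trans _ _ (2 * eta * ((N b w)%:R + 1))).
  apply: ler_wpM2l; first by rewrite mulr_ge0// ltW.
  by rewrite lerBlDr -addrA lerDl addr_ge0.
by rewrite /eta le_eqVlt; apply/orP; left; apply/eqP; field; rewrite gt_eqF.
Unshelve. all: by end_near. Qed.

End swapping_paths.

(** * Second moments of the swapping process *)

(** ** Independence of the swap times from the Brownian motions *)
Section swapping_moments.
Context {d : measure_display} {T : measurableType d} {R : realType}.
Variable P : probability T R.
Variables (mu1 mu2 sigma1 sigma2 s x0 y0 : R).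
Variables (W1 W2 : R -> {RV P >-> R}) (N : R -> {RV P >-> nat}).
Variables (X Y : R -> {RV P >-> R}).
Hypothesis s_gt0 : 0 < s.
Hypothesis XY_bsp : brownian_swapping_process mu1 mu2 sigma1 sigma2 s x0 y0
  W1 W2 N X Y.

Local Notation E f := (Rintegral P setT f).
Local Notation L1 f := (f \in Lfun P 1).
Local Notation L2 f := (f \in Lfun P 2%:E).
Local Notation eps := (parity N).
Local Notation D := (fun t w => X t w - Y t w).
Local Notation Z := (drive P mu1 mu2 sigma1 sigma2 W1 W2).
Local Notation m := (mu1 - mu2).
Local Notation v := (sigma1 ^+ 2 + sigma2 ^+ 2).

Definition process_events d' (T' : measurableType d') (V : R -> T -> T') :
    set (set T) :=
  \bigcup_(t in [set t : R | 0 <= t]) sigma_of_rv (V t).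

Local Notation events_N := (process_events _ _ (fun t => N t : T -> nat)).
Local Notation events_W :=
  (intersections (sigma_of_process (fun t => W1 t : T -> R))
                 (sigma_of_process (fun t => W2 t : T -> R))).

Lemma sigma_of_rv_measurable d' (T' : measurableType d') (f : {mfun T >-> T'}) :
  sigma_of_rv (f : T -> T') `<=` measurable.
Proof. by move=> _ [B mB <-]; exact: measurable_funP. Qed.

Lemma process_events_measurable d' (T' : measurableType d') (V : R -> {mfun T >-> T'}) :
  process_events _ _ (fun t => V t : T -> T') `<=` measurable.
Proof. by move=> A [t _]; exact: sigma_of_rv_measurable. Qed.

Lemma sigma_of_process_measurable d' (T' : measurableType d')
    (V : R -> {mfun T >-> T'}) :
  sigma_of_process (fun t => V t : T -> T') `<=` measurable.
Proof.
apply: smallest_sub; first exact: sigma_algebra_measurable.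
exact: process_events_measurable.
Qed.

Lemma sigma_of_process_setI d' (T' : measurableType d') (V : R -> T -> T') :
  setI_closed (sigma_of_process V).
Proof. by move=> A B; apply: (@measurableI _ (g_sigma_algebraType _)). Qed.

Lemma sigma_of_process_setT d' (T' : measurableType d') (V : R -> T -> T') :
  sigma_of_process V setT.
Proof. exact: (@measurableT _ (g_sigma_algebraType _)). Qed.

Lemma bsp_independent (A B C : set T) :
  sigma_of_process (fun t => W1 t : T -> R) A ->
  sigma_of_process (fun t => W2 t : T -> R) B ->
  sigma_of_process (fun t => N t : T -> nat) C ->
  P (A `&` B `&` C) = (P A * P B * P C)%E.
Proof.
move=> sA sB sC; case: XY_bsp => _ ind _ _ _.
have := ind [set: 'I_3]%SET (fun i => tnth [tuple A; B; C] i).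
have -> : \bigcap_(i in [set` [set: 'I_3]%SET]) tnth [tuple A; B; C] i = A `&` B `&` C.
  apply/seteqP; split=> w.
    move=> h; split; first split.
    - by have := h ord0; rewrite /= inE => /(_ isT).
    - by have := h (inord 1); rewrite /= inE (tnth_nth A)/= inordK// => /(_ isT).
    - by have := h (inord 2); rewrite /= inE (tnth_nth A)/= inordK// => /(_ isT).
  move=> [[Aw Bw] Cw] i _; rewrite (tnth_nth A).
  by case: i => [[|[|[|//]]]].
move=> ->.
  rewrite (eq_bigl xpredT); last by move=> i; rewrite inE.
  by rewrite !big_ord_recl big_ord0 mule1 !(tnth_nth A)/= muleA.
move=> i _; case: i => [[|[|[|//]]] Hi];
  rewrite /= !(tnth_nth set0) /=; first exact: sA; first exact: sB; exact: sC.
Qed.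

(** The independence of the three processes makes [N] independent of the pair
    [(W1, W2)]. All moments below are computed by factoring out the parities in
    this way. *)
Lemma E_split (F G : T -> R) M : adapted events_N F -> (forall w, `|F w| <= M) ->
  adapted events_W G -> L1 G ->
  L1 (fun w => F w * G w) /\ E (fun w => F w * G w) = E F * E G.
Proof.
move=> aF FM aG G1.
have mF := adapted_measurable events_N F (process_events_measurable _ _ N) aF.
have FG1 := bounded_mul_L1 P F G M mF FM G1; split => //.
apply: E_indep => //; first exact/L2_L1/(bounded_L2 P F M).
apply: independent_rv_sym => B C mB mC.
apply: (independent_intersections P (sigma_of_process (fun t => W1 t : T -> R))
  (sigma_of_process (fun t => W2 t : T -> R)) (sigma_of_process (fun t => N t : T -> nat))).
- exact: sigma_of_process_measurable.
- exact: sigma_of_process_measurable.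
- exact: sigma_of_process_measurable.
- exact: sigma_of_process_setI.
- exact: sigma_of_process_setI.
- exact: sigma_of_process_setT.
- exact: sigma_of_process_setT.
- exact: sigma_of_process_setT.
- exact: bsp_independent.
- by have := aG measurableT B mB; rewrite setTI.
- by have := aF measurableT C mC; rewrite setTI.
Qed.

Lemma adaptedM (G : set (set T)) (f g : T -> R) :
  adapted G f -> adapted G g -> adapted G (fun w => f w * g w).
Proof. exact: measurable_funM. Qed.

Lemma adaptedD (G : set (set T)) (f g : T -> R) :
  adapted G f -> adapted G g -> adapted G (fun w => f w + g w).
Proof. exact: measurable_funD. Qed.

Lemma adaptedB (G : set (set T)) (f g : T -> R) :
  adapted G f -> adapted G g -> adapted G (fun w => f w - g w).
Proof. exact: measurable_funB. Qed.

Lemma adapted_cst (G : set (set T)) (c : R) : adapted G (fun=> c).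
Proof. exact: measurable_cst. Qed.

Lemma adapted_parity t : 0 <= t -> adapted events_N (eps t).
Proof.
move=> t0 _ B mB; rewrite setTI; apply: sub_sigma_algebra; exists t => //.
by exists [set k | B ((-1) ^+ k)] => //; rewrite setTI.
Qed.

Lemma adapted_W1 t : 0 <= t -> adapted events_W (W1 t).
Proof.
move=> t0 _ B mB; rewrite setTI; apply: sub_sigma_algebra.
exists (W1 t @^-1` B); last by exists setT; [exact: sigma_of_process_setT|rewrite setIT].
by apply: sub_sigma_algebra; exists t => //; exists B => //; rewrite setTI.
Qed.

Lemma adapted_W2 t : 0 <= t -> adapted events_W (W2 t).
Proof.
move=> t0 _ B mB; rewrite setTI; apply: sub_sigma_algebra.
exists setT; first exact: sigma_of_process_setT.
exists (W2 t @^-1` B); last by rewrite setTI.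
by apply: sub_sigma_algebra; exists t => //; exists B => //; rewrite setTI.
Qed.

Lemma adapted_drive t : 0 <= t -> adapted events_W (Z t).
Proof.
move=> t0; apply: adaptedD; first exact: adapted_cst.
apply: adaptedB; apply: adaptedM; [exact: adapted_cst|exact: adapted_W1|
  exact: adapted_cst|exact: adapted_W2].
Qed.

(** ** Moments of the driving noise *)

Let bm1 : brownian_motion W1. Proof. by case: XY_bsp => -[]. Qed.
Let bm2 : brownian_motion W2. Proof. by case: XY_bsp => -[]. Qed.
Let ppN : poisson_process s N. Proof. by case: XY_bsp => -[]. Qed.

Lemma E_cross (a b c e : R) : 0 <= a -> a <= b -> 0 <= c -> c <= e ->
  E (fun w => (W1 b w - W1 a w) * (W2 e w - W2 c w)) = 0.
Proof.
move=> a0 ab c0 ce; have b0 := le_trans a0 ab; have e0 := le_trans c0 ce.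
have f2 := bm_L2 P W1 bm1 a b a0 ab; have g2 := bm_L2 P W2 bm2 c e c0 ce.
rewrite E_indep.
- by rewrite (bm_mean P W1 bm1)// mul0r.
- exact: L2_L1.
- exact: L2_L1.
- exact: L2M_L1.
move=> B C mB mC.
have incr (V : R -> {mfun T >-> R}) (p q : R) (U : set R) : 0 <= p -> 0 <= q -> measurable U ->
    sigma_of_process (fun t => V t : T -> R) ((fun w => V q w - V p w) @^-1` U).
  move=> p0 q0 mU.
  have aV t : 0 <= t -> adapted (process_events _ _ (fun t => V t : T -> R)) (V t).
    move=> t0 _ U' mU'; rewrite setTI; apply: sub_sigma_algebra; exists t => //.
    by exists U' => //; rewrite setTI.
  have := adaptedB _ _ _ (aV q q0) (aV p p0) measurableT U mU.
  by rewrite setTI.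
have := bsp_independent _ _ _ (incr W1 a b B a0 b0 mB) (incr W2 c e C c0 e0 mC)
  (sigma_of_process_setT _ _ _).
by rewrite setIT probability_setT mule1.
Qed.

Definition noise1 (a b : R) (w : T) : R := sigma1 * (W1 b w - W1 a w).
Definition noise2 (a b : R) (w : T) : R := sigma2 * (W2 b w - W2 a w).

Lemma drive_incr a b w : Z b w - Z a w = m * (b - a) + (noise1 a b w - noise2 a b w).
Proof. by rewrite /drive /noise1 /noise2; ring. Qed.

Lemma noise1_L2 a b : 0 <= a -> a <= b -> L2 (noise1 a b).
Proof. by move=> a0 ab; apply: L2Z; exact: bm_L2. Qed.

Lemma noise2_L2 a b : 0 <= a -> a <= b -> L2 (noise2 a b).
Proof. by move=> a0 ab; apply: L2Z; exact: bm_L2. Qed.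

Lemma E_noise1 a b : 0 <= a -> a <= b -> E (noise1 a b) = 0.
Proof.
move=> a0 ab; rewrite EZ ?(bm_mean P W1 bm1) ?mulr0//.
exact/L2_L1/bm_L2.
Qed.

Lemma E_noise2 a b : 0 <= a -> a <= b -> E (noise2 a b) = 0.
Proof.
move=> a0 ab; rewrite EZ ?(bm_mean P W2 bm2) ?mulr0//.
exact/L2_L1/bm_L2.
Qed.

Lemma E_noise1M a b c e (q : R) : 0 <= a -> a <= b -> 0 <= c -> c <= e ->
  E (fun w => (W1 b w - W1 a w) * (W1 e w - W1 c w)) = q ->
  E (fun w => noise1 a b w * noise1 c e w) = sigma1 ^+ 2 * q.
Proof.
move=> a0 ab c0 ce <-; rewrite -EZ; last by apply: L2M_L1; exact: bm_L2.
by apply: eq_Rintegral => w _; rewrite /noise1; ring.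
Qed.

Lemma E_noise2M a b c e (q : R) : 0 <= a -> a <= b -> 0 <= c -> c <= e ->
  E (fun w => (W2 b w - W2 a w) * (W2 e w - W2 c w)) = q ->
  E (fun w => noise2 a b w * noise2 c e w) = sigma2 ^+ 2 * q.
Proof.
move=> a0 ab c0 ce <-; rewrite -EZ; last by apply: L2M_L1; exact: bm_L2.
by apply: eq_Rintegral => w _; rewrite /noise2; ring.
Qed.

Lemma E_noise12 a b c e : 0 <= a -> a <= b -> 0 <= c -> c <= e ->
  E (fun w => noise1 a b w * noise2 c e w) = 0.
Proof.
move=> a0 ab c0 ce.
rewrite -(mulr0 (sigma1 * sigma2)) -(E_cross a b c e a0 ab c0 ce) -EZ; last first.
  by apply: L2M_L1; exact: bm_L2.
by apply: eq_Rintegral => w _; rewrite /noise1 /noise2; ring.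
Qed.

Lemma drive_incr_L2 a b : 0 <= a -> a <= b -> L2 (fun w => Z b w - Z a w).
Proof.
move=> a0 ab; under eq_fun do rewrite drive_incr.
apply: L2D; first exact: L2_cst.
by apply: L2B; [exact: noise1_L2|exact: noise2_L2].
Qed.

Lemma E_drive_incr a b : 0 <= a -> a <= b -> E (fun w => Z b w - Z a w) = m * (b - a).
Proof.
move=> a0 ab; under eq_Rintegral do rewrite drive_incr.
have n1 := L2_L1 P _ (noise1_L2 a b a0 ab); have n2 := L2_L1 P _ (noise2_L2 a b a0 ab).
rewrite ED; [|exact: L1_cst|exact: L1B].
by rewrite EB// E_noise1// E_noise2// E_cst subrr addr0.
Qed.

(** The drift contributes the product of the means; the noise contributes
   [q1] and [q2]. *)
Lemma E_drive_incrM a b c e (q1 q2 : R) : 0 <= a -> a <= b -> 0 <= c -> c <= e ->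
  E (fun w => (W1 b w - W1 a w) * (W1 e w - W1 c w)) = q1 ->
  E (fun w => (W2 b w - W2 a w) * (W2 e w - W2 c w)) = q2 ->
  E (fun w => (Z b w - Z a w) * (Z e w - Z c w))
    = m * (b - a) * (m * (e - c)) + (sigma1 ^+ 2 * q1 + sigma2 ^+ 2 * q2).
Proof.
move=> a0 ab c0 ce Eq1 Eq2.
have n1 := noise1_L2 a b a0 ab; have n2 := noise2_L2 a b a0 ab.
have n3 := noise1_L2 c e c0 ce; have n4 := noise2_L2 c e c0 ce.
have n12 := L2B P _ _ n1 n2; have n34 := L2B P _ _ n3 n4.
transitivity (E (fun w => m * (b - a) * (Z e w - Z c w)
   + (m * (e - c) * (noise1 a b w - noise2 a b w)
   + ((noise1 a b w * noise1 c e w - noise1 a b w * noise2 c e w)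
   - (noise1 c e w * noise2 a b w - noise2 a b w * noise2 c e w))))).
  by apply: eq_Rintegral => w _; rewrite !drive_incr; ring.
have p13 := L2M_L1 P _ _ n1 n3; have p14 := L2M_L1 P _ _ n1 n4.
have p32 := L2M_L1 P _ _ n3 n2; have p24 := L2M_L1 P _ _ n2 n4.
have q := L1B P _ _ (L1B P _ _ p13 p14) (L1B P _ _ p32 p24).
have r := L1Z P (m * (e - c)) _ (L2_L1 P _ n12).
have t := L1Z P (m * (b - a)) _ (L2_L1 P _ (drive_incr_L2 c e c0 ce)).
rewrite ED//; last exact: L1D.
rewrite ED// EZ; last exact/L2_L1/drive_incr_L2.
rewrite EZ; last exact: L2_L1.
rewrite (EB P (noise1 a b) (noise2 a b)); [|exact: L2_L1|exact: L2_L1].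
rewrite (EB P (fun w => _ - _) (fun w => _ - _)); [|exact: L1B|exact: L1B].
rewrite (EB P _ _ p13 p14) (EB P _ _ p32 p24) E_drive_incr// E_noise1// E_noise2//.
rewrite (E_noise1M a b c e q1)// (E_noise2M a b c e q2)// !E_noise12//.
ring.
Qed.

Lemma E_drive_sqr a b : 0 <= a -> a <= b ->
  E (fun w => (Z b w - Z a w) * (Z b w - Z a w)) = m ^+ 2 * (b - a) ^+ 2 + v * (b - a).
Proof.
move=> a0 ab; rewrite (E_drive_incrM a b a b (b - a) (b - a))//; first by ring.
  by rewrite -(bm_var P W1 bm1 a b a0 ab).
by rewrite -(bm_var P W2 bm2 a b a0 ab).
Qed.

Lemma E_drive_disjoint a b c e : 0 <= a -> a <= b -> b <= c -> c <= e ->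
  E (fun w => (Z b w - Z a w) * (Z e w - Z c w)) = m ^+ 2 * ((b - a) * (e - c)).
Proof.
move=> a0 ab bc ce; have c0 : 0 <= c by rewrite (le_trans a0)// (le_trans ab).
rewrite (E_drive_incrM a b c e 0 0)//; first by ring.
  exact: bm_orthogonal.
exact: bm_orthogonal.
Qed.

(** ** Riemann sums weighted by functionals of the swap times *)

Definition grid_incr (a b : R) (K k : nat) (w : T) : R :=
  Z (grid a b K k.+1) w - Z (grid a b K k) w.

Lemma grid_incr_L2 a b K k : 0 <= a -> a <= b -> L2 (grid_incr a b K k).
Proof.
move=> a0 ab; apply: drive_incr_L2; last exact: grid_le.
by rewrite (le_trans a0)// grid_ge.
Qed.

Lemma adapted_grid_incr a b K k : 0 <= a -> a <= b -> adapted events_W (grid_incr a b K k).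
Proof.
by move=> a0 ab; apply: adaptedB; apply: adapted_drive; rewrite (le_trans a0)// grid_ge.
Qed.

Lemma E_grid_incrM a b K k l : 0 <= a -> a <= b ->
  E (fun w => grid_incr a b K k w * grid_incr a b K l w)
  = m ^+ 2 * ((b - a) / K%:R) ^+ 2 + v * ((b - a) / K%:R) * (k == l)%:R.
Proof.
move=> a0 ab; have g0 j : 0 <= grid a b K j by rewrite (le_trans a0)// grid_ge.
rewrite /grid_incr; have [kl|lk|->] := ltngtP k l.
- rewrite E_drive_disjoint// ?grid_le// !grid_step mulr0 addr0; ring.
- under eq_Rintegral do rewrite mulrC.
  rewrite E_drive_disjoint// ?grid_le// !grid_step mulr0 addr0; ring.
- by rewrite E_drive_sqr// ?grid_le// !grid_step /= mulr1.
Qed.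

Section weighted_sums.
Variables (a b M : R) (K : nat) (c : nat -> T -> R).
Hypotheses (a0 : 0 <= a) (ab : a <= b).
Hypothesis ac : forall k, (k < K)%N -> adapted events_N (c k).
Hypothesis cM : forall k w, (k < K)%N -> `|c k w| <= M.

Lemma adapted_N_measurable (f : T -> R) : adapted events_N f -> measurable_fun setT f.
Proof. exact: adapted_measurable (process_events_measurable _ _ N). Qed.

Lemma weighted_sum_L2 : L2 (fun w => \sum_(k < K) c k w * grid_incr a b K k w).
Proof.
apply: L2_sum => k _; apply: (bounded_mul_L2 P _ _ M).
- by apply: adapted_N_measurable; apply: ac.
- by move=> w; exact: (cM k w (ltn_ord k)).
- exact: grid_incr_L2.
Qed.

(** Expanding the square and factoring each term by independence leaves the
    correlations of the weights, against the moments of the grid increments. *)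
Lemma E_weighted_sum_sqr F : adapted events_N F -> (forall w, `|F w| <= 1) ->
  E (fun w => F w * (\sum_(k < K) c k w * grid_incr a b K k w) ^+ 2)
  = \sum_(k < K) \sum_(l < K) E (fun w => F w * (c k w * c l w))
      * (m ^+ 2 * ((b - a) / K%:R) ^+ 2 + v * ((b - a) / K%:R) * (k == l)%:R).
Proof.
move=> aF F1.
have split_kl (k l : 'I_K) := E_split (fun w => F w * (c k w * c l w))
  (fun w => grid_incr a b K k w * grid_incr a b K l w) (1 * (M * M))
  (adaptedM _ _ _ aF (adaptedM _ _ _ (ac k (ltn_ord k)) (ac l (ltn_ord l)))).
have bound (k l : 'I_K) w : `|F w * (c k w * c l w)| <= 1 * (M * M).
  by rewrite normrM ler_pM// normrM ler_pM// cM.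
have {}split_kl (k l : 'I_K) := split_kl k l (bound k l)
  (adaptedM _ _ _ (adapted_grid_incr a b K k a0 ab) (adapted_grid_incr a b K l a0 ab))
  (L2M_L1 P _ _ (grid_incr_L2 a b K k a0 ab) (grid_incr_L2 a b K l a0 ab)).
transitivity (E (fun w => \sum_(k < K) \sum_(l < K) (F w * (c k w * c l w))
    * (grid_incr a b K k w * grid_incr a b K l w))).
  apply: eq_Rintegral => w _; rewrite expr2 big_distrlr/= mulr_sumr.
  apply: eq_bigr => k _; rewrite mulr_sumr; apply: eq_bigr => l _; ring.
rewrite E_sum; last first.
  by move=> k _; apply: L1_sum => l _; have [] := split_kl k l.
apply: eq_bigr => k _; rewrite E_sum; last by move=> l _; have [] := split_kl k l.
by apply: eq_bigr => l _; have [_ ->] := split_kl k l; rewrite E_grid_incrM.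
Qed.

Lemma sum_grid_weights : (0 < K)%N ->
  \sum_(k < K) \sum_(l < K)
      (m ^+ 2 * ((b - a) / K%:R) ^+ 2 + v * ((b - a) / K%:R) * (k == l)%:R)
  = m ^+ 2 * (b - a) ^+ 2 + v * (b - a).
Proof.
move=> K0; have KR : K%:R != 0 :> R by rewrite pnatr_eq0 -lt0n.
transitivity (\sum_(k < K) (m ^+ 2 * (b - a) ^+ 2 + v * (b - a)) / K%:R).
  apply: eq_bigr => k _; rewrite big_split/= sumr_const card_ord -mulr_natr.
  rewrite (bigD1 k)//= eqxx mulr1 big1 ?addr0; last first.
    by move=> l lk; rewrite eq_sym (negbTE lk) mulr0.
  by field.
by rewrite sumr_const card_ord -mulr_natr; field.
Qed.

Lemma E_weighted_sum_sqr_le kappa : (0 < K)%N ->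
  (forall k l, (k < K)%N -> (l < K)%N -> `|E (fun w => c k w * c l w)| <= kappa) ->
  E (fun w => (\sum_(k < K) c k w * grid_incr a b K k w) ^+ 2)
  <= kappa * (m ^+ 2 * (b - a) ^+ 2 + v * (b - a)).
Proof.
move=> K0 ck; have := E_weighted_sum_sqr (fun=> 1) (adapted_cst _ 1).
under eq_Rintegral do rewrite mul1r.
rewrite normr1 => -> //; rewrite -(sum_grid_weights K0) mulr_sumr.
apply: ler_sum => k _; rewrite mulr_sumr; apply: ler_sum => l _.
under eq_Rintegral do rewrite mul1r.
apply: ler_wpM2r; last exact: le_trans (ler_norm _) (ck _ _ _ _).
have h0 : 0 <= (b - a) / K%:R by rewrite divr_ge0// subr_ge0.
by rewrite addr_ge0// mulr_ge0 ?sqr_ge0// mulr_ge0// addr_ge0 ?sqr_ge0.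
Qed.

End weighted_sums.

(** ** The integral of the parity against the drive *)

Lemma E_parityM_le1 t u : `|E (fun w => eps t w * eps u w)| <= 1.
Proof.
apply: E_norm_le => [|w].
  apply: L2M_L1; apply: (bounded_L2 P _ 1);
    [exact: measurable_parity|exact: norm_parity|exact: measurable_parity|
     exact: norm_parity].
by rewrite normrM mulr_ile1 ?norm_parity.
Qed.

Lemma parity_L2 t : L2 (eps t).
Proof. by apply: (bounded_L2 P _ 1); [exact: measurable_parity|exact: norm_parity]. Qed.

(** [eps D] minus its initial value: the integral of the parity against the
   driving noise. *)
Definition signed_diff (t : R) (w : T) : R := eps t w * D t w - eps 0 w * D 0 w.

Local Notation M := signed_diff.

Lemma measurable_signed_diff t : measurable_fun setT (M t).
Proof.
apply: measurable_funB; apply: measurable_funM;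
  [exact: measurable_parity|exact: measurable_funB|
   exact: measurable_parity|exact: measurable_funB].
Qed.

(** The bound holds for each Riemann sum, since the parity has modulus one, and
    passes to the limit by [fatou_L2]. *)
Lemma signed_diff_incr a b : 0 <= a -> a <= b ->
  L2 (fun w => M b w - M a w) /\
  E (fun w => (M b w - M a w) ^+ 2) <= m ^+ 2 * (b - a) ^+ 2 + v * (b - a).
Proof.
move=> a0; rewrite le_eqVlt => /orP[/eqP <-|ab].
  split; first by under eq_fun do rewrite subrr; exact: L2_cst.
  under eq_Rintegral do rewrite subrr expr0n/=.
  by rewrite E_cst subrr expr0n/= !mulr0 addr0.
have b0 := le_trans a0 (ltW ab).
pose F p w := \sum_(k < 1 * 2 ^ p) eps (grid a b (1 * 2 ^ p) k) w
  * grid_incr a b (1 * 2 ^ p) k w.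
have ge0 p k : 0 <= grid a b (1 * 2 ^ p) k by rewrite (le_trans a0)// grid_ge// ltW.
apply: (fatou_L2 P F).
- move=> p; apply: (weighted_sum_L2 a b 1 (1 * 2 ^ p)
    (fun k => eps (grid a b (1 * 2 ^ p) k))) => //; first exact: ltW.
    by move=> k _; exact: adapted_parity.
  by move=> k w _; exact: norm_parity.
- by apply: measurable_funB; exact: measurable_signed_diff.
- have := riemann_sums_cvg P mu1 mu2 sigma1 sigma2 s x0 y0 W1 W2 N X Y s_gt0 XY_bsp
    a b 1 a0 ab isT.
  apply: filterS => w; rewrite (_ : _ - _ = M b w - M a w); last first.
    by rewrite /signed_diff; ring.
  by apply: cvg_trans; apply: near_eq_cvg; apply: nearW => p; rewrite big_mkord.
- move=> p; rewrite -[leRHS]mul1r; apply: (E_weighted_sum_sqr_le a b 1 (1 * 2 ^ p)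
    (fun k => eps (grid a b (1 * 2 ^ p) k))) => //.
  + exact: ltW.
  + by move=> k _; exact: adapted_parity.
  + by move=> k w _; exact: norm_parity.
  + by rewrite mul1n expn_gt0.
  + by move=> k l _ _; exact: E_parityM_le1.
Qed.

Lemma E_parity_diff_sqr a b : 0 <= a -> a <= b ->
  E (fun w => (eps b w - eps a w) ^+ 2) <= 4 * s * (b - a).
Proof.
move=> a0 ab.
apply: (@le_trans _ _ (E (fun w => 2 - 2 * (eps a w * eps b w)))).
  rewrite le_eqVlt; apply/orP; left; apply/eqP; apply: eq_Rintegral => w _.
  have := parity_sqr P N a w; have := parity_sqr P N b w.
  move: (eps a w) (eps b w) => p q; lra.
have p1 := L2M_L1 P _ _ (parity_L2 a) (parity_L2 b).
rewrite EB; [|exact: L1_cst|exact: L1Z].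
rewrite EZ// E_cst (E_parity2 P s N s_gt0 ppN)//.
have := expR_ge1Dx (- (2 * s * (b - a))); lra.
Qed.

Lemma parity_diff_L2 a b : L2 (fun w => eps b w - eps a w).
Proof. by apply: L2B; exact: parity_L2. Qed.

(** Rewrites a sum over coarse cells as one over finer cells: on a block of [q] cells
    the weight is constant and the increments telescope. *)
Lemma sum_blocks (c z : nat -> R) K q : (0 < q)%N ->
  \sum_(0 <= k < K * q) c (k %/ q)%N * (z k.+1 - z k)
  = \sum_(0 <= j < K) c j * (z (j.+1 * q)%N - z (j * q)%N).
Proof.
move=> q0; elim: K => [|K IH]; first by rewrite mul0n !big_geq.
rewrite big_nat_recr//= -IH (big_cat_nat _ (n := (K * q)%N))//=; last first.
  by rewrite mulSn leq_addl.
congr (_ + _); rewrite -telescope_sumr; last by rewrite mulSn leq_addl.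
rewrite mulr_sumr; apply: eq_big_nat => k /andP[Kk kK].
congr (c _ * _); apply/eqP; rewrite eqn_leq leq_divRL// Kk andbT.
by rewrite -ltnS ltn_divLR.
Qed.

Definition ito_sum (t : R) (K : nat) (w : T) : R :=
  \sum_(k < K) eps (grid 0 t K k) w * grid_incr 0 t K k w.

Lemma ito_sum_L2 t K : 0 <= t -> L2 (ito_sum t K).
Proof.
move=> t0; apply: (weighted_sum_L2 0 t 1 K (fun k => eps (grid 0 t K k))) => //.
  by move=> k _; apply: adapted_parity; exact: grid_ge.
by move=> k w _; exact: norm_parity.
Qed.

(** On the finer grids, whose Riemann sums converge to [M t], the coarse sum amounts
    to freezing the parity at the left ends of the coarse cells. The weights of the
    difference are [eps (fine point) - eps (left end)], of mean square at most
    [4 s (t / K)]. *)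
Lemma ito_sum_error t K : 0 < t -> (0 < K)%N ->
  L2 (fun w => M t w - ito_sum t K w) /\
  E (fun w => (M t w - ito_sum t K w) ^+ 2)
    <= 4 * s * (t / K%:R) * (m ^+ 2 * t ^+ 2 + v * t).
Proof.
move=> t0 K0; have t0' := ltW t0.
pose c p k w := eps (grid 0 t (K * 2 ^ p) k) w - eps (grid 0 t K (k %/ 2 ^ p)) w.
pose F p w := \sum_(k < K * 2 ^ p) c p k w * grid_incr 0 t (K * 2 ^ p) k w.
have p2 p : (0 < 2 ^ p)%N by rewrite expn_gt0.
have ac p k : (k < K * 2 ^ p)%N -> adapted events_N (c p k).
  by move=> _; apply: adaptedB; apply: adapted_parity; exact: grid_ge.
have c2 p k w : (k < K * 2 ^ p)%N -> `|c p k w| <= 2.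
  move=> _; rewrite (le_trans (ler_normB _ _))// -[2]/(1 + 1) lerD// norm_parity//.
have cL2 p k : L2 (c p k) by exact: parity_diff_L2.
have Ec p k : E (fun w => c p k w ^+ 2) <= 4 * s * (t / K%:R).
  rewrite /c -(grid_mul 0 t K (2 ^ p))//.
  apply: le_trans (E_parity_diff_sqr _ _ _ _) _; first exact: grid_ge.
    by apply: grid_le => //; exact: leq_trunc_div.
  rewrite ler_pM2l ?mulr_gt0// /grid subr0 !add0r -mulrBr ler_pM2l//.
  rewrite -mulrBl (natrM R K) ler_pdivrMr ?mulr_gt0 ?ltr0n// mulKf ?pnatr_eq0 -?lt0n//.
  by rewrite lerBlDr -natrD ler_nat {1}(divn_eq k (2 ^ p)) addnC leq_add2r ltnW// ltn_mod.
have := fatou_L2 P F (fun w => M t w - ito_sum t K w)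
  (4 * s * (t / K%:R) * (m ^+ 2 * t ^+ 2 + v * t)); apply.
- by move=> p; apply: (weighted_sum_L2 0 t 2 (K * 2 ^ p) (c p)) => //; [exact: ac|exact: c2].
- apply: measurable_funB; first exact: measurable_signed_diff.
  exact: (L2_measurable P _ (ito_sum_L2 t K t0')).
- have := riemann_sums_cvg P mu1 mu2 sigma1 sigma2 s x0 y0 W1 W2 N X Y s_gt0 XY_bsp
    0 t K (lexx 0) t0 K0.
  apply: filterS => w cvw.
  rewrite (_ : (fun p => F p w) = (fun p =>
    \sum_(0 <= k < K * 2 ^ p) eps (grid 0 t (K * 2 ^ p) k) w
      * (Z (grid 0 t (K * 2 ^ p) k.+1) w - Z (grid 0 t (K * 2 ^ p) k) w)
    - ito_sum t K w)); first by apply: cvgB => //; exact: cvg_cst.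
  apply/funext => p.
  have -> : ito_sum t K w = \sum_(0 <= k < K * 2 ^ p) eps (grid 0 t K (k %/ 2 ^ p)) w
      * grid_incr 0 t (K * 2 ^ p) k w.
    rewrite (sum_blocks (fun k => eps (grid 0 t K k) w)
      (fun k => Z (grid 0 t (K * 2 ^ p) k) w))//.
    by rewrite big_mkord; apply: eq_bigr => j _; rewrite !grid_mul.
  rewrite -sumrB /F -(big_mkord xpredT (fun k => c p k w * grid_incr 0 t (K * 2 ^ p) k w)).
  by apply: eq_bigr => k _; rewrite -mulrBl.
- move=> p; have := E_weighted_sum_sqr_le 0 t 2 (K * 2 ^ p) (c p) (lexx 0) t0'
    (ac p) (c2 p) (4 * s * (t / K%:R)); rewrite subr0; apply.
    by rewrite muln_gt0 K0 p2.
  move=> k l _ _; rewrite ler_norml.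
  have ckl := L2M_L1 P _ _ (cL2 p k) (cL2 p l).
  have sqk := L2_sqr P _ (cL2 p k); have sql := L2_sqr P _ (cL2 p l).
  (* Both signs of the product are at most half the sum of the squares. *)
  have half : E (fun w => 2^-1 * (c p k w ^+ 2 + c p l w ^+ 2)) <= 4 * s * (t / K%:R).
    rewrite EZ ?ED//; last exact: L1D.
    have := Ec p k; have := Ec p l; lra.
  have halfL1 : L1 (fun w => 2^-1 * (c p k w ^+ 2 + c p l w ^+ 2)).
    by apply: L1Z; exact: L1D.
  apply/andP; split.
    rewrite lerNl; apply: le_trans half.
    rewrite -mulN1r -EZ//; apply: E_le => //; first exact: L1Z.
    move=> w; rewrite -subr_ge0.
    rewrite (_ : _ - _ = 2^-1 * (c p k w + c p l w) ^+ 2); first by rewrite mulr_ge0 ?sqr_ge0.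
    by field.
  apply: le_trans half; apply: E_le => // w; rewrite -subr_ge0.
  rewrite (_ : _ - _ = 2^-1 * (c p k w - c p l w) ^+ 2); first by rewrite mulr_ge0 ?sqr_ge0.
  by field.
Qed.

Lemma signed_diff_L2 t : 0 <= t -> L2 (M t).
Proof.
move=> t0; have [+ _] := signed_diff_incr 0 t (lexx 0) t0.
by under eq_fun do rewrite [M 0 _]subrr subr0.
Qed.

(** A lower Riemann sum of an increasing exponential: by [1 + y <= exp y] each term
    is at most an increment of the antiderivative, and the increments
    telescope. *)
Lemma sum_exp_grid_le t K : 0 < t -> (0 < K)%N ->
  \sum_(k < K) expR (- (2 * s * (t - grid 0 t K k))) * (t / K%:R) <= (2 * s)^-1.
Proof.
move=> t0 K0; have s20 : 0 < 2 * s by rewrite mulr_gt0.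
pose g k := expR (- (2 * s * (t - grid 0 t K k))).
rewrite -(ler_pM2l s20) mulfV ?gt_eqF// mulr_sumr.
apply: (@le_trans _ _ (\sum_(0 <= k < K) (g k.+1 - g k))).
  rewrite big_mkord; apply: ler_sum => k _.
  have -> : g k.+1 = g k * expR (2 * s * (t / K%:R)).
    rewrite /g -expRD; congr expR.
    have := grid_step 0 t K k; rewrite subr0 => <-; ring.
  rewrite -/(g k); have := expR_ge1Dx (2 * s * (t / K%:R)).
  have := expR_ge0 (- (2 * s * (t - grid 0 t K k))); rewrite -/(g k).
  move: (g k) (t / K%:R) (expR _) => p q r; nra.
rewrite telescope_sumr// /g grid_last// subrr mulr0 oppr0 expR0.
by rewrite lerBlDr lerDl expR_ge0.
Qed.

Lemma parity_ito_split t u K (G : T -> R) : 0 <= t -> t <= u ->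
  adapted events_W G -> L2 G ->
  E (fun w => G w * eps u w * ito_sum t K w)
  = \sum_(k < K) expR (- (2 * s * (u - grid 0 t K k)))
      * E (fun w => G w * grid_incr 0 t K k w).
Proof.
move=> t0 tu aG G2; have u0 := le_trans t0 tu.
transitivity (E (fun w => \sum_(k < K) (eps (grid 0 t K k) w * eps u w)
    * (G w * grid_incr 0 t K k w))).
  apply: eq_Rintegral => w _; rewrite mulr_sumr; apply: eq_bigr => k _; ring.
have GL1 (k : 'I_K) := L2M_L1 P _ _ G2 (grid_incr_L2 0 t K k (lexx 0) t0).
have aGi (k : 'I_K) := adaptedM _ _ _ aG (adapted_grid_incr 0 t K k (lexx 0) t0).
have spl (k : 'I_K) : L1 (fun w => eps (grid 0 t K k) w * eps u w
      * (G w * grid_incr 0 t K k w)) /\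
    E (fun w => eps (grid 0 t K k) w * eps u w * (G w * grid_incr 0 t K k w))
    = E (fun w => eps (grid 0 t K k) w * eps u w) * E (fun w => G w * grid_incr 0 t K k w).
  apply: (E_split _ _ 1) => //.
    by apply: adaptedM; apply: adapted_parity => //; exact: grid_ge.
  by move=> w; rewrite normrM mulr_ile1 ?norm_parity.
rewrite E_sum; last by move=> k _; have [] := spl k.
apply: eq_bigr => k _; have [_ ->] := spl k.
rewrite (E_parity2 P s N s_gt0 ppN)//; first exact: grid_ge.
by rewrite (le_trans _ tu)// grid_le_last ?(leq_ltn_trans (leq0n k))// ltnW.
Qed.

Lemma mesh_cvg (c : R) : c / n.+1%:R @[n --> \oo] --> (0 : R).
Proof. by rewrite -(mulr0 c); apply: cvgM; [exact: cvg_cst|exact: cvg_harmonic]. Qed.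

Lemma ito_sum_cvg t : 0 < t ->
  E (fun w => (M t w - ito_sum t n.+1 w) ^+ 2) @[n --> \oo] --> (0 : R).
Proof.
move=> t0; pose C := 4 * s * t * (m ^+ 2 * t ^+ 2 + v * t).
apply: (squeeze_cvgr _ (cvg_cst 0) (mesh_cvg C)).
apply: nearW => n; apply/andP; split; first by apply: E_ge0 => w; exact: sqr_ge0.
have [_ /le_trans] := ito_sum_error t n.+1 t0 isT; apply.
rewrite le_eqVlt /C; apply/orP; left; apply/eqP; ring.
Qed.

Lemma cvg_norm_le (u : nat -> R) (l C : R) : u n @[n --> \oo] --> l ->
  (forall n, `|u n| <= C) -> `|l| <= C.
Proof.
move=> ul uC; have nul : `|u n| @[n --> \oo] --> `|l| by exact: cvg_norm.
rewrite -(cvg_lim _ nul)//; apply: limr_le; first exact: cvgP nul.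
exact: nearW.
Qed.

(** The parity decorrelates at rate [2 s], so the parity at time [u] only
    remembers a stretch of the integral of length [1 / (2 s)]. *)
Lemma E_parity_signed_diff_le t u kappa (G : T -> R) : 0 < t -> t <= u ->
  adapted events_W G -> L2 G ->
  (forall K k, (k < K)%N ->
     `|E (fun w => G w * grid_incr 0 t K k w)| <= kappa * (t / K%:R)) ->
  `|E (fun w => G w * eps u w * M t w)| <= kappa / (2 * s).
Proof.
move=> t0 tu aG G2 Gk; have t0' := ltW t0.
have g2 : L2 (fun w => G w * eps u w).
  under eq_fun do rewrite mulrC.
  by apply: (bounded_mul_L2 P _ _ 1); [exact: measurable_parity|exact: norm_parity|].
have kappa0 : 0 <= kappa.
  have := le_trans (normr_ge0 _) (Gk 1%N 0%N isT); rewrite divr1 pmulr_lge0//.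
apply: (cvg_norm_le _ _ _ (L2_cvg_dot P (fun n => ito_sum t n.+1) (M t) _ g2
  (signed_diff_L2 t t0') (fun n => ito_sum_L2 t n.+1 t0') (ito_sum_cvg t t0))) => n.
rewrite parity_ito_split// (le_trans (ler_norm_sum _ _ _))//.
apply: (@le_trans _ _ (kappa * \sum_(k < n.+1)
    expR (- (2 * s * (t - grid 0 t n.+1 k))) * (t / n.+1%:R))).
  rewrite mulr_sumr; apply: ler_sum => k _; rewrite normrM ger0_norm ?expR_ge0//.
  rewrite [leRHS]mulrCA; apply: ler_pM; [exact: expR_ge0|exact: normr_ge0| |exact: Gk].
  by rewrite ler_expR lerN2 ler_pM2l ?mulr_gt0// lerB.
by rewrite ler_wpM2l// sum_exp_grid_le.
Qed.

Lemma E_parity_signed_diff t u : 0 < t -> t <= u ->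
  `|E (fun w => eps u w * M t w)| <= `|m| / (2 * s).
Proof.
move=> t0 tu; have t0' := ltW t0.
have := E_parity_signed_diff_le t u `|m| (fun=> 1) t0 tu (adapted_cst _ 1) (L2_cst P 1).
under eq_Rintegral do rewrite mul1r; apply => K k kK.
under eq_Rintegral do rewrite mul1r.
rewrite /grid_incr E_drive_incr ?grid_ge// ?grid_le// grid_step subr0 normrM.
by rewrite ler_wpM2l// ger0_norm// divr_ge0.
Qed.

(** ** Covariances with the noise of the sum and the quadratic growth *)

(** The centred Brownian part of [X + Y]. *)
Definition noise_sum (t : R) (w : T) : R := noise1 0 t w + noise2 0 t w.

Lemma noise_sum_L2 t : 0 <= t -> L2 (noise_sum t).
Proof. by move=> t0; apply: L2D; [exact: noise1_L2|exact: noise2_L2]. Qed.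

Lemma adapted_noise_sum t : 0 <= t -> adapted events_W (noise_sum t).
Proof.
move=> t0; apply: adaptedD; apply: adaptedM; try exact: adapted_cst.
  by apply: adaptedB; exact: adapted_W1.
by apply: adaptedB; exact: adapted_W2.
Qed.

Lemma E_noise_sum t : 0 <= t -> E (noise_sum t) = 0.
Proof.
move=> t0; rewrite ED; [|exact/L2_L1/noise1_L2|exact/L2_L1/noise2_L2].
by rewrite E_noise1// E_noise2// addr0.
Qed.

Lemma E_noise_sum_incr t K k : 0 <= t -> (k < K)%N ->
  E (fun w => noise_sum t w * grid_incr 0 t K k w)
  = (sigma1 ^+ 2 - sigma2 ^+ 2) * (t / K%:R).
Proof.
move=> t0 kK; have K0 : (0 < K)%N by exact: leq_ltn_trans kK.
set a := grid 0 t K k; set b := grid 0 t K k.+1.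
have a0 : 0 <= a by exact: grid_ge.
have ab : a <= b by exact: grid_le.
have bt : b <= t by exact: grid_le_last.
have h : b - a = t / K%:R by rewrite grid_step subr0.
have nt1 := noise1_L2 0 t (lexx 0) t0; have nt2 := noise2_L2 0 t (lexx 0) t0.
have n1 := noise1_L2 a b a0 ab; have n2 := noise2_L2 a b a0 ab.
have p11 := L2M_L1 P _ _ nt1 n1; have p12 := L2M_L1 P _ _ nt1 n2.
have p21 := L2M_L1 P _ _ n1 nt2; have p22 := L2M_L1 P _ _ nt2 n2.
transitivity (E (fun w => m * (b - a) * noise_sum t w
  + ((noise1 0 t w * noise1 a b w - noise1 0 t w * noise2 a b w)
  + (noise1 a b w * noise2 0 t w - noise2 0 t w * noise2 a b w)))).
  by apply: eq_Rintegral => w _; rewrite /grid_incr drive_incr /noise_sum -/a -/b; ring.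
have q1 := L1B P _ _ p11 p12; have q2 := L1B P _ _ p21 p22.
rewrite ED; [|exact/L1Z/L2_L1/noise_sum_L2|exact: L1D].
rewrite EZ; last exact/L2_L1/noise_sum_L2.
rewrite E_noise_sum// mulr0 add0r ED// (EB P _ _ p11 p12) (EB P _ _ p21 p22).
rewrite (E_noise1M 0 t a b (b - a))//; last exact: bm_total_incr.
rewrite (E_noise2M 0 t a b (b - a))//; last exact: bm_total_incr.
rewrite !E_noise12// h; ring.
Qed.

Lemma E_noise_parity_signed_diff t u : 0 < t -> t <= u ->
  `|E (fun w => noise_sum t w * eps u w * M t w)| <= v / (2 * s).
Proof.
move=> t0 tu; have t0' := ltW t0; apply: E_parity_signed_diff_le => //.
- exact: adapted_noise_sum.
- exact: noise_sum_L2.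
move=> K k kK; rewrite E_noise_sum_incr// normrM.
have h0 : 0 <= t / K%:R by rewrite divr_ge0.
rewrite (ger0_norm h0) ler_wpM2r// ler_norml.
have := sqr_ge0 sigma1; have := sqr_ge0 sigma2.
by move: (sigma1 ^+ 2) (sigma2 ^+ 2) => p q; lra.
Qed.

(** In natural numbers [(k - l) + (l - k)] is the distance of [k] and [l]. The
    factor [(1 - q) ^+ 2] clears the denominators of the geometric sums. *)
Lemma sum_geometric_dist (q : R) K :
  (1 - q) ^+ 2 * (\sum_(k < K) \sum_(l < K) q ^+ ((k - l) + (l - k)))
  = K%:R * (1 - q ^+ 2) - 2 * q * (1 - q ^+ K).
Proof.
have col n : (1 - q) * (\sum_(k < n) q ^+ (n - k)) = q - q ^+ n.+1.
  elim: n => [|n IH]; first by rewrite big_ord0 expr1; ring.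
  rewrite big_ord_recl subn0 mulrDr.
  under eq_bigr do rewrite /= /bump add1n subSS.
  by rewrite IH !exprS; ring.
elim: K => [|K IH]; first by rewrite big_ord0 expr0; ring.
rewrite big_ord_recr/=.
have -> : \sum_(k < K) \sum_(l < K.+1) q ^+ ((k - l) + (l - k))
    = \sum_(k < K) \sum_(l < K) q ^+ ((k - l) + (l - k)) + \sum_(k < K) q ^+ (K - k).
  rewrite -big_split/=; apply: eq_bigr => k _; rewrite big_ord_recr/=.
  by rewrite (_ : (k - K)%N = 0%N) ?add0n//; apply/eqP; rewrite subn_eq0 ltnW.
have -> : \sum_(l < K.+1) q ^+ ((K - l) + (l - K)) = \sum_(k < K) q ^+ (K - k) + 1.
  rewrite big_ord_recr/= subnn expr0; congr (_ + _); apply: eq_bigr => l _.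
  by rewrite (_ : (l - K)%N = 0%N) ?addn0//; apply/eqP; rewrite subn_eq0 ltnW.
rewrite !mulrDr IH expr2 -[(1 - q) * (1 - q) * \sum_(k < K) q ^+ (K - k)]mulrA col.
rewrite -natr1 !exprS; ring.
Qed.

(** Squeezed by [1 - exp (- y) <= y <= exp y - 1]. *)
Lemma cvg_mesh_ratio (c : R) : 0 < c ->
  c / n.+1%:R / (1 - expR (- (2 * s * (c / n.+1%:R)))) @[n --> \oo] --> (2 * s)^-1.
Proof.
move=> c0; have s20 : 0 < 2 * s by rewrite mulr_gt0.
have e1 : expR (2 * s * (c / n.+1%:R)) @[n --> \oo] --> expR 0.
  apply: (@continuous_cvg _ _ _ _ _ _ expR); first exact: continuous_expR.
  by rewrite -(mulr0 (2 * s)); apply: cvgM; [exact: cvg_cst|exact: mesh_cvg].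
have up : (2 * s)^-1 * expR (2 * s * (c / n.+1%:R)) @[n --> \oo] --> (2 * s)^-1.
  rewrite -[X in _ --> X]mulr1; apply: cvgM; first exact: cvg_cst.
  by rewrite expR0 in e1.
apply: (squeeze_cvgr _ (cvg_cst _) up); apply: nearW => n.
set h := c / n.+1%:R; have h0 : 0 < h by rewrite divr_gt0.
have y_gt0 : 0 < 2 * s * h by rewrite mulr_gt0.
have lt1 : 0 < 1 - expR (- (2 * s * h)) by rewrite subr_gt0 expR_lt1 oppr_lt0.
have le1 := expR_ge1Dx (- (2 * s * h)).
have le2 := expR_ge1Dx (2 * s * h).
have e0 := expR_gt0 (- (2 * s * h)).
have ee : expR (- (2 * s * h)) * expR (2 * s * h) = 1 by rewrite -expRD addNr expR0.
apply/andP; split.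
  rewrite ler_pdivlMr// mulrC ler_pdivrMr//; lra.
rewrite ler_pdivrMr// -[leRHS]mulrA -(ler_pM2l s20) mulVKf ?gt_eqF//.
by rewrite mulrBr mulr1 [expR _ * expR _]mulrC ee; lra.
Qed.

(** The parities of the jumps in disjoint intervals are independent, so each pair of
    cells contributes [exp (- 2 s (u - t))] times the covariance
    [exp (- 2 s |r - r'|)] of the parity. The resulting Riemann sum of its double
    integral is a geometric sum, evaluated exactly before the limit. *)
Lemma E_parity_signed_diff_sqr t u : 0 < t -> t <= u ->
  E (fun w => eps t w * eps u w * M t w ^+ 2) = expR (- (2 * s * (u - t))) *
    (m ^+ 2 * (t / s - (1 - expR (- (2 * s * t))) / (2 * s ^+ 2)) + v * t).
Proof.
move=> t0 tu; have t0' := ltW t0; have u0 := le_trans t0' tu.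
have aF : adapted events_N (fun w => eps t w * eps u w).
  by apply: adaptedM; exact: adapted_parity.
have F1 w : `|eps t w * eps u w| <= 1 by rewrite normrM mulr_ile1 ?norm_parity.
have mF := adapted_N_measurable _ aF.
have lim1 := L2_cvg_sqr P (fun n => ito_sum t n.+1) (M t) _ mF F1
  (signed_diff_L2 t t0') (fun n => ito_sum_L2 t n.+1 t0') (ito_sum_cvg t t0).
set r := expR (- (2 * s * (u - t))).
pose q n := expR (- (2 * s * (t / n.+1%:R))).
pose x n := t / n.+1%:R / (1 - q n).
have q1 n : 0 < 1 - q n.
  by rewrite subr_gt0 -expR0 ltr_expR oppr_lt0 !mulr_gt0// invr_gt0.
have exact_n n : E (fun w => eps t w * eps u w * ito_sum t n.+1 w ^+ 2)
    = r * (m ^+ 2 * (t * x n * (1 + q n)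
        - 2 * q n * (1 - expR (- (2 * s * t))) * x n ^+ 2) + v * t).
  have qK : q n ^+ n.+1 = expR (- (2 * s * t)).
    rewrite -expRM_natl; congr expR; field.
    by rewrite addrC natr1 pnatr_eq0.
  have four k l : (k < n.+1)%N -> (l < n.+1)%N -> (k <= l)%N ->
      E (fun w => eps t w * eps u w * (eps (grid 0 t n.+1 k) w * eps (grid 0 t n.+1 l) w))
      = r * q n ^+ ((k - l) + (l - k)).
    move=> kK lK kl; under eq_Rintegral do rewrite mulrC.
    rewrite (E_parity4 P s N s_gt0 ppN)//; last 3 first.
    - exact: grid_ge.
    - exact: grid_le.
    - by apply: grid_le_last => //; exact: ltnW.
    rewrite mulrC -/r; congr (_ * _).
    rewrite (_ : (k - l)%N = 0%N) ?add0n; last by apply/eqP; rewrite subn_eq0.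
    rewrite -expRM_natl; congr expR; rewrite /grid subr0 natrB//; ring.
  rewrite (E_weighted_sum_sqr 0 t 1 n.+1 (fun k => eps (grid 0 t n.+1 k)))//; last first.
  - by move=> k w _; exact: norm_parity.
  - by move=> k _; apply: adapted_parity; exact: grid_ge.
  transitivity (\sum_(k < n.+1) \sum_(l < n.+1) (r * m ^+ 2 * (t / n.+1%:R) ^+ 2)
      * q n ^+ ((k - l) + (l - k)) + \sum_(k < n.+1) r * v * (t / n.+1%:R)).
    rewrite -big_split/=; apply: eq_bigr => k _.
    have -> : r * v * (t / n.+1%:R) = \sum_(l < n.+1) r * q n ^+ ((k - l) + (l - k))
        * (v * (t / n.+1%:R) * (k == l)%:R).
      rewrite (bigD1 k)//= eqxx subnn addn0 expr0 !mulr1 big1 ?addr0; last first.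
        by move=> l lk; rewrite eq_sym (negbTE lk) !mulr0.
      by rewrite mulrA.
    rewrite -big_split/=; apply: eq_bigr => l _.
    rewrite subr0; have [kl|/ltnW lk] := leqP k l.
      by rewrite four//; ring.
    under eq_Rintegral do rewrite [eps (grid 0 t n.+1 k) _ * _]mulrC.
    by rewrite four// addnC; ring.
  under eq_bigr do rewrite -mulr_sumr.
  rewrite -mulr_sumr sumr_const card_ord -mulr_natr.
  have := sum_geometric_dist (q n) n.+1; rewrite qK.
  set S := \sum_(k < n.+1) _ => HS.
  have -> : S = (n.+1%:R * (1 - q n ^+ 2) - 2 * q n * (1 - expR (- (2 * s * t))))
      / (1 - q n) ^+ 2.
    by rewrite -HS mulrC mulKf// expf_neq0// gt_eqF.
  rewrite /x; have := q1 n; move: (q n) (expR (- (2 * s * t))) => p e p1.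
  by field; rewrite gt_eqF// addrC natr1 pnatr_eq0.
have {}lim1 : r * (m ^+ 2 * (t * x n * (1 + q n)
    - 2 * q n * (1 - expR (- (2 * s * t))) * x n ^+ 2) + v * t) @[n --> \oo] -->
    E (fun w => eps t w * eps u w * M t w ^+ 2).
  by under eq_cvg do rewrite -exact_n.
have cx : x n @[n --> \oo] --> (2 * s)^-1 := cvg_mesh_ratio t t0.
have cq : q n @[n --> \oo] --> (1 : R).
  have -> : q = (fun n => 1 - t / n.+1%:R / x n).
    apply/funext => n; rewrite /x; have := q1 n; move: (q n) => p p1.
    by field; rewrite !gt_eqF//= addrC natr1.
  rewrite -[X in _ --> X]subr0; apply: cvgB; first exact: cvg_cst.
  rewrite -(mul0r (2 * s)^-1^-1); apply: cvgM; first exact: mesh_cvg.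
  by apply: cvgV => //; rewrite invr_neq0// gt_eqF// mulr_gt0.
have lim2 : r * (m ^+ 2 * (t * x n * (1 + q n)
    - 2 * q n * (1 - expR (- (2 * s * t))) * x n ^+ 2) + v * t) @[n --> \oo] -->
  r * (m ^+ 2 * (t * (2 * s)^-1 * (1 + 1)
    - 2 * 1 * (1 - expR (- (2 * s * t))) * (2 * s)^-1 ^+ 2) + v * t).
  apply: cvgM; first exact: cvg_cst.
  apply: cvgD; last exact: cvg_cst.
  apply: cvgM; first exact: cvg_cst.
  apply: cvgB.
    apply: cvgM; first by apply: cvgM => //; exact: cvg_cst.
    by apply: cvgD => //; exact: cvg_cst.
  apply: cvgM; last by apply: cvgM.
  apply: cvgM; last exact: cvg_cst.
  by apply: cvgM => //; exact: cvg_cst.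
rewrite (cvg_unique _ lim1 lim2)//; congr (_ * (_ * _ + _)).
by field; rewrite gt_eqF.
Qed.

(** ** Growth of the covariances *)

Local Notation cov f g := (fine (covariance P f g)).

(** Almost surely [X] for [sg = 1] and [Y] for [sg = -1]: half of [X + Y] plus
    [sg] times [X - Y], in terms of the noise and of the signed difference. *)
Definition component (sg t : R) (w : T) : R :=
  2^-1 * (x0 + y0 + (mu1 + mu2) * t + noise_sum t w
    + sg * (eps t w * (M t w + (x0 - y0)))).

(** The swap integrals of [X] and [Y] are opposite, so they cancel in the sum; the
    difference is recovered by multiplying [M] with the parity once more. *)
Lemma ae_components t : 0 <= t ->
  {ae P, forall w, X t w = component 1 t w /\ Y t w = component (-1) t w}.
Proof.
move=> t0; case: XY_bsp => -[[W10 _ _ _] [W20 _ _ _] [N0 _ _ _]] _ _ XY0 XYeq.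
apply: filterS (filterI W10 (filterI W20 (filterI N0 (filterI XY0 XYeq)))).
move=> w [w1 [w2 [n0 [[X0 Y0] eqs]]]].
have [/= Xt Yt] := eqs t t0.
set I := counting_integral _ _ _ in Xt.
have I' : counting_integral
    (fun u => left_limit (fun t => X t w) u - left_limit (fun t => Y t w) u)
    (fun t => (N t w)%:R) t = - I.
  rewrite /I /counting_integral -mulN1r mulr_fsumr; apply: eq_fsbigr => u _.
  by rewrite mulN1r -mulNr opprB.
rewrite I' in Yt.
have sumE : X t w + Y t w = x0 + y0 + (mu1 + mu2) * t + noise_sum t w.
  by rewrite Xt Yt X0 Y0 /noise_sum /noise1 /noise2 w1 w2; ring.
have diffE : eps t w * (M t w + (x0 - y0)) = X t w - Y t w.
  have eps0 : eps 0 w = 1 by rewrite /parity n0.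
  rewrite /signed_diff eps0 X0 Y0 mul1r subrK mulrA -expr2.
  by rewrite (parity_sqr P N) mul1r.
by rewrite /component -sumE diffE; split; field.
Qed.

Lemma measurable_component sg t : 0 <= t -> measurable_fun setT (component sg t).
Proof.
move=> t0; apply: measurable_funM => //; apply: measurable_funD.
  apply: measurable_funD => //; exact: (L2_measurable P _ (noise_sum_L2 t t0)).
apply: measurable_funM => //; apply: measurable_funM; first exact: measurable_parity.
by apply: measurable_funD => //; exact: measurable_signed_diff.
Qed.

(** The part of twice the component at time [u] that grows with [t]. Stopping both
    integrals at [t] lets the components at different times share the same noise;
    only the parity is taken at time [u]. *)
Definition leading (sg t u : R) (w : T) : R := noise_sum t w + sg * (eps u w * M t w).

Definition remainder (sg t u : R) (w : T) : R :=
  (noise_sum u w - noise_sum t w)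
  + sg * (eps u w * ((M u w - M t w) + (x0 - y0))).

Lemma component_split sg t u w : 2 * component sg u w =
  x0 + y0 + (mu1 + mu2) * u + (leading sg t u w + remainder sg t u w).
Proof. by rewrite /component /leading /remainder; field. Qed.

Lemma parity_mul_L2 u f : L2 f -> L2 (fun w => eps u w * f w).
Proof.
by apply: (bounded_mul_L2 P _ _ 1); [exact: measurable_parity|exact: norm_parity].
Qed.

Lemma leading_L2 sg t u : 0 <= t -> L2 (leading sg t u).
Proof.
move=> t0; apply: L2D; first exact: noise_sum_L2.
by apply: L2Z; apply: parity_mul_L2; exact: signed_diff_L2.
Qed.

Lemma remainder_L2 sg t u : 0 <= t -> t <= u -> L2 (remainder sg t u).
Proof.
move=> t0 tu; have u0 := le_trans t0 tu; apply: L2D.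
  by apply: L2B; exact: noise_sum_L2.
apply: L2Z; apply: parity_mul_L2; apply: L2D; last exact: L2_cst.
by have [] := signed_diff_incr t u t0 tu.
Qed.

Lemma E_remainder_le sg t u : sg ^+ 2 = 1 -> 0 <= t -> t <= u ->
  E (fun w => remainder sg t u w ^+ 2)
    <= 4 * (v * (u - t)) + 4 * (m ^+ 2 * (u - t) ^+ 2 + v * (u - t))
       + 4 * (x0 - y0) ^+ 2.
Proof.
move=> sg1 t0 tu; have u0 := le_trans t0 tu.
have [Mi2 Mi] := signed_diff_incr t u t0 tu.
have n1 := noise1_L2 t u t0 tu; have n2 := noise2_L2 t u t0 tu.
have nI2 := L2B P _ _ (noise_sum_L2 u u0) (noise_sum_L2 t t0).
have jL2 : L2 (fun w => M u w - M t w + (x0 - y0)) by apply: L2D => //; exact: L2_cst.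
have jL2' : L2 (fun w => sg * (eps u w * (M u w - M t w + (x0 - y0)))).
  by apply: L2Z; exact: parity_mul_L2.
have b1 : E (fun w => (noise_sum u w - noise_sum t w) ^+ 2) <= 2 * (v * (u - t)).
  have -> : E (fun w => (noise_sum u w - noise_sum t w) ^+ 2)
      = E (fun w => (noise1 t u w + noise2 t u w) ^+ 2).
    by apply: eq_Rintegral => w _; rewrite /noise_sum /noise1 /noise2; ring.
  apply: le_trans (E_sqrD_le P _ _ n1 n2) _.
  have := E_noise1M t u t u (u - t) t0 tu t0 tu (bm_var P W1 bm1 t u t0 tu).
  have := E_noise2M t u t u (u - t) t0 tu t0 tu (bm_var P W2 bm2 t u t0 tu).
  under eq_Rintegral do rewrite -expr2.
  move=> ->; under eq_Rintegral do rewrite -expr2.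
  by move=> ->; rewrite -mulrDr -mulrDl addrC.
have b2 : E (fun w => (sg * (eps u w * (M u w - M t w + (x0 - y0)))) ^+ 2)
    <= 2 * (m ^+ 2 * (u - t) ^+ 2 + v * (u - t)) + 2 * (x0 - y0) ^+ 2.
  under eq_Rintegral do rewrite exprMn sg1 mul1r exprMn (parity_sqr P N) mul1r.
  apply: le_trans (E_sqrD_le P _ _ Mi2 (L2_cst P _)) _.
  by rewrite E_cst lerD2r ler_pM2l.
apply: le_trans (E_sqrD_le P _ _ nI2 jL2') _.
lra.
Qed.

(** Linear rate, in time, of four times the covariance at lag [tau] of components
    whose signs have the product [sg]. *)
Definition growth (sg tau : R) : R := v + sg * expR (- (2 * s * tau)) * (m ^+ 2 / s + v).

Lemma E_noise_sum_sqr t : 0 <= t -> E (fun w => noise_sum t w ^+ 2) = v * t.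
Proof.
move=> t0; have n1 := noise1_L2 0 t (lexx 0) t0; have n2 := noise2_L2 0 t (lexx 0) t0.
have p11 := L2M_L1 P _ _ n1 n1; have p12 := L2M_L1 P _ _ n1 n2.
have p22 := L2M_L1 P _ _ n2 n2.
transitivity (E (fun w => noise1 0 t w * noise1 0 t w
    + (2 * (noise1 0 t w * noise2 0 t w) + noise2 0 t w * noise2 0 t w))).
  by apply: eq_Rintegral => w _; rewrite /noise_sum; ring.
have p12' := L1Z P 2 _ p12.
rewrite (ED P _ _ p11 (L1D P _ _ p12' p22)) (ED P _ _ p12' p22) EZ// E_noise12//.
rewrite (E_noise1M 0 t 0 t (t - 0))//; last by rewrite -(bm_var P W1 bm1 0 t).
rewrite (E_noise2M 0 t 0 t (t - 0))//; last by rewrite -(bm_var P W2 bm2 0 t).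
ring.
Qed.

(** The squares of [noise_sum] and of [M] give the two terms of [growth]; the mixed
    terms stay bounded. The case [u = t] serves the covariance at a lag, the case
    [u = u'] the variance at the later time. *)
Lemma E_leadingM sg sg' t u u' : sg ^+ 2 = 1 -> sg' ^+ 2 = 1 -> 0 < t -> t <= u ->
  u <= u' -> (u = t \/ u = u') ->
  `|E (fun w => leading sg t u w * leading sg' t u' w)
    - growth (sg * sg') (u' - u) * t| <= v / s + m ^+ 2 / s ^+ 2.
Proof.
move=> sg1 sg'1 t0 tu uu' cases; have t0' := ltW t0; have tu' := le_trans tu uu'.
have n2 := noise_sum_L2 t t0'; have M2 := signed_diff_L2 t t0'.
have e1 := parity_mul_L2 u _ M2; have e2 := parity_mul_L2 u' _ M2.
have p1 := L2_sqr P _ n2; have p2 := L2M_L1 P _ _ n2 e1.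
have p3 := L2M_L1 P _ _ n2 e2; have p4 := L2M_L1 P _ _ e1 e2.
have z2 := L1Z P sg _ p2; have z3 := L1Z P sg' _ p3; have z4 := L1Z P (sg * sg') _ p4.
have main : `|E (fun w => eps u w * M t w * (eps u' w * M t w))
    - expR (- (2 * s * (u' - u))) * (m ^+ 2 / s + v) * t| <= m ^+ 2 / (2 * s ^+ 2).
  have -> : E (fun w => eps u w * M t w * (eps u' w * M t w))
      = expR (- (2 * s * (u' - u))) *
    (m ^+ 2 * (t / s - (1 - expR (- (2 * s * t))) / (2 * s ^+ 2)) + v * t).
    case: cases => [->|->].
      rewrite -(E_parity_signed_diff_sqr t u')//.
      by apply: eq_Rintegral => w _; ring.
    rewrite subrr; have := E_parity_signed_diff_sqr t t t0 (lexx _); rewrite subrr => <-.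
    apply: eq_Rintegral => w _; have := parity_sqr P N u' w; have := parity_sqr P N t w.
    by rewrite !expr2 => -> h; rewrite mul1r mulrACA h mul1r.
  set e := expR (- (2 * s * (u' - u))); set e' := expR (- (2 * s * t)).
  have e0 : 0 <= e by exact: expR_ge0.
  have e'0 : 0 <= e' by exact: expR_ge0.
  have e_1 : e <= 1.
    by rewrite /e -expR0 ler_expR oppr_le0 !mulr_ge0 ?subr_ge0// ltW.
  have e'1 : e' <= 1 by rewrite /e' -expR0 ler_expR oppr_le0 !mulr_ge0// ltW.
  rewrite (_ : _ - _ = - (e * (1 - e') * (m ^+ 2 / (2 * s ^+ 2)))); last first.
    by field; rewrite gt_eqF.
  have q0 : 0 <= m ^+ 2 / (2 * s ^+ 2) by apply: divr_ge0; [exact: sqr_ge0|rewrite mulr_ge0 ?sqr_ge0].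
  rewrite normrN ger0_norm; last first.
    by apply: mulr_ge0 => //; apply: mulr_ge0 => //; rewrite subr_ge0.
  rewrite -[leRHS]mul1r ler_wpM2r// mulr_ile1 ?subr_ge0//.
  by rewrite lerBlDr lerDl.
have c1 := E_noise_parity_signed_diff t u t0 tu.
have c2 := E_noise_parity_signed_diff t u' t0 tu'.
have -> : E (fun w => leading sg t u w * leading sg' t u' w)
  = v * t + (sg * E (fun w => noise_sum t w * eps u w * M t w)
    + (sg' * E (fun w => noise_sum t w * eps u' w * M t w)
    + sg * sg' * E (fun w => eps u w * M t w * (eps u' w * M t w)))).
  have -> : E (fun w => noise_sum t w * eps u w * M t w)
      = E (fun w => noise_sum t w * (eps u w * M t w)).
    by apply: eq_Rintegral => w _; rewrite mulrA.
  have -> : E (fun w => noise_sum t w * eps u' w * M t w)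
      = E (fun w => noise_sum t w * (eps u' w * M t w)).
    by apply: eq_Rintegral => w _; rewrite mulrA.
  rewrite -E_noise_sum_sqr// -!EZ//.
  have w1 := L1D P _ _ z3 z4; have w2 := L1D P _ _ z2 w1.
  rewrite -(ED P _ _ z3 z4) -(ED P _ _ z2 w1) -(ED P _ _ p1 w2).
  by apply: eq_Rintegral => w _; rewrite /leading; ring.
have sgn (z : R) : z ^+ 2 = 1 -> `|z| = 1.
  by move=> z1; apply/eqP; rewrite -(@eqrXn2 _ 2)// real_normK ?num_real// z1 expr1n.
move: main c1 c2.
set A1 := E _; set A2 := E _; set A3 := E _ => main c1 c2.
rewrite (_ : _ - _ = sg * A2 + (sg' * A3
  + sg * sg' * (A1 - expR (- (2 * s * (u' - u))) * (m ^+ 2 / s + v) * t))); last first.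
  rewrite /growth; ring.
apply: le_trans (ler_normD _ _) _; rewrite normrM (sgn sg)// mul1r.
apply: (@le_trans _ _ (v / (2 * s) + (v / (2 * s) + m ^+ 2 / (2 * s ^+ 2)))).
  apply: lerD => //; apply: le_trans (ler_normD _ _) _.
  by rewrite !normrM (sgn sg)// (sgn sg')// !mul1r; apply: lerD.
rewrite -subr_ge0 (_ : _ - _ = m ^+ 2 / (2 * s ^+ 2)); last by field; rewrite gt_eqF.
by apply: divr_ge0; [exact: sqr_ge0|rewrite mulr_ge0 ?sqr_ge0].
Qed.

Lemma E_leading_le sg t u : sg ^+ 2 = 1 -> 0 < t -> t <= u ->
  `|E (leading sg t u)| <= `|m| / (2 * s).
Proof.
move=> sg1 t0 tu; have t0' := ltW t0.
have e1 := L2_L1 P _ (parity_mul_L2 u _ (signed_diff_L2 t t0')).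
rewrite ED; [|exact/L2_L1/noise_sum_L2|exact: L1Z].
rewrite E_noise_sum// add0r EZ// normrM.
have -> : `|sg| = 1.
  by apply/eqP; rewrite -(@eqrXn2 _ 2)// real_normK ?num_real// sg1 expr1n.
by rewrite mul1r; exact: E_parity_signed_diff.
Qed.

Lemma cov_leading sg sg' t u u' : sg ^+ 2 = 1 -> sg' ^+ 2 = 1 -> 0 < t -> t <= u ->
  u <= u' -> (u = t \/ u = u') ->
  `|cov (leading sg t u) (leading sg' t u') - growth (sg * sg') (u' - u) * t|
  <= v / s + 2 * (m ^+ 2 / s ^+ 2).
Proof.
move=> sg1 sg'1 t0 tu uu' cases; have t0' := ltW t0; have tu' := le_trans tu uu'.
rewrite cov_E; [|exact: leading_L2|exact: leading_L2].
have h1 := E_leadingM sg sg' t u u' sg1 sg'1 t0 tu uu' cases.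
have h2 := E_leading_le sg t u sg1 t0 tu; have h3 := E_leading_le sg' t u' sg'1 t0 tu'.
rewrite (_ : _ - _ - _ = (E (fun w => leading sg t u w * leading sg' t u' w)
  - growth (sg * sg') (u' - u) * t) - E (leading sg t u) * E (leading sg' t u'));
  last by ring.
apply: le_trans (ler_normB _ _) _.
apply: (@le_trans _ _ (v / s + m ^+ 2 / s ^+ 2 + (`|m| / (2 * s)) * (`|m| / (2 * s)))).
  by apply: lerD => //; rewrite normrM; apply: ler_pM.
rewrite -subr_ge0 (_ : _ - _ = 3 / 4 * (m ^+ 2 / s ^+ 2)); last first.
  have <- : `|m| ^+ 2 = m ^+ 2 by rewrite real_normK ?num_real.
  by field; rewrite gt_eqF.
by rewrite mulr_ge0 ?divr_ge0 ?sqr_ge0.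
Qed.

Lemma cov_component_asymptotics sg sg' tau : sg ^+ 2 = 1 -> sg' ^+ 2 = 1 -> 0 <= tau ->
  exists C, forall t u u', 1 <= t -> t <= u -> u' = t + tau -> (u = t \/ u = u') ->
  `|4 * cov (component sg u) (component sg' u') - growth (sg * sg') (u' - u) * t|
    <= C * Num.sqrt t.
Proof.
move=> sg1 sg'1 tau0.
have s0 := ltW s_gt0.
have v0 : 0 <= v by rewrite addr_ge0 ?sqr_ge0.
pose c0 := v / s + 2 * (m ^+ 2 / s ^+ 2).
have ms0 : 0 <= m ^+ 2 / s ^+ 2 by rewrite divr_ge0 ?sqr_ge0.
have vs0 : 0 <= v / s by rewrite divr_ge0.
have c00 : 0 <= c0 by rewrite addr_ge0// mulr_ge0.
pose cr := 4 * (v * tau) + 4 * (m ^+ 2 * tau ^+ 2 + v * tau) + 4 * (x0 - y0) ^+ 2.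
have cr0 : 0 <= cr.
  have vt : 0 <= v * tau by rewrite mulr_ge0.
  have mt : 0 <= m ^+ 2 * tau ^+ 2 by rewrite mulr_ge0 ?sqr_ge0.
  by have := sqr_ge0 (x0 - y0); rewrite /cr; lra.
pose cg := growth 1 0.
have cg0 : 0 <= cg.
  rewrite /cg /growth mulr0 oppr0 expR0 !mul1r.
  have m2s : 0 <= m ^+ 2 / s by rewrite divr_ge0 ?sqr_ge0.
  by move: m2s v0; lra.
pose c := Num.sqrt (c0 + cr + cg).
have cc : c ^+ 2 = c0 + cr + cg by rewrite sqr_sqrtr//; apply: addr_ge0 => //; apply: addr_ge0.
exists (7 * c ^+ 2) => t u u' t1 tu u'E cases.
have t0 : 0 < t by exact: lt_le_trans ltr01 t1.
have t0' := ltW t0.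
have tu' : t <= u' by rewrite u'E lerDl.
have uu' : u <= u' by case: cases => ->.
have sq_leading z p : z ^+ 2 = 1 -> t <= p ->
    E (fun w => leading z t p w ^+ 2) <= c ^+ 2 * t.
  move=> z1 tp; have := E_leadingM z z t p p z1 z1 t0 tp (lexx _) (or_intror erefl).
  rewrite -expr2 z1 subrr -/cg; under eq_Rintegral do rewrite -expr2.
  rewrite ler_norml => /andP[_]; rewrite lerBlDr => /le_trans; apply.
  rewrite cc /c0 -subr_ge0.
  set p1 := v / s; set p2 := m ^+ 2 / s ^+ 2.
  have p10 : 0 <= p1 by [].
  have p20 : 0 <= p2 by [].
  rewrite (_ : _ - _ = (p1 + p2) * (t - 1) + (p2 + cr) * t); last by ring.
  by rewrite addr_ge0// mulr_ge0 ?subr_ge0// addr_ge0.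
have sq_remainder z p : z ^+ 2 = 1 -> t <= p -> p <= u' ->
    E (fun w => remainder z t p w ^+ 2) <= c ^+ 2.
  move=> z1 tp pu'; apply: le_trans (E_remainder_le z t p z1 t0' tp) _.
  have ptau : p - t <= tau by rewrite lerBlDl -u'E.
  have pt0 : 0 <= p - t by rewrite subr_ge0.
  apply: (@le_trans _ _ cr); last by rewrite cc -addrA addrCA lerDl addr_ge0.
  rewrite /cr lerD2r; apply: lerD; rewrite ler_pM2l//; first by rewrite ler_wpM2l.
  apply: lerD; rewrite ler_wpM2l ?sqr_ge0//.
  by rewrite lerXn2r ?nnegrE.
have := cov_perturbation P (leading sg t u) (leading sg' t u') (remainder sg t u)
  (remainder sg' t u') (x0 + y0 + (mu1 + mu2) * u) (x0 + y0 + (mu1 + mu2) * u')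
  c t (growth (sg * sg') (u' - u)) (leading_L2 _ _ _ t0') (leading_L2 _ _ _ t0')
  (remainder_L2 _ _ _ t0' tu) (remainder_L2 _ _ _ t0' tu') t1 (sqrtr_ge0 _)
  (sq_leading _ _ sg1 tu) (sq_leading _ _ sg'1 tu')
  (sq_remainder _ _ sg1 tu uu') (sq_remainder _ _ sg'1 tu' (lexx _)).
have cL : `|cov (leading sg t u) (leading sg' t u') - growth (sg * sg') (u' - u) * t|
    <= c ^+ 2.
  apply: le_trans (cov_leading sg sg' t u u' sg1 sg'1 t0 tu uu' cases) _.
  by rewrite cc -addrA lerDl addr_ge0.
move=> /(_ cL).
have comp_L2 z p : t <= p -> L2 (component z p).
  move=> tp; have -> : component z p = (fun w => 2^-1 * (x0 + y0 + (mu1 + mu2) * p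
      + (leading z t p w + remainder z t p w))).
    by apply/funext => w; rewrite -component_split mulrA mulVf ?mul1r.
  apply: L2Z; apply: L2D; first exact: L2_cst.
  by apply: L2D; [exact: leading_L2|exact: remainder_L2].
have double z p : (fun w => x0 + y0 + (mu1 + mu2) * p
    + (leading z t p w + remainder z t p w)) = (fun w => 2 * component z p w).
  by apply/funext => w; rewrite (component_split z t).
rewrite !double.
have cu := comp_L2 sg u tu; have cu' := comp_L2 sg' u' tu'.
rewrite cov_E; [|exact: L2Z|exact: L2Z].
rewrite (cov_E P _ _ cu cu').
rewrite (EZ P _ _ (L2_L1 P _ cu)) (EZ P _ _ (L2_L1 P _ cu')).
have -> : E (fun w => 2 * component sg u w * (2 * component sg' u' w))
    = 4 * E (fun w => component sg u w * component sg' u' w).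
  by rewrite -EZ; [apply: eq_Rintegral => w _; ring|exact: L2M_L1].
congr (`| _ - _ | <= _); ring.
Qed.

(** ** Limits of the correlations *)

(** Indexing the coordinates by signs treats auto- and cross-correlations
    together. *)
Definition coordinate (sg : R) : R -> {RV P >-> R} := if sg == 1 then X else Y.

Lemma cov_coordinates sg sg' t u : sg = 1 \/ sg = -1 -> sg' = 1 \/ sg' = -1 ->
  0 <= t -> 0 <= u ->
  cov (coordinate sg t) (coordinate sg' u) = cov (component sg t) (component sg' u).
Proof.
have N1 : (-1 == 1 :> R) = false by rewrite lt_eqF// (lt_trans _ ltr01)// oppr_lt0.
have aeE z p : z = 1 \/ z = -1 -> 0 <= p ->
    {ae P, forall w, coordinate z p w = component z p w}.
  move=> z1 p0; apply: filterS (ae_components p p0) => w [Xw Yw].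
  by rewrite /coordinate; case: z1 => ->; rewrite ?eqxx ?N1.
move=> sg1 sg'1 t0 u0; apply: cov_ae; [by []|exact: measurable_component|by []|
  exact: measurable_component|exact: aeE|exact: aeE].
Qed.

Lemma cvg_of_rate (f : R -> R) (k C : R) :
  (forall t, 1 <= t -> `|f t - k * t| <= C * Num.sqrt t) ->
  f t / t @[t --> +oo] --> k.
Proof.
move=> fk; have C0 : 0 <= C.
  by have := le_trans (normr_ge0 _) (fk 1 (lexx _)); rewrite sqrtr1 mulr1.
apply/cvgrPdist_le => e e0; near=> t.
have t1 : 1 <= t by near: t; exact: nbhs_pinfty_ge.
have tC : (C / e) ^+ 2 <= t by near: t; apply: nbhs_pinfty_ge; exact: num_real.
have t0 : 0 < t by exact: lt_le_trans ltr01 t1.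
have q0 : 0 < Num.sqrt t by rewrite sqrtr_gt0.
have qq : Num.sqrt t ^+ 2 = t by rewrite sqr_sqrtr// ltW.
have Ce : C / e <= Num.sqrt t.
  have Ce0 : 0 <= C / e by rewrite divr_ge0// ltW.
  by rewrite -(ler_pXn2r (n := 2))// ?nnegrE ?sqrtr_ge0// qq.
rewrite (_ : k - f t / t = - ((f t - k * t) / t)); last by field; rewrite gt_eqF.
rewrite normrN normrM [`|t^-1|]gtr0_norm ?invr_gt0// ler_pdivrMr//.
apply: le_trans (fk t t1) _; rewrite -[X in _ <= e * X]qq expr2 mulrA ler_pM2r//.
by rewrite mulrC -ler_pdivrMr.
Unshelve. all: by end_near. Qed.

(** The normalisation [4 / t] cancels between the covariance and the square root of
    the product of the variances. *)
Lemma corr_coordinates_cvg sg sg' tau : sg = 1 \/ sg = -1 -> sg' = 1 \/ sg' = -1 ->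
  0 < v -> 0 <= tau ->
  corr P (coordinate sg t) (coordinate sg' (t + tau)) @[t --> +oo]
    --> growth (sg * sg') tau / growth 1 0.
Proof.
move=> sg1 sg'1 v0 tau0.
have sq z : z = 1 \/ z = -1 -> z ^+ 2 = 1 :> R.
  by case=> ->; rewrite ?sqrrN expr1n.
have rate z z' (a b : R -> R) : z = 1 \/ z = -1 -> z' = 1 \/ z' = -1 ->
    (forall t, 1 <= t -> t <= a t) -> (forall t, b t = t + tau) ->
    (forall t, a t = t \/ a t = b t) -> 
    forall g, (forall t, growth (z * z') (b t - a t) = g) ->
    4 * cov (coordinate z (a t)) (coordinate z' (b t)) / t @[t --> +oo] --> g.
  move=> z1 z'1 ta bE ab g gE.
  have [C HC] := cov_component_asymptotics z z' tau (sq z z1) (sq z' z'1) tau0.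
  apply: (cvg_of_rate _ _ C) => t t1; have t0 : 0 <= t by exact: le_trans ler01 t1.
  rewrite cov_coordinates//; last by rewrite bE addr_ge0.
    by rewrite -(gE t); apply: HC => //; exact: ta.
  exact: le_trans t0 (ta t t1).
have g0 : 0 < growth 1 0.
  rewrite /growth mulr0 oppr0 expR0 !mul1r.
  have m2s : 0 <= m ^+ 2 / s by rewrite divr_ge0 ?sqr_ge0// ltW.
  by move: m2s v0; lra.
have sqz z : z = 1 \/ z = -1 -> z * z = 1 :> R by move=> z1; rewrite -expr2 sq.
have c12 := rate sg sg' id (fun t => t + tau) sg1 sg'1 (fun t _ => lexx t)
  (fun t => erefl) (fun t => or_introl erefl) (growth (sg * sg') tau).
have c22 := rate sg' sg' (fun t => t + tau) (fun t => t + tau) sg'1 sg'1.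
have {}c12 : 4 * cov (coordinate sg t) (coordinate sg' (t + tau)) / t @[t --> +oo]
    --> growth (sg * sg') tau by apply: c12 => t; rewrite addrC addKr.
have {}c22 : 4 * cov (coordinate sg' (t + tau)) (coordinate sg' (t + tau)) / t
    @[t --> +oo] --> growth 1 0.
  apply: c22 => //; [by move=> t _; rewrite lerDl|by move=> t; right|].
  by move=> t; rewrite subrr sqz.
have c11 : 4 * cov (coordinate sg t) (coordinate sg t) / t @[t --> +oo]
    --> growth 1 0.
  have [C HC] := cov_component_asymptotics sg sg 0 (sq sg sg1) (sq sg sg1) (lexx 0).
  apply: (cvg_of_rate _ _ C) => t t1; have t0 : 0 <= t by exact: le_trans ler01 t1.
  rewrite cov_coordinates//; have := HC t t t t1 (lexx t) (esym (addr0 t)) (or_introl erefl).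
  by rewrite subrr sqz.
have prod : Num.sqrt (4 * cov (coordinate sg t) (coordinate sg t) / t *
    (4 * cov (coordinate sg' (t + tau)) (coordinate sg' (t + tau)) / t)) @[t --> +oo]
    --> growth 1 0.
  have -> : growth 1 0 = Num.sqrt (growth 1 0 * growth 1 0).
    by rewrite -expr2 sqrtr_sqr gtr0_norm.
  apply: (@continuous_cvg _ _ _ _ _ _ Num.sqrt); first exact: sqrt_continuous.
  exact: cvgM.
have ratio : 4 * cov (coordinate sg t) (coordinate sg' (t + tau)) / t *
    (Num.sqrt (4 * cov (coordinate sg t) (coordinate sg t) / t *
    (4 * cov (coordinate sg' (t + tau)) (coordinate sg' (t + tau)) / t)))^-1
    @[t --> +oo] --> growth (sg * sg') tau / growth 1 0.
  by apply: cvgM => //; apply: cvgV => //; exact: lt0r_neq0.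
apply: cvg_trans ratio; apply: near_eq_cvg; near=> t.
have t0 : 0 < t by near: t; exact: nbhs_pinfty_gt.
rewrite /corr /variance /=.
set c := cov _ _; set v1 := cov _ _; set v2 := cov _ _.
have -> : 4 * v1 / t * (4 * v2 / t) = (4 / t) ^+ 2 * (v1 * v2) by ring.
rewrite sqrtrM ?sqr_ge0// sqrtr_sqr gtr0_norm ?divr_gt0// invfM.
rewrite (_ : 4 * c / t * _ = c * (Num.sqrt (v1 * v2))^-1 * (4 / t * (4 / t)^-1)); last by ring.
by rewrite mulfV ?mulr1// gt_eqF// divr_gt0.
Unshelve. all: by end_near. Qed.

End swapping_moments.

Theorem theorem5p9 (d : measure_display) (T : measurableType d) (R : realType)
    (P : probability T R) (mu1 mu2 sigma1 sigma2 s x0 y0 : R)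
    (sigma1_gt0 : 0 < sigma1) (sigma2_gt0 : 0 < sigma2) (s_gt0 : 0 < s)
    (W1 W2 : R -> {RV P >-> R}) (N : R -> {RV P >-> nat})
    (X Y : R -> {RV P >-> R})
    (XY_bsp : brownian_swapping_process mu1 mu2 sigma1 sigma2 s x0 y0
                W1 W2 N X Y) :
  let eta := (mu1 - mu2) ^+ 2 / (2 * s * (sigma1 ^+ 2 + sigma2 ^+ 2)) in
  (forall tau : R, 0 <= tau ->
    corr P (X t) (X (t + tau)) @[t --> +oo] -->
      (expR (- (2 * s * tau)) * (mu1 - mu2) ^+ 2
        + (sigma1 ^+ 2 + sigma2 ^+ 2) * s * (1 + expR (- (2 * s * tau))))
      / ((mu1 - mu2) ^+ 2 + 2 * s * (sigma1 ^+ 2 + sigma2 ^+ 2))) /\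
  (forall tau : R, 0 <= tau ->
    corr P (X t) (Y (t + tau)) @[t --> +oo] -->
      ((sigma1 ^+ 2 + sigma2 ^+ 2) * s * (1 - expR (- (2 * s * tau)))
        - (mu1 - mu2) ^+ 2 * expR (- (2 * s * tau)))
      / ((mu1 - mu2) ^+ 2 + 2 * s * (sigma1 ^+ 2 + sigma2 ^+ 2))) /\
  has_correlation_time (limit_corr P X X) (2 * s)^-1 /\
  has_correlation_time (limit_corr P X Y) (2 * s)^-1 /\
  limit_corr P X X 0 = 1 /\
  corr P (X t) (Y t) @[t --> +oo] --> - (eta / (1 + eta)) /\
  limit_corr P X Y 0 = - (eta / (1 + eta)).
Proof.
move=> eta.
set a := (mu1 - mu2) ^+ 2; set v := sigma1 ^+ 2 + sigma2 ^+ 2.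
have v0 : 0 < v by rewrite addr_gt0 ?exprn_gt0.
have a0 : 0 <= a by exact: sqr_ge0.
have sv0 : 0 < 2 * s * v by rewrite !mulr_gt0.
have den0 : 0 < a + 2 * s * v by rewrite ltr_wpDl.
have N1 : (-1 == 1 :> R) = false by rewrite lt_eqF// (lt_trans _ ltr01)// oppr_lt0.
have gE sg tau : growth mu1 mu2 sigma1 sigma2 s sg tau / growth mu1 mu2 sigma1 sigma2 s 1 0
    = (v * s + sg * expR (- (2 * s * tau)) * (a + v * s)) / (a + 2 * s * v).
  rewrite /growth mulr0 oppr0 expR0 -/a -/v; field.
  rewrite !gt_eqF//= (_ : _ + _ = a + 2 * s * v) ?gt_eqF//; ring.
have rXX tau : 0 <= tau -> corr P (X t) (X (t + tau)) @[t --> +oo] -->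
    (v * s + expR (- (2 * s * tau)) * (a + v * s)) / (a + 2 * s * v).
  move=> tau0; have := corr_coordinates_cvg P mu1 mu2 sigma1 sigma2 s x0 y0 W1 W2 N X Y
    s_gt0 XY_bsp 1 1 tau (or_introl erefl) (or_introl erefl) v0 tau0.
  by rewrite gE /coordinate eqxx !mul1r.
have rXY tau : 0 <= tau -> corr P (X t) (Y (t + tau)) @[t --> +oo] -->
    (v * s - expR (- (2 * s * tau)) * (a + v * s)) / (a + 2 * s * v).
  move=> tau0; have := corr_coordinates_cvg P mu1 mu2 sigma1 sigma2 s x0 y0 W1 W2 N X Y
    s_gt0 XY_bsp 1 (-1) tau (or_introl erefl) (or_intror erefl) v0 tau0.
  by rewrite gE /coordinate eqxx N1 mul1r !mulN1r mulNr.
have lXX tau : 0 <= tau -> limit_corr P X X tau =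
    (v * s + expR (- (2 * s * tau)) * (a + v * s)) / (a + 2 * s * v).
  by move=> /rXX ?; exact: cvg_lim.
have lXY tau : 0 <= tau -> limit_corr P X Y tau =
    (v * s - expR (- (2 * s * tau)) * (a + v * s)) / (a + 2 * s * v).
  by move=> /rXY ?; exact: cvg_lim.
have etaE : - (eta / (1 + eta)) = (v * s - expR (- (2 * s * 0)) * (a + v * s))
    / (a + 2 * s * v).
  rewrite mulr0 oppr0 expR0 /eta -/a -/v; field.
  by rewrite !gt_eqF//= addrC gt_eqF.
have c0 : (a + v * s) / (a + 2 * s * v) != 0.
  by rewrite mulf_neq0 ?invr_neq0// gt_eqF// ltr_wpDl// mulr_gt0.
split; [|split; [|split; [|split; [|split; [|split]]]]].
- move=> tau /rXX; rewrite (_ : _ / _ = (expR (- (2 * s * tau)) * a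
    + v * s * (1 + expR (- (2 * s * tau)))) / (a + 2 * s * v))//.
  by congr (_ / _); ring.
- move=> tau /rXY; rewrite (_ : _ / _ = (v * s * (1 - expR (- (2 * s * tau)))
    - a * expR (- (2 * s * tau))) / (a + 2 * s * v))//.
  by congr (_ / _); ring.
- exists (v * s / (a + 2 * s * v)), ((a + v * s) / (a + 2 * s * v)); split => // tau /lXX ->.
  by rewrite invrK (mulrC tau); field; rewrite gt_eqF.
- exists (v * s / (a + 2 * s * v)), (- ((a + v * s) / (a + 2 * s * v))).
  split; first by rewrite oppr_eq0.
  by move=> tau /lXY ->; rewrite invrK (mulrC tau); field; rewrite gt_eqF.
- rewrite lXX// mulr0 oppr0 expR0 (_ : _ + _ = a + 2 * s * v) ?divff ?gt_eqF//; ring.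
- rewrite etaE; have := rXY 0 (lexx 0).
  by under eq_cvg do rewrite addr0.
- by rewrite lXY// etaE.
Qed.
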